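(* Let $\Bbbk$ be an arbitrary field and $S=\Bbbk[x_1,\dots,x_n]$. Let $r\le n$ and let $2\le e_1\le\cdots\le e_r$ be integers. Let $I\subset S$ be a homogeneous ideal containing a regular sequence of monomials $f_1,\dots,f_r$ with $\deg f_i=e_i$ for all $i$. Put $P=(x_1^{e_1},\dots,x_r^{e_r})$, and let $L$ be a lex-plus-$P$ ideal with the same Hilbert function as $I$. Then the graded Betti numbers of $I$ are obtained from those of $L$ by consecutive cancellations.
   Context: $S$ is standard graded. The Hilbert function of a graded module $M$ is $d\mapsto\dim_{\Bbbk}M_d$, and $b_{i,j}(M)=\dim_{\Bbbk}\operatorname{Tor}^S_i(\Bbbk,M)_j$ (with $b_{i,j}(M)=0$ for $i<0$). The lexicographic order: for monomials of the same degree, $x_1^{p_1}\cdots x_n^{p_n}>_{\mathrm{lex}}x_1^{q_1}\cdots x_n^{q_n}$ if there is an $i$ with $p_i>q_i$ and $p_j=q_j$ for all $j<i$. A monomial ideal $\hat L$ is lex if, whenever $u,v$ are monomials of the same degree with $u<_{\mathrm{lex}}v$ and $u\in\hat L$, then $v\in\hat L$. An ideal $L\supseteq P$ is lex-plus-$P$ if $L=\hat L+P$ for some lex ideal $\hat L$. The graded Betti numbers of $I$ are obtained from those of $L$ by consecutive cancellations if there exist nonnegative integers $c_{i,j}$ such that, for all integers $i$ and $j$, $b_{i,j}(I)=b_{i,j}(L)-c_{i,j}-c_{i-1,j}$ (so in particular $c_{i,j}=0$ for $i<0$). *)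

(* Defs.v *)
From HB Require Import structures.
From mathcomp Require Import all_boot all_order all_algebra.
From mathcomp Require Export mpoly.

Set Implicit Arguments.
Unset Strict Implicit.
Unset Printing Implicit Defensive.

Import GRing.Theory.
Local Open Scope ring_scope.

Section Ideals.
Variables (k : fieldType) (n : nat).
Implicit Types (I J A : {mpoly k[n]} -> Prop).

(* Ideals are allowed to be improper. *)
Definition is_ideal I : Prop :=
  [/\ I 0,
      (forall p q, I p -> I q -> I (p + q))
    & (forall a p, I p -> I (a * p))].

Definition homogeneous_ideal I : Prop :=
  is_ideal I /\ (forall p d, I p -> I (pihomog mdeg d p)).

Definition same_ideal I J : Prop := forall p, I p <-> J p.

Definition ideal_add I J : {mpoly k[n]} -> Prop :=
  fun p => exists u v, [/\ I u, J v & p = u + v].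

Definition ideal_gen A : {mpoly k[n]} -> Prop :=
  fun p => exists s : seq ({mpoly k[n]} * {mpoly k[n]}),
    (forall x, x \in s -> A x.2) /\ p = \sum_(x <- s) x.1 * x.2.

Definition regular_sequence r (f : 'I_r -> {mpoly k[n]}) : Prop :=
  (forall (i : 'I_r) g,
     let J := ideal_gen (fun p => exists2 j : 'I_r, (j < i)%N & p = f j) in
     J (f i * g) -> J g) /\
  ~ ideal_gen (fun p => exists j : 'I_r, p = f j) 1.

Definition pure_powers r (hr : (r <= n)%N) (e : 'I_r -> nat) :
    {mpoly k[n]} -> Prop :=
  ideal_gen (fun p => exists i : 'I_r, p = 'X_(widen_ord hr i) ^+ e i).

(* [lex_lt q p] compares monomials of equal degree; 'X_0 is the largest
   variable. *)
Definition lex_lt (q p : 'X_{1..n}) : Prop :=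
  exists i : 'I_n, (q i < p i)%N /\ (forall j : 'I_n, (j < i)%N -> p j = q j).

Definition monomial_ideal I : Prop :=
  exists M : 'X_{1..n} -> Prop,
    same_ideal I (ideal_gen (fun p => exists2 m, M m & p = 'X_[m])).

Definition lex_ideal I : Prop :=
  monomial_ideal I /\
  (forall u v : 'X_{1..n},
     mdeg u = mdeg v -> lex_lt u v -> I 'X_[u] -> I 'X_[v]).

Definition lex_plus (P L : {mpoly k[n]} -> Prop) : Prop :=
  exists2 Lhat, lex_ideal Lhat & same_ideal L (ideal_add Lhat P).

(* [graded_dim I d h]: the degree d component of I has a k-basis with h
   elements. *)
Definition graded_dim I (d h : nat) : Prop :=
  exists b : 'I_h -> {mpoly k[n]},
    (forall p, (I p /\ p \is d.-homog) <->
               exists c : 'I_h -> k, p = \sum_i c i *: b i) /\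
    (forall c : 'I_h -> k, \sum_i c i *: b i = 0 -> forall i, c i = 0).

Definition hilbert_function I (H : nat -> nat) : Prop :=
  forall d, graded_dim I d (H d).

(* A zero entry is homogeneous of every degree, so the degree may be any
   integer. *)
Definition homog_int (d : int) (p : {mpoly k[n]}) : Prop :=
  forall m, m \in msupp p -> (mdeg m)%:Z = d.

(* A resolution ... -> F_1 -> F_0 -> I -> 0 of the graded module I by finitely
   generated graded free modules F_i = \bigoplus_a S(- res_deg i a). Elements
   of F_i are row vectors and maps act by right multiplication. *)
Record graded_free_resolution I := GradedFreeResolution {
  res_rank : nat -> nat;
  res_deg : forall i, 'I_(res_rank i) -> int;
  res_aug : 'cV[{mpoly k[n]}]_(res_rank 0);
  res_diff : forall i, 'M[{mpoly k[n]}]_(res_rank i.+1, res_rank i);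
  res_aug_homog : forall a, homog_int (res_deg a) (res_aug a 0);
  res_diff_homog : forall i a b,
    homog_int (res_deg a - res_deg b) (res_diff i a b);
  res_aug_onto : forall p, I p <-> exists v : 'rV_(res_rank 0), p = (v *m res_aug) 0 0;
  res_exact0 : forall v : 'rV_(res_rank 0),
    v *m res_aug = 0 <-> exists w : 'rV_(res_rank 1), v = w *m res_diff 0;
  res_exact : forall i (v : 'rV_(res_rank i.+1)),
    v *m res_diff i = 0 <-> exists w : 'rV_(res_rank i.+2), v = w *m res_diff i.+1
}.

Arguments res_rank [I] F i : rename.
Arguments res_deg [I] F [i] a : rename.
Arguments res_diff [I] F i : rename.

Section Tor.
Variables (I : {mpoly k[n]} -> Prop) (F : graded_free_resolution I).

(* k \otimes_S F_i is k^(res_rank i), and k = S / (x_1, ..., x_n) sends a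
   polynomial to its constant coefficient. *)
Definition tor_diff i : 'M[k]_(res_rank F i.+1, res_rank F i) :=
  map_mx (mcoeff 0%MM) (res_diff F i).

(* Row space: the degree j component of k \otimes_S F_i. *)
Definition tor_chain i (j : int) : 'M[k]_(res_rank F i) :=
  diag_mx (\row_a (res_deg F a == j)%:R).

Definition tor_ker i : 'M[k]_(res_rank F i) :=
  match i with
  | 0%N => 1%:M
  | i'.+1 => kermx (tor_diff i')
  end.

(* dim_k Tor_i(k, I)_j = dim_k H_i(k \otimes_S F)_j: cycles modulo
   boundaries. *)
Definition tor_dim i (j : int) : nat :=
  (\rank (tor_chain i j :&: tor_ker i)%MS
   - \rank (tor_chain i.+1 j *m tor_diff i))%N.

Definition betti (i j : int) : nat :=
  match i with
  | Posz i' => tor_dim i' j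
  | Negz _ => 0%N
  end.

End Tor.
End Ideals.

Definition consecutive_cancellations (bI bL : int -> int -> nat) : Prop :=
  exists c : int -> int -> nat, forall i j : int,
    (bI i j)%:Z = (bL i j)%:Z - (c i j)%:Z - (c (i - 1) j)%:Z.

(* Main.v *)
(** Dimension shifting along the resolution gives
      b_{i,j}(I) = z_i(I_{j-i}) + z_{i+1}(I_{j-i-1}) - C(n, i+1) dim I_{j-i-1},
    where z_p(I_d) is the dimension of the space of Koszul p-cycles with
    coefficients in I_d. Since I and L have the same Hilbert function,
      c_{i,j} = z_{i+1}(L_{j-i-1}) - z_{i+1}(I_{j-i-1})
    works, once z_p(I_d) <= z_p(L_d) for all p and d.
    A filtration by the monomial order shows that z_p does not decrease when I_d
    is replaced by the span of its initial monomials; these contain all multiples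
    of the monomials f_i, which are pairwise coprime by regularity. For a space
    spanned by monomials, z_p is a sum over multidegrees of dimensions of cycles
    in simplices, and sorting set systems shows that it does not decrease under
    compression in two variables. Compressions turn the f_i into powers of
    variables, put the exponents in increasing order, and then make the space
    strongly stable. A stable space is compared with the lex-plus-powers space of
    the same dimension by induction on the number of variables, slicing by the
    exponent of the last one. *)

From HB Require Import structures.
From Stdlib Require Import ClassicalEpsilon FunctionalExtensionality PropExtensionality.
Require Import Defs.
From mathcomp Require Import all_boot all_order all_algebra.
From mathcomp Require Import perm zify.

Set Implicit Arguments.
Unset Strict Implicit.
Unset Printing Implicit Defensive.

Import GRing.Theory.
Local Open Scope ring_scope.

(** * Dimension of subspaces *)

(** The numbers [z_p] see one degree of an ideal at a time, so a compression may act on that degree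
    alone and its result need not belong to an ideal. No generic change of coordinates occurs, and
    hence the field is arbitrary. Splitting a simplex along a vertex turns cycles into chains on a
    family [D] with boundary in a second family [G], so the dimension [rcyc X D G] of that space is
    the basic quantity. By the dimension formula for sums and intersections it is supermodular in
    the pair [(D, G)]: replacing two entries of a sequence of pairs by their intersection and union
    does not lower the total, and this makes sorting work. The delicate lines are those whose length
    equals the compression exponent e, with x^e and y^e as their end points. Neither end family need
    contain the other there, and acyclicity of the full simplex replaces the containment. In degree
    d all exponents are truncated at d + 1, a value that imposes no condition, so variables without
    a power are treated like the others. *)

Lemma lin_sum (k : fieldType) (V W : lmodType k) (f : V -> W) (fl : linear f)
    (T : Type) (r : seq T) (P : pred T) (F : T -> V) :
  f (\sum_(i <- r | P i) F i) = \sum_(i <- r | P i) f (F i).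
Proof.
pose fL : {linear V -> W} := HB.pack f (GRing.isLinear.Build k V W _ f fl).
exact: (linear_sum fL).
Qed.

Lemma lin0 (k : fieldType) (V W : lmodType k) (f : V -> W) (fl : linear f) : f 0 = 0.
Proof.
pose fL : {linear V -> W} := HB.pack f (GRing.isLinear.Build k V W _ f fl).
exact: (linear0 fL).
Qed.

Lemma linZ (k : fieldType) (V W : lmodType k) (f : V -> W) (fl : linear f) a u :
  f (a *: u) = a *: f u.
Proof. by rewrite -[a *: u]addr0 fl lin0 // addr0. Qed.

Lemma linD (k : fieldType) (V W : lmodType k) (f : V -> W) (fl : linear f) u v :
  f (u + v) = f u + f v.
Proof. by rewrite -[u]scale1r fl !scale1r. Qed.

Lemma linN (k : fieldType) (V W : lmodType k) (f : V -> W) (fl : linear f) u :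
  f (- u) = - f u.
Proof. by rewrite -scaleN1r linZ // scaleN1r. Qed.

Section Dimension.
Variable k : fieldType.

Definition has_dim (V : lmodType k) (U : V -> Prop) (d : nat) : Prop :=
  exists b : 'I_d -> V,
    (forall v, U v <-> exists c : 'I_d -> k, v = \sum_i c i *: b i) /\
    (forall c : 'I_d -> k, \sum_i c i *: b i = 0 -> forall i, c i = 0).

Definition fin (V : lmodType k) (U : V -> Prop) : Prop := exists d, has_dim U d.

(** Outside [fin] subspaces [epsilon] returns an arbitrary number; totality lets dimensions appear
    as plain terms in arithmetic. *)
Definition dim (V : lmodType k) (U : V -> Prop) : nat :=
  epsilon (inhabits 0%N) (has_dim U).

Definition subspace (V : lmodType k) (U : V -> Prop) : Prop :=
  U 0 /\ forall a u v, U u -> U v -> U (a *: u + v).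

Definition img (V W : lmodType k) (f : V -> W) (U : V -> Prop) : W -> Prop :=
  fun w => exists2 v, U v & w = f v.

Lemma pred_ext (T : Type) (U U' : T -> Prop) : (forall v, U v <-> U' v) -> U = U'.
Proof.
by move=> UU'; apply: functional_extensionality => v; apply: propositional_extensionality.
Qed.

Section Lmod.
Variable V : lmodType k.
Implicit Types (U : V -> Prop) (d : nat).

Lemma subspaceZ U a u : subspace U -> U u -> U (a *: u).
Proof. by case=> U0 UD Uu; rewrite -[_ *: _]addr0; apply: UD. Qed.

Lemma subspaceD U u v : subspace U -> U u -> U v -> U (u + v).
Proof. by case=> U0 UD Uu Uv; rewrite -[u]scale1r; apply: UD. Qed.

Lemma subspaceN U u : subspace U -> U u -> U (- u).
Proof. by move=> sU Uu; rewrite -scaleN1r; apply: subspaceZ. Qed.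

Lemma subspace_sum U (T : Type) (r : seq T) (P : pred T) (F : T -> V) :
  subspace U -> (forall i, P i -> U (F i)) -> U (\sum_(i <- r | P i) F i).
Proof.
move=> sU UF; apply: big_ind => //; first by case: sU.
by move=> x y; apply: subspaceD.
Qed.

Lemma subspaceI U U' : subspace U -> subspace U' -> subspace (fun v => U v /\ U' v).
Proof.
move=> [U0 UD] [U0' UD']; split=> // a u v [? ?] [? ?].
by split; [apply: UD | apply: UD'].
Qed.

Lemma has_dim_subspace U d : has_dim U d -> subspace U.
Proof.
case=> b [UP _]; split.
  by apply/UP; exists (fun=> 0); rewrite big1 // => i _; rewrite scale0r.
move=> a u v /UP[c ->] /UP[c' ->]; apply/UP; exists (fun i => a * c i + c' i).
rewrite scaler_sumr -big_split; apply: eq_bigr => i _ /=.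
by rewrite scalerDl scalerA.
Qed.

Lemma fin_subspace U : fin U -> subspace U.
Proof. by case=> d /has_dim_subspace. Qed.

(** If [d' < d], the matrix expressing [b] through [b'] has more rows than columns, and a nonzero
    vector in its left kernel is a linear dependency among the [b i]. *)
Lemma has_dim_le U U' d d' :
  has_dim U d -> has_dim U' d' -> (forall v, U v -> U' v) -> (d <= d')%N.
Proof.
move=> [b [UP bfree]] [b' [UP' _]] UU'.
have Ub i : U (b i).
  apply/UP; exists (fun j => (j == i)%:R).
  rewrite (bigD1 i) //= eqxx scale1r big1 ?addr0 // => j /negbTE ->.
  by rewrite scale0r.
have /fin_all_exists[A bA] i : exists c : 'I_d' -> k, b i = \sum_j c j *: b' j.
  by apply/UP'/UU'.
pose M := \matrix_(i, j) A i j.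
rewrite leqNgt; apply/negP => lt_d'd.
have : kermx M != 0.
  by rewrite -mxrank_eq0 mxrank_ker subn_eq0 -ltnNge (leq_ltn_trans (rank_leq_col _)).
case/rowV0Pn=> v /sub_kermxP vM /eqP; apply; apply/rowP => i; rewrite mxE.
apply: (bfree (v 0)); under eq_bigr do rewrite bA scaler_sumr.
rewrite exchange_big big1 //= => j _.
under eq_bigr do rewrite scalerA.
rewrite -scaler_suml; have /rowP/(_ j) := vM; rewrite !mxE => e.
rewrite -[X in X *: _ = _]/(\sum_i v 0 i * A i j).
by under eq_bigr => i0 _ do rewrite -[A i0 j](mxE matrix_key (fun i j => A i j)); rewrite e scale0r.
Qed.

Lemma dimP U : fin U -> has_dim U (dim U).
Proof. exact: epsilon_spec. Qed.

Lemma dimE U d : has_dim U d -> dim U = d.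
Proof.
move=> Ud; have Ud' : has_dim U (dim U) by apply: dimP; exists d.
by apply/eqP; rewrite eqn_leq (has_dim_le Ud' Ud) // (has_dim_le Ud Ud').
Qed.

Lemma dim_ext U U' : (forall v, U v <-> U' v) -> dim U = dim U'.
Proof. by move/pred_ext->. Qed.

Lemma dim_le U U' : fin U -> fin U' -> (forall v, U v -> U' v) -> (dim U <= dim U')%N.
Proof. by move=> /dimP Ud /dimP U'd; apply: has_dim_le. Qed.

Lemma has_dim0 U : (forall v, U v <-> v = 0) -> has_dim U 0.
Proof.
move=> U0; exists (fun=> 0); split=> [v|c _ []//].
split=> [/U0 ->|[c ->]]; first by exists (fun=> 0); rewrite big_ord0.
by apply/U0; rewrite big_ord0.
Qed.

Lemma dim0 U : (forall v, U v <-> v = 0) -> dim U = 0%N.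
Proof. by move/has_dim0/dimE. Qed.

End Lmod.

(** A matrix of maximal rank among those with row space inside [P] works: adjoining a further vector
    of [P] would raise the rank. This is the passage from abstract predicates to matrices. *)
Lemma row_subspace d (P : 'rV[k]_d -> Prop) :
  subspace P -> exists A : 'M[k]_d, forall v, P v <-> (v <= A)%MS.
Proof.
move=> sP.
pose good r := exists2 A : 'M[k]_d, \rank A = r & forall v, (v <= A)%MS -> P v.
pose goodb r : bool := if excluded_middle_informative (good r) then true else false.
have goodP r : reflect (good r) (goodb r).
  by rewrite /goodb; case: excluded_middle_informative => H; constructor.
have ex : exists r, goodb r.
  exists 0%N; apply/goodP; exists 0; rewrite ?mxrank0 // => v.
  by rewrite submx0 => /eqP ->; case: sP.
have le r : goodb r -> (r <= d)%N.
  by move=> /goodP[A <- _]; apply: rank_leq_row.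
case: (ex_maxnP ex le) => r /goodP[A rA AP] rmax.
exists A => v; split=> [Pv|]; last exact: AP.
apply/negPn/negP => nvA.
have : goodb (\rank (A + <<v>>)%MS).
  apply/goodP; exists (A + <<v>>)%MS => // w /sub_addsmxP[[w1 w2] /= ->].
  apply: (subspaceD sP); first by apply: AP; apply: submxMl.
  have /sub_rVP[a ->] : (w2 *m <<v>> <= v)%MS.
    by rewrite (submx_trans (submxMl _ _)) // genmxE.
  exact: subspaceZ.
move/rmax; rewrite leqNgt -rA => /negP; apply.
apply: rank_ltmx; rewrite /ltmx addsmxSl /= addsmx_sub submx_refl /=.
by rewrite genmxE.
Qed.

Lemma has_dim_row d r (V : lmodType k) (b : 'I_d -> V) (A : 'M[k]_(r, d)) :
  (forall v : 'rV[k]_d, (v <= A)%MS -> \sum_i v 0 i *: b i = 0 -> v = 0) ->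
  has_dim (fun w => exists2 v : 'rV[k]_d, (v <= A)%MS & w = \sum_i v 0 i *: b i) (\rank A).
Proof.
move=> inj; pose B := row_base A.
have comb (c : 'I_(\rank A) -> k) :
    \sum_i c i *: (\sum_j B i j *: b j) = \sum_j ((\row_i c i) *m B) 0 j *: b j.
  under eq_bigr do rewrite scaler_sumr.
  rewrite exchange_big; apply: eq_bigr => j _ /=.
  rewrite [in RHS]mxE scaler_suml; apply: eq_bigr => i _; by rewrite (mxE _ _ 0 i) scalerA.
exists (fun i => \sum_j B i j *: b j); split=> [w|c].
  split=> [[v vA ->]|[c ->]].
    have /submxP[u ->] : (v <= B)%MS by rewrite eq_row_base.
    exists (u 0); rewrite comb (_ : \row_i u 0 i = u) //.
    by apply/rowP => i; rewrite mxE.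
  exists ((\row_i c i) *m B); last exact: comb.
  by rewrite (submx_trans (submxMl _ _)) // eq_row_base.
rewrite comb => /inj c0 i.
have cB : (\row_i c i) *m B = 0.
  by apply: c0; rewrite (submx_trans (submxMl _ _)) // eq_row_base.
have /rowP/(_ i) : \row_i c i = 0 by apply: (row_free_inj (row_base_free A)); rewrite mul0mx.
by rewrite !mxE.
Qed.

(** In coordinates on [U] the kernel is the row space of some matrix [A], and the complement [A^C]
    maps isomorphically onto the image. *)
Lemma rank_nullity_ex (V W : lmodType k) (f : V -> W) (U : V -> Prop) d :
  linear f -> has_dim U d -> exists r,
    [/\ (r <= d)%N, has_dim (fun v => U v /\ f v = 0) r & has_dim (img f U) (d - r)].
Proof.
move=> fl [b [UP bfree]].
pose P (c : 'rV[k]_d) := f (\sum_i c 0 i *: b i) = 0.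
have lc : linear (fun c : 'rV[k]_d => \sum_i c 0 i *: b i).
  move=> a u v; rewrite scaler_sumr -big_split; apply: eq_bigr => i _ /=.
  by rewrite !mxE scalerDl scalerA.
have sP : subspace P.
  split=> [|a u v]; rewrite /P; first by rewrite big1 ?lin0 // => i _; rewrite mxE scale0r.
  by rewrite lc fl => -> ->; rewrite scaler0 addr0.
have [A AP] := row_subspace sP.
have UcP w : U w <-> exists c : 'rV[k]_d, w = \sum_i c 0 i *: b i.
  rewrite UP; split=> [[c ->]|[c ->]]; last by exists (c 0).
  by exists (\row_i c i); apply: eq_bigr => i _; rewrite mxE.
exists (\rank A); split; first exact: rank_leq_row.
  rewrite (_ : (fun _ => _) = (fun w => exists2 v : 'rV[k]_d, (v <= A)%MS & w = \sum_i v 0 i *: b i)).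
    apply: has_dim_row => v _ /bfree v0; by apply/rowP => i; rewrite mxE v0.
  apply: pred_ext => w; split=> [[/UcP[c ->] /AP cA]|[c /AP cA ->]]; first by exists c.
  by split=> //; apply/UcP; exists c.
have -> : (d - \rank A = \rank (A^C)%MS)%N by rewrite mxrank_compl.
rewrite (_ : img f U = (fun w => exists2 v : 'rV[k]_d, (v <= A^C)%MS & w = \sum_i v 0 i *: f (b i))).
  apply: has_dim_row => v vAC.
  under eq_bigr do rewrite -linZ //.
  rewrite -lin_sum // => /AP vA; apply/eqP; rewrite -submx0.
  by rewrite -(capmx_compl A) sub_capmx vA.
apply: pred_ext => w; split=> [[v /UcP[c ->] ->]|[c cA ->]].
  have : (c <= A + A^C)%MS by rewrite (submx_trans (submx1 _)) // sub1mx addsmx_compl_full.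
  case/sub_addsmxP=> [[u1 u2] /= ->].
  exists (u2 *m (A^C)%MS); first exact: submxMl.
  have /AP := submxMl u1 A; rewrite /P => e.
  rewrite -[u1 *m _]scale1r lc linD // linZ // e scaler0 add0r lin_sum //.
  by apply: eq_bigr => i _; rewrite linZ.
exists (\sum_i c 0 i *: b i); first by apply/UcP; exists c.
by rewrite lin_sum //; apply: eq_bigr => i _; rewrite linZ.
Qed.

Lemma rank_nullity (V W : lmodType k) (f : V -> W) (U : V -> Prop) :
  linear f -> fin U -> dim U = (dim (fun v => U v /\ f v = 0%R) + dim (img f U))%N.
Proof.
move=> fl /dimP Ud; have [r [rd kr ir]] := rank_nullity_ex fl Ud.
by rewrite (dimE kr) (dimE ir) subnKC.
Qed.

Lemma fin_img (V W : lmodType k) (f : V -> W) (U : V -> Prop) :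
  linear f -> fin U -> fin (img f U).
Proof. by move=> fl [d Ud]; have [r [_ _ ir]] := rank_nullity_ex fl Ud; exists (d - r)%N. Qed.

Lemma fin_ker (V W : lmodType k) (f : V -> W) (U : V -> Prop) :
  linear f -> fin U -> fin (fun v => U v /\ f v = 0).
Proof. by move=> fl [d Ud]; have [r [_ ? ir]] := rank_nullity_ex fl Ud; exists r. Qed.

Lemma fin_sub (V : lmodType k) (U U' : V -> Prop) :
  fin U' -> subspace U -> (forall v, U v -> U' v) -> fin U.
Proof.
move=> [d [b [UP bfree]]] sU UU'.
pose P (c : 'rV[k]_d) := U (\sum_i c 0 i *: b i).
have lc : linear (fun c : 'rV[k]_d => \sum_i c 0 i *: b i).
  move=> a u v; rewrite scaler_sumr -big_split; apply: eq_bigr => i _ /=.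
  by rewrite !mxE scalerDl scalerA.
have sP : subspace P.
  split=> [|a u v]; rewrite /P.
    by rewrite big1 => [|i _]; [case: sU | rewrite mxE scale0r].
  by rewrite lc => ? ?; case: sU => _; apply.
have [A AP] := row_subspace sP.
exists (\rank A).
rewrite (_ : U = (fun w => exists2 v : 'rV[k]_d, (v <= A)%MS & w = \sum_i v 0 i *: b i)).
  apply: has_dim_row => v _ /bfree v0; by apply/rowP => i; rewrite mxE v0.
apply: pred_ext => w; split=> [Uw|[c /AP cA -> //]].
have /UP[c wE] := UU' _ Uw.
exists (\row_i c i); last by rewrite wE; apply: eq_bigr => i _; rewrite mxE.
by apply/AP; rewrite /P (_ : \sum_i _ = w) // wE; apply: eq_bigr => i _; rewrite mxE.
Qed.

Lemma dim_inj (V W : lmodType k) (f : V -> W) (U : V -> Prop) :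
  linear f -> fin U -> (forall v, U v -> f v = 0 -> v = 0) -> dim (img f U) = dim U.
Proof.
move=> fl fU inj; rewrite (rank_nullity fl fU) [X in (X + _)%N]dim0 // => v.
split=> [[/inj]|->]; first exact.
by rewrite lin0 //; split=> //; case: (fin_subspace fU).
Qed.

Lemma subspace_img (V W : lmodType k) (f : V -> W) (U : V -> Prop) :
  linear f -> subspace U -> subspace (img f U).
Proof.
move=> fl [U0 UD]; split; first by exists 0; rewrite ?lin0.
by move=> a _ _ [u Uu ->] [v Uv ->]; exists (a *: u + v); rewrite ?fl //; apply: UD.
Qed.

Lemma subspace_ker (V W : lmodType k) (f : V -> W) :
  linear f -> subspace (fun v => f v = 0).
Proof.
move=> fl; split; first exact: lin0.
by move=> a u v; rewrite fl => -> ->; rewrite scaler0 addr0.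
Qed.

Lemma subspace_pre (V W : lmodType k) (f : V -> W) (U : W -> Prop) :
  linear f -> subspace U -> subspace (fun v => U (f v)).
Proof.
move=> fl [U0 UD]; split; first by rewrite lin0.
by move=> a u v fu fv; rewrite fl; apply: UD.
Qed.

(* The successive graded pieces of U for the filtration by the vanishing of the first f_i. *)
Lemma dim_filtration (V : lmodType k) (W : lmodType k) (T : eqType) (s : seq T)
    (f : T -> V -> W) (U : V -> Prop) :
  (forall t, linear (f t)) -> fin U -> uniq s ->
  (forall v, U v -> (forall t, t \in s -> f t v = 0) -> v = 0) ->
  dim U = \sum_(t <- s)
    dim (img (f t) (fun v => U v /\ forall t', (index t' s < index t s)%N -> f t' v = 0)).
Proof.
move=> fl; elim: s U => [|t s IH] U fU us U0.
  rewrite big_nil dim0 // => v; split=> [Uv|->]; first exact: U0.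
  by case: (fin_subspace fU).
rewrite big_cons (rank_nullity (fl t) fU) addnC; congr (_ + _)%N.
  apply: dim_ext => w; split=> [[v Uv ->]|[v [Uv _] ->]]; last by exists v.
  by exists v => //; split=> // t'; rewrite /= eqxx ltn0.
move: us => /= /andP[nts us].
rewrite IH //; first last.
- move=> v [Uv tv] sv; apply: U0 => // t'; rewrite inE => /orP[/eqP-> //|]; exact: sv.
- exact: fin_ker.
rewrite !big_seq; apply: eq_bigr => t' t's; apply: dim_ext => w.
have tt' : t == t' = false by apply/eqP => tt'; rewrite tt' t's in nts.
split=> [[v [[Uv ftv] H] ->]|[v [Uv H] ->]]; exists v => //; split=> //=.
- move=> t2; rewrite /= tt'; case: eqP => [<- _ //|_]; rewrite ltnS; exact: H.
- by split=> //; apply: H; rewrite /= eqxx tt'.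
- move=> t2 t2lt; apply: H; rewrite /= tt'; case: eqP => // _; by rewrite ltnS.
Qed.

Lemma has_dim_prod (V W : lmodType k) (U : V -> Prop) (U' : W -> Prop) d d' :
  has_dim U d -> has_dim U' d' -> has_dim (fun p : V * W => U p.1 /\ U' p.2) (d + d').
Proof.
move=> [b [UP bf]] [b' [UP' bf']].
exists (fun i => match split i with inl i => (b i, 0) | inr i => (0, b' i) end).
have E (c : 'I_(d + d') -> k) : \sum_i c i *: match split i with inl i => (b i, 0) | inr i => (0, b' i) end
    = (\sum_i c (lshift _ i) *: b i, \sum_i c (rshift _ i) *: b' i) :> V * W.
  rewrite big_split_ord /=.
  under eq_bigr do rewrite (unsplitK (inl _)).
  under [X in _ + X]eq_bigr do rewrite (unsplitK (inr _)).
  rewrite [LHS]surjective_pairing; congr pair.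
    rewrite [LHS](linD (f := fst)) // !(lin_sum (f := fst)) //=.
    by rewrite [X in _ + X]big1 ?addr0 // => i _; rewrite scaler0.
  rewrite [LHS](linD (f := snd)) // !(lin_sum (f := snd)) //=.
  by rewrite [X in X + _]big1 ?add0r // => i _; rewrite scaler0.
split=> [[v w]|c].
  split=> [[/UP[c /= ->] /UP'[c' /= ->]]|[c]].
    exists (fun i => match split i with inl i => c i | inr i => c' i end).
    rewrite E; congr pair; apply: eq_bigr => i _.
      by rewrite (unsplitK (inl _)).
    by rewrite (unsplitK (inr _)).
  rewrite E => -[-> ->] /=; split; [apply/UP | apply/UP']; by eexists.
rewrite E => -[/bf c1 /bf' c2] i.
by case: (splitP i) => j ij; [have -> : i = lshift _ j by apply: val_inj
                           | have -> : i = rshift _ j by apply: val_inj].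
Qed.

(** Rank-nullity for the difference map on pairs: its kernel is the diagonal copy of the
    intersection and its image lies in [U3]. Every exchange argument below rests on this
    inequality. *)
Lemma dim_super (V : lmodType k) (U1 U2 U3 : V -> Prop) :
  fin U3 -> subspace U1 -> subspace U2 ->
  (forall v, U1 v -> U3 v) -> (forall v, U2 v -> U3 v) ->
  (dim U1 + dim U2 <= dim (fun v => U1 v /\ U2 v) + dim U3)%N.
Proof.
move=> f3 s1 s2 s13 s23.
have f1 := fin_sub f3 s1 s13; have f2 := fin_sub f3 s2 s23.
have f12 : fin (fun v => U1 v /\ U2 v).
  by apply: (fin_sub f1) => [|v []//]; apply: subspaceI.
have dp := has_dim_prod (dimP f1) (dimP f2).
have fp : fin (fun p : V * V => U1 p.1 /\ U2 p.2) by eexists; exact: dp.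
have fl : linear (fun p : V * V => p.1 - p.2).
  by move=> a u v /=; rewrite opprD scalerBr addrACA.
rewrite -(dimE dp) (rank_nullity fl fp); apply: leq_add.
  rewrite -(@dim_inj _ _ (fun v => (v, v)) (fun v => U1 v /\ U2 v)) //; last by move=> v _ [].
  apply: dim_le => [||[v w] /= [[Uv Uw] /eqP]]; [exact: fin_ker|exact: fin_img|].
  by rewrite subr_eq0 => /eqP E; exists v; rewrite /= E // -{1}E.
apply: dim_le => // [|_ [[v w] /= [Uv Uw] ->]]; first exact: fin_img.
have s3 := fin_subspace f3.
by apply: (subspaceD s3); [apply: s13 | apply: (subspaceN s3); apply: s23].
Qed.

Lemma scaleoE (a : k) (b : k^o) : a *: b = a * b.
Proof. by []. Qed.

Lemma has_dim_supp (T : finType) (D : {set T}) :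
  has_dim (fun c : {ffun T -> k^o} => forall t, t \notin D -> c t = 0) #|D|.
Proof.
exists (fun i => [ffun t => (t == enum_val i)%:R : k^o]).
have E (c : 'I_#|D| -> k) i : (\sum_i c i *: [ffun t => (t == enum_val i)%:R : k^o]) (enum_val i) = c i.
  rewrite sum_ffunE (bigD1 i) //= !ffunE eqxx scaleoE mulr1 big1 ?addr0 // => j ji.
  by rewrite !ffunE (inj_eq enum_val_inj) eq_sym (negbTE ji) scaleoE mulr0.
split=> [c|c c0 i]; last by rewrite -E c0 ffunE.
split=> [cD|[a ->] t tD].
  exists (fun i => c (enum_val i)); apply/ffunP => t.
  have [tD|tD] := boolP (t \in D); last first.
    rewrite cD // sum_ffunE big1 // => i _; rewrite !ffunE.
    by case: eqP => [te|_]; [rewrite te enum_valP in tD | rewrite scaleoE mulr0].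
  by rewrite -(enum_rankK_in tD tD) E.
rewrite sum_ffunE big1 // => i _; rewrite !ffunE.
by case: eqP => [te|_]; [rewrite te enum_valP in tD | rewrite scaleoE mulr0].
Qed.

Lemma has_dim_extension (V W : lmodType k) (f : V -> W) (U : V -> Prop) a b :
  linear f -> subspace U -> has_dim (fun v => U v /\ f v = 0) a -> has_dim (img f U) b ->
  has_dim U (a + b).
Proof.
move=> fl sU [u [uP ufree]] [w [wP wfree]].
have /fin_all_exists[v vP] i : exists v, U v /\ w i = f v.
  have [v Uv ->] : img f U (w i); last by exists v.
  apply/wP; exists (fun j => (j == i)%:R).
  rewrite (bigD1 i) //= eqxx scale1r big1 ?addr0 // => j /negbTE ->.
  by rewrite scale0r.
have Uu i : U (u i) /\ f (u i) = 0.
  apply/uP; exists (fun j => (j == i)%:R).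
  rewrite (bigD1 i) //= eqxx scale1r big1 ?addr0 // => j /negbTE ->.
  by rewrite scale0r.
pose e i := match split i with inl i => u i | inr j => v j end.
have E (c : 'I_(a + b) -> k) :
    \sum_i c i *: e i = \sum_i c (lshift _ i) *: u i + \sum_j c (rshift _ j) *: v j.
  rewrite big_split_ord /=; congr (_ + _); apply: eq_bigr => i _; rewrite /e.
    by rewrite (unsplitK (inl _)).
  by rewrite (unsplitK (inr _)).
have fu (c : 'I_a -> k) : f (\sum_i c i *: u i) = 0.
  by rewrite (lin_sum fl) big1 // => i _; rewrite (linZ fl) (Uu i).2 scaler0.
have fv (c : 'I_b -> k) : f (\sum_i c i *: v i) = \sum_i c i *: w i.
  by rewrite (lin_sum fl); apply: eq_bigr => i _; rewrite (linZ fl) (vP i).2.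
exists e; split=> [x|c]; last first.
  rewrite E => c0; have c2 : forall j, c (rshift a j) = 0.
    by apply: wfree; rewrite -fv -[LHS]add0r -(fu (fun i => c (lshift b i))) -(linD fl) c0 (lin0 fl).
  have c1 : forall i, c (lshift b i) = 0.
    by apply: ufree; rewrite -[RHS]c0 [X in _ = _ + X]big1 ?addr0 // => j _; rewrite c2 scale0r.
  by move=> i; case: (splitP i) => j ij; [have -> : i = lshift b j by apply: val_inj
                                        | have -> : i = rshift a j by apply: val_inj].
split=> [Ux|[c ->]]; last first.
  rewrite E; apply: (subspaceD sU); apply: (subspace_sum _ sU) => i _; apply: (subspaceZ _ sU).
    exact: (Uu i).1.
  exact: (vP i).1.
have /wP[c2 fx] : img f U (f x) by exists x.
have /uP[c1 xE] : U (x - \sum_i c2 i *: v i) /\ f (x - \sum_i c2 i *: v i) = 0.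
  split; last by rewrite (linD fl) (linN fl) fv fx subrr.
  apply: (subspaceD sU Ux); apply: (subspaceN sU); apply: (subspace_sum _ sU) => i _.
  by apply: (subspaceZ _ sU); apply: (vP i).1.
exists (fun i => match split i with inl i => c1 i | inr j => c2 j end).
rewrite E -[x](subrK (\sum_i c2 i *: v i)) xE; congr (_ + _); apply: eq_bigr => i _.
  by rewrite (unsplitK (inl _)).
by rewrite (unsplitK (inr _)).
Qed.

(** Induction on [D]: evaluation at a point [t] of [D] maps onto [U], and its kernel consists of the
    functions on [D :\ t]. *)
Lemma has_dim_ffun (V : lmodType k) (T : finType) (D : {set T}) (U : V -> Prop) d :
  has_dim U d ->
  has_dim (fun c : {ffun T -> V} => forall t, if t \in D then U (c t) else c t = 0) (#|D| * d).
Proof.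
move=> Ud; have sU := has_dim_subspace Ud.
have sub (C : {set T}) :
    subspace (fun c : {ffun T -> V} => forall t, if t \in C then U (c t) else c t = 0).
  split=> [t|a u v cu cv t]; rewrite !ffunE; first by case: ifP => // _; case: sU.
  have := cu t; have := cv t; case: ifP => _; first by move=> ? ?; apply: sU.2.
  by move=> -> ->; rewrite scaler0 addr0.
elim: {D}_.+1 {-2}D (ltnSn #|D|) => // N IH D DN.
have [->|[t tD]] := set_0Vmem D.
  rewrite cards0 mul0n; apply: has_dim0 => c; split=> [H|-> t]; last by rewrite inE ffunE.
  by apply/ffunP => t; have := H t; rewrite inE ffunE.
have fl : linear (fun c : {ffun T -> V} => c t) by move=> a u v; rewrite !ffunE.
rewrite (cardsD1 t) tD addnC mulnDl mul1n; apply: (has_dim_extension fl) => //.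
  have := IH (D :\ t); rewrite (cardsD1 t) tD ltnS in DN => /(_ DN).
  rewrite (_ : (fun c => _) = (fun c : {ffun T -> V} =>
    (forall t, if t \in D then U (c t) else c t = 0) /\ c t = 0)) //.
  apply: pred_ext => c; split=> [H|[H ct] t'].
    split=> [t'|]; last by have := H t; rewrite !inE eqxx.
    have := H t'; rewrite !inE; case: eqP => [->|] //=; rewrite tD => ->; by case: sU.
  by rewrite !inE; have := H t'; case: eqP => [->|].
rewrite (_ : img _ _ = U) //; apply: pred_ext => v; split=> [[c H ->]|Uv].
  by have := H t; rewrite tD.
exists [ffun t' => if t' == t then v else 0]; last by rewrite ffunE eqxx.
move=> t'; rewrite ffunE; case: eqP => [->|_]; first by rewrite tD.
by case: ifP => // _; case: sU.
Qed.

End Dimension.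

(** * Koszul complexes *)

Section Koszul.
Variables (k : fieldType) (n : nat).
Implicit Types (x y : 'I_n) (X Y F G : {set 'I_n}).

(** The sign of moving [x] to its place when it is put in front of the exterior monomial of [G]. *)
Definition sgn x G : k := (-1) ^+ #|[set z in G | (z < x)%N]|.

Lemma sgn_mul x G : sgn x G * sgn x G = 1.
Proof. by rewrite /sgn -exprD addnn -mul2n exprM sqrrN expr1n expr1n. Qed.

Lemma sgn_neq0 x G : sgn x G != 0.
Proof. by apply/eqP => s0; have /eqP := sgn_mul x G; rewrite s0 mul0r eq_sym oner_eq0. Qed.

Lemma sgn_swap x y G : x != y -> x \notin G -> y \notin G ->
  sgn x G * sgn y (x |: G) = - (sgn y G * sgn x (y |: G)).
Proof.
have S u v : u \notin G -> sgn v (u |: G) = sgn v G * (-1) ^+ (u < v)%N.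
  move=> uG; rewrite /sgn -exprD; congr (_ ^+ _).
  case: ltnP => uv /=.
    rewrite (_ : finset _ = u |: [set z in G | (z < v)%N]).
      by rewrite cardsU1 inE (negbTE uG) addnC.
    by apply/setP => z; rewrite !inE; case: eqP => // ->.
  rewrite addn0; apply: eq_card => z; rewrite !inE; case: eqP => // ->.
  by rewrite [(u < v)%N]ltnNge uv !andbF.
move=> xy xG yG; rewrite !S // [sgn y G * (_ * _)]mulrCA.
case: (ltngtP x y) => [||/val_inj xy'] /=; last by rewrite xy' eqxx in xy.
- by rewrite expr0 expr1 !mulr1 !mulrN1 mulrN.
- by rewrite expr0 expr1 !mulr1 !mulrN1 mulrN opprK.
Qed.

Section Module.
Variables (V : lmodType k) (mu : 'I_n -> V -> V).
Hypothesis mul : forall x, linear (mu x).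
Hypothesis muC : forall x y v, mu x (mu y v) = mu y (mu x v).
Local Notation chains := {ffun {set 'I_n} -> V}.
Implicit Types c b : chains.

(** The Koszul differential, written coefficientwise and restricted to the variables of [X]. Leaving
    [X] free permits induction on the set of variables. *)
Definition bd X c : chains :=
  [ffun G : {set 'I_n} => \sum_(x in X :\: G) sgn x G *: mu x (c (x |: G))].

Definition mum x c : chains := [ffun G : {set 'I_n} => mu x (c G)].

(* A chain is split along a variable x into its part without x and its part
   divided by x. *)
Definition part0 x c : chains := [ffun G : {set 'I_n} => if x \in G then 0 else c G].
Definition part1 x c : chains := [ffun G : {set 'I_n} => if x \in G then 0 else sgn x G *: c (x |: G)].
Definition glue x (c0 c1 : chains) : chains :=
  [ffun F : {set 'I_n} => if x \in F then sgn x (F :\ x) *: c1 (F :\ x) else c0 F].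

Lemma mum_linear x : linear (mum x).
Proof. by move=> a u v; apply/ffunP => G; rewrite !ffunE mul. Qed.

Lemma bd_linear X : linear (bd X).
Proof.
move=> a u v; apply/ffunP => G; rewrite !ffunE scaler_sumr -big_split /=.
by apply: eq_bigr => x _; rewrite !ffunE mul scalerDr !scalerA mulrC.
Qed.

Lemma part0_linear x : linear (part0 x).
Proof. by move=> a u v; apply/ffunP => G; rewrite !ffunE; case: ifP; rewrite ?scaler0 ?addr0. Qed.

Lemma part1_linear x : linear (part1 x).
Proof.
move=> a u v; apply/ffunP => G; rewrite !ffunE; case: ifP; rewrite ?scaler0 ?addr0 //.
by rewrite scalerDr !scalerA mulrC.
Qed.

Lemma bd_mum X x c : bd X (mum x c) = mum x (bd X c).
Proof.
apply/ffunP => G; rewrite !ffunE (lin_sum (mul x)); apply: eq_bigr => y _.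
by rewrite ffunE (linZ (mul x)) muC.
Qed.

Lemma bd_set0 c : bd set0 c = 0.
Proof. by apply/ffunP => G; rewrite !ffunE big1 // => x; rewrite set0D inE. Qed.

Lemma bd_avoid X x c : (forall F, x \in F -> c F = 0) -> forall F, x \in F -> bd X c F = 0.
Proof.
move=> c0 F xF; rewrite ffunE big1 // => y _.
by rewrite c0 ?(lin0 (mul y)) ?scaler0 // inE xF orbT.
Qed.

(** Together with [part1_bd] this exhibits the complex on [x |: X] as the mapping cone of
    multiplication by [x] on the complex on [X]. *)
Lemma part0_bd X x c : x \notin X ->
  part0 x (bd (x |: X) c) = bd X (part0 x c) + mum x (part1 x c).
Proof.
move=> xX; apply/ffunP => G; rewrite !ffunE.
case: ifP => xG.
  rewrite (lin0 (mul x)) addr0 big1 // => y _.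
  by rewrite ffunE inE xG orbT (lin0 (mul y)) scaler0.
rewrite setDUl (setDidPl _) ?disjoints1 ?inE ?xG //.
rewrite big_setU1 ?inE ?xG ?(negbTE xX) //= addrC (linZ (mul x)); congr (_ + _).
apply: eq_bigr => y; rewrite inE => /andP[_ yX]; rewrite ffunE !inE xG orbF.
by case: eqP => // xy; rewrite xy yX in xX.
Qed.

Lemma part1_bd X x c : x \notin X -> part1 x (bd (x |: X) c) = - bd X (part1 x c).
Proof.
move=> xX; apply/ffunP => G; rewrite !ffunE.
case: ifP => xG.
  rewrite big1 ?oppr0 // => y _.
  by rewrite ffunE inE xG orbT (lin0 (mul y)) scaler0.
have -> : (x |: X) :\: (x |: G) = X :\: G.
  apply/setP => z; rewrite !inE; case: eqP => //= ->.
  by rewrite (negbTE xX) andbF.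
rewrite scaler_sumr -sumrN; apply: eq_bigr => y; rewrite inE => /andP[yG yX].
have xy : x != y by apply: contraNneq xX => ->.
rewrite ffunE !inE xG (negbTE xy) /= (linZ (mul y)) !scalerA sgn_swap ?xG //.
by rewrite scaleNr setUCA.
Qed.

Lemma part_eq0 x c : part0 x c = 0 -> part1 x c = 0 -> c = 0.
Proof.
move=> /ffunP c0 /ffunP c1; apply/ffunP => F; rewrite ffunE.
have [xF|xF] := boolP (x \in F); last by have := c0 F; rewrite !ffunE (negbTE xF).
have := c1 (F :\ x); rewrite !ffunE !inE eqxx /= setD1K // => /eqP.
by rewrite scaler_eq0 (negbTE (sgn_neq0 _ _)) => /eqP.
Qed.

Lemma part_inj x c b : part0 x c = part0 x b -> part1 x c = part1 x b -> c = b.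
Proof.
move=> e0 e1; apply/eqP; rewrite -subr_eq0; apply/eqP; apply: (@part_eq0 x).
  by rewrite (linD (part0_linear x)) (linN (part0_linear x)) e0 subrr.
by rewrite (linD (part1_linear x)) (linN (part1_linear x)) e1 subrr.
Qed.

Lemma part0_glue x (c0 c1 : chains) :
  (forall F, x \in F -> c0 F = 0) -> part0 x (glue x c0 c1) = c0.
Proof. by move=> H; apply/ffunP => F; rewrite !ffunE; case: ifP => [/H -> //|-> //]. Qed.

Lemma part1_glue x (c0 c1 : chains) :
  (forall F, x \in F -> c1 F = 0) -> part1 x (glue x c0 c1) = c1.
Proof.
move=> H; apply/ffunP => F; rewrite !ffunE; case: ifP => [/H -> //|xF].
by rewrite !inE eqxx /= setU1K ?xF // scalerA sgn_mul scale1r.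
Qed.

(** Induction on [X] through the mapping cone: the two mixed terms cancel because [mu x] commutes
    with the differential on the smaller set. *)
Lemma bd_bd X c : bd X (bd X c) = 0.
Proof.
elim: {X}_.+1 {-2}X (ltnSn #|X|) c => // m IH X Xm c.
have [->|[x xX]] := set_0Vmem X; first exact: bd_set0.
have XE : X = x |: (X :\ x) by rewrite setD1K.
have lt : (#|X :\ x| < m)%N by move: Xm; rewrite (cardsD1 x) xX.
have nx : x \notin X :\ x by rewrite !inE eqxx.
move: XE nx lt; set X' := X :\ x => -> nx lt.
apply: (@part_eq0 x); last by rewrite !part1_bd // (linN (bd_linear _)) IH // !oppr0.
rewrite part0_bd // part0_bd // part1_bd // (linD (bd_linear _)) IH // bd_mum.
by rewrite add0r (linN (mum_linear x)) subrr.
Qed.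

Definition chain X p c := forall F, ~~ ((F \subset X) && (#|F| == p)) -> c F = 0.

Lemma chain_subspace X p : subspace (chain X p).
Proof.
split=> [F _|a u v cu cv F HF]; first by rewrite ffunE.
by rewrite !ffunE cu // cv // scaler0 addr0.
Qed.

Lemma chain_bd X p c : chain X p.+1 c -> chain X p (bd X c).
Proof.
move=> cc F HF; rewrite ffunE big1 // => x; rewrite inE => /andP[xF xX].
rewrite cc ?(lin0 (mul x)) ?scaler0 // subUset sub1set xX cardsU1 xF.
by rewrite -[#|F|.+1 == p.+1]/(#|F| == p).
Qed.

Lemma chain_part0 X p x c : chain (x |: X) p c -> chain X p (part0 x c).
Proof.
move=> cc F HF; rewrite ffunE; case: ifP => // xF; apply: cc; apply: contra HF.
move=> /andP[FX ->]; rewrite andbT; apply/subsetP => y yF.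
by have /setU1P[yx|//] := subsetP FX _ yF; rewrite -yx yF in xF.
Qed.

Lemma chain_part1 X p x c : chain (x |: X) p.+1 c -> chain X p (part1 x c).
Proof.
move=> cc F HF; rewrite ffunE; case: ifP => // xF.
rewrite cc ?scaler0 //; apply: contra HF.
rewrite cardsU1 xF subUset add1n eqSS => /andP[/andP[_ FX] ->]; rewrite andbT.
apply/subsetP => y yF.
by have /setU1P[yx|//] := subsetP FX _ yF; rewrite -yx yF in xF.
Qed.

Lemma chain_glue X p x c0 c1 :
  chain X p.+1 c0 -> chain X p c1 -> chain (x |: X) p.+1 (glue x c0 c1).
Proof.
move=> h0 h1 F HF; rewrite ffunE; case: ifP => xF.
  rewrite h1 ?scaler0 //; apply: contra HF => /andP[FX /eqP c].
  by rewrite (cardsD1 x) xF c add1n eqxx andbT -(setD1K xF) setUS.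
apply: h0; apply: contra HF => /andP[FX ->].
by rewrite andbT (subset_trans FX) // subsetUr.
Qed.

Lemma chain_avoid X p x c : x \notin X -> chain X p c -> forall F, x \in F -> c F = 0.
Proof.
move=> xX cc F xF; apply: cc; apply/negP => /andP[/subsetP/(_ x xF)].
by rewrite (negbTE xX).
Qed.

Lemma bd_glue X x c0 c1 : x \notin X ->
  (forall F, x \in F -> c0 F = 0) -> (forall F, x \in F -> c1 F = 0) ->
  bd (x |: X) (glue x c0 c1) = glue x (bd X c0 + mum x c1) (- bd X c1).
Proof.
move=> xX h0 h1; apply: (@part_inj x).
  rewrite part0_bd // part0_glue // part1_glue // part0_glue // => F xF.
  by rewrite !ffunE h1 // (lin0 (mul x)) addr0; have := bd_avoid X h0 xF; rewrite ffunE.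
rewrite part1_bd // !part1_glue // => F xF.
by rewrite ffunE (bd_avoid X h1 xF) oppr0.
Qed.

(** The values [bd X c set0] are the sums of multiples by variables of [X], so this says that each
    variable is a nonzerodivisor modulo any set of other variables. *)
Hypothesis regular : forall X x v c, x \notin X ->
  mu x v = bd X c set0 -> exists c', v = bd X c' set0.

(** Induction on [X] along the cone: fill [part1 c] by [b1], fill [part0 c + mum x b1] by [b0], and
    glue [b0] with [- b1]. The induction cannot fill [part1 c] when it is a 0-chain; regularity does
    so there. *)
Lemma koszul_exact X p c : (0 < p)%N -> chain X p c -> bd X c = 0 ->
  exists2 b, chain X p.+1 b & bd X b = c.
Proof.
elim: {X}_.+1 {-2}X (ltnSn #|X|) p c => // m IH X Xm [//|p] c _ cc c0.
have [X0|[x xX]] := set_0Vmem X.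
  exists 0; first by case: (chain_subspace X p.+2).
  rewrite X0 bd_set0; apply/ffunP => F; rewrite ffunE cc // X0 subset0.
  by apply/negP => /andP[/eqP -> ]; rewrite cards0.
have XE : X = x |: (X :\ x) by rewrite setD1K.
have nx : x \notin X :\ x by rewrite !inE eqxx.
have lt : (#|X :\ x| < m)%N by move: Xm; rewrite (cardsD1 x) xX.
move: XE nx lt cc c0; set X' := X :\ x => -> nx lt cc c0.
have cc0 := chain_part0 cc; have cc1 := chain_part1 cc.
have e0 : bd X' (part0 x c) + mum x (part1 x c) = 0.
  by rewrite -part0_bd // c0; apply: (lin0 (part0_linear x)).
have e1 : bd X' (part1 x c) = 0.
  by apply/eqP; rewrite -oppr_eq0 -part1_bd // c0; apply/eqP/(lin0 (part1_linear x)).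
have [b1 cb1 b1E] : exists2 b1, chain X' p.+1 b1 & bd X' b1 = part1 x c.
  case: p cc cc0 cc1 => [|p] cc cc0 cc1; last exact: IH.
  have [c' c'E] : exists c', part1 x c set0 = bd X' c' set0.
    apply: (@regular X' x _ (- part0 x c)) => //.
    have /ffunP/(_ set0) := e0; rewrite ffunE [mum _ _ _]ffunE [X in _ = X]ffunE => /eqP.
    rewrite addrC addr_eq0 => /eqP ->.
    by rewrite (linN (bd_linear X')) [in RHS]ffunE.
  (* The chain [c'] may have coefficients anywhere; cutting it down to singletons of [X'] keeps the
     value of its boundary at [set0] and makes it a 1-chain. *)
  pose b1 : chains := [ffun F : {set 'I_n} => if (F \subset X') && (#|F| == 1%N) then c' F else 0].
  have cb1 : chain X' 1 b1 by move=> F HF; rewrite ffunE (negbTE HF).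
  exists b1 => //; apply/ffunP => F.
  have [->|F0] := eqVneq F set0.
    rewrite c'E !ffunE; apply: eq_bigr => y; rewrite inE setU0 ffunE => /andP[_ yX'].
    by rewrite sub1set yX' cards1.
  rewrite (chain_bd cb1) ?cc1 //; by rewrite cards_eq0 (negbTE F0) andbF.
have [b0 cb0 b0E] : exists2 b0, chain X' p.+2 b0 & bd X' b0 = part0 x c + mum x b1.
  apply: IH => //; last by rewrite (linD (bd_linear _)) bd_mum b1E.
  apply: subspaceD cc0 _ => [|F HF]; first exact: chain_subspace.
  by rewrite ffunE cb1 // (lin0 (mul x)).
have ncb1 : chain X' p.+1 (- b1) by apply: subspaceN cb1; apply: chain_subspace.
exists (glue x b0 (- b1)); first exact: chain_glue.
have n0 := chain_avoid nx cb0; have n1 := chain_avoid nx ncb1.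
rewrite bd_glue // b0E (linN (mum_linear x)) addrK (linN (bd_linear X')) b1E opprK.
by apply: (@part_inj x); rewrite ?part0_glue ?part1_glue // => F xF; rewrite ffunE xF.
Qed.

End Module.
End Koszul.

(** * Simplicial chains with prescribed support and boundary *)

Section Simplex.
Variables (k : fieldType) (n : nat).
Implicit Types (x y : 'I_n) (X Y F : {set 'I_n}) (C D G J U : {set {set 'I_n}}).

Local Notation sch := {ffun {set 'I_n} -> k^o}.
(** With every variable acting as the identity on [k], the Koszul differential becomes the
    simplicial boundary. Each multidegree of a polynomial Koszul complex has this form. *)
Definition sbd : {set 'I_n} -> sch -> sch := @bd k n k^o (fun=> idfun).

Implicit Types c : sch.

Definition supp (D : {set {set 'I_n}}) (c : sch) := forall F, F \notin D -> c F = 0.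

Definition scyc X D G : sch -> Prop := fun c => supp D c /\ supp G (sbd X c).

Definition rcyc X D G := dim (scyc X D G).

Lemma mum_id x c : mum (fun=> idfun) x c = c :> sch.
Proof. by apply/ffunP => F; rewrite ffunE. Qed.

Lemma spart0_bd X x c : x \notin X ->
  part0 x (sbd (x |: X) c) = sbd X (part0 x c) + part1 x c.
Proof. by move=> xX; rewrite /sbd part0_bd // mum_id. Qed.

Lemma spart1_bd X x c : x \notin X -> part1 x (sbd (x |: X) c) = - sbd X (part1 x c).
Proof. by move=> xX; rewrite /sbd part1_bd. Qed.

Lemma sbd_glue X x c0 c1 : x \notin X ->
  (forall F, x \in F -> c0 F = 0) -> (forall F, x \in F -> c1 F = 0) ->
  sbd (x |: X) (glue x c0 c1) = glue x (sbd X c0 + c1) (- sbd X c1).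
Proof. by move=> xX h0 h1; rewrite /sbd bd_glue // mum_id. Qed.

Lemma supp_sub D C c : D \subset C -> supp D c -> supp C c.
Proof. by move=> DC Dc F FC; apply: Dc; apply: contra FC; apply: (subsetP DC). Qed.

Lemma supp_subspace D : subspace (supp D).
Proof.
split=> [F _|a u v cu cv F HF]; first by rewrite ffunE.
by rewrite !ffunE cu // cv // scaler0 addr0.
Qed.

Lemma supp0 c : supp set0 c <-> c = 0.
Proof.
split=> [H|-> F _]; last by rewrite ffunE.
by apply/ffunP => F; rewrite ffunE H // inE.
Qed.

Lemma suppI D C c : supp D c -> supp C c -> supp (D :&: C) c.
Proof. by move=> HD HC F; rewrite inE negb_and => /orP[/HD|/HC]. Qed.

Lemma fin_supp D : fin (supp D).
Proof. by exists #|D|; apply: has_dim_supp. Qed.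

Lemma sbd_linear X : linear (sbd X).
Proof. by apply: bd_linear. Qed.

Lemma sbd_sbd X c : sbd X (sbd X c) = 0.
Proof. by apply: bd_bd. Qed.

Lemma scyc_subspace X D G : subspace (scyc X D G).
Proof.
apply: subspaceI; first exact: supp_subspace.
exact: (subspace_pre (sbd_linear X) (supp_subspace G)).
Qed.

Lemma fin_scyc X D G : fin (scyc X D G).
Proof. by apply: (fin_sub (fin_supp D)) => [|c []//]; apply: scyc_subspace. Qed.

Hint Resolve fin_scyc scyc_subspace sbd_linear fin_supp supp_subspace : core.

Lemma rcyc_mono X D D' G G' : D \subset D' -> G \subset G' -> (rcyc X D G <= rcyc X D' G')%N.
Proof.
move=> DD' GG'; apply: dim_le => // c [cD cG].
by split; [apply: supp_sub cD | apply: supp_sub cG].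
Qed.

Lemma rcyc_super X D1 D2 G1 G2 :
  (rcyc X D1 G1 + rcyc X D2 G2 <= rcyc X (D1 :&: D2) (G1 :&: G2) + rcyc X (D1 :|: D2) (G1 :|: G2))%N.
Proof.
apply: leq_trans (dim_super (fin_scyc X (D1 :|: D2) (G1 :|: G2)) _ _ _ _) _ => //.
- by move=> c [? ?]; split; apply: supp_sub (subsetUl _ _) _.
- by move=> c [? ?]; split; apply: supp_sub (subsetUr _ _) _.
rewrite leq_add2r; apply: dim_le => // [|c [[? ?] [? ?]]].
  by apply: (fin_sub (fin_scyc X D1 G1)) => [|c []//]; apply: subspaceI.
by split; apply: suppI.
Qed.

Lemma rcyc_card X D G : (rcyc X D G <= #|D|)%N.
Proof.
have <- : dim (supp D) = #|D| by apply: dimE; apply: has_dim_supp.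
by apply: dim_le => // c [].
Qed.

(** Requiring support in [D'] imposes at most [#|D| - #|D'|] linear conditions on the chains on
    [D]. *)
Lemma rcyc_lipschitz X D D' G : D' \subset D ->
  (rcyc X D G + #|D'| <= rcyc X D' G + #|D|)%N.
Proof.
move=> DD'; have cE C : #|C| = dim (supp C) by apply/esym/dimE; apply: has_dim_supp.
rewrite !cE; apply: leq_trans (dim_super (fin_supp D) _ _ _ _) _ => //.
- by move=> c [].
- by move=> c; apply: supp_sub.
rewrite leq_add2r; apply: dim_le => // [|c [[_ cG] cD]]; last by split.
by apply: (fin_sub (fin_scyc X D G)) => [|c []//]; apply: subspaceI.
Qed.

Lemma rcyc_eq_card X D G :
  (forall x F, x \in X -> x \notin F -> x |: F \in D -> F \in G) -> rcyc X D G = #|D|.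
Proof.
move=> DG; have <- : dim (supp D) = #|D| by apply: dimE; apply: has_dim_supp.
apply: dim_ext => c; split=> [[]//|cD]; split=> // F FG.
rewrite ffunE big1 // => x; rewrite inE => /andP[xF xX].
by rewrite cD ?scaler0 //; apply: contra FG; apply: DG.
Qed.

(** The kernels of the boundary on the two spaces over [C] agree, so only the images differ. The
    image for [U0] is the image for [U] cut down to cycles on [U0], and this loses at most the
    difference between the cycles on [U] and on [U0]. *)
Lemma rcyc_trade X C U0 U : U0 \subset U ->
  (rcyc X C U + rcyc X U0 set0 <= rcyc X C U0 + rcyc X U set0)%N.
Proof.
move=> UU.
rewrite /rcyc (rank_nullity (sbd_linear X) (fin_scyc X C U)).
rewrite (rank_nullity (sbd_linear X) (fin_scyc X C U0)).
rewrite (_ : dim (fun v => scyc X C U v /\ sbd X v = 0%R) = dim (fun v => scyc X C U0 v /\ sbd X v = 0%R)).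
  rewrite -!addnA leq_add2l.
  apply: leq_trans (dim_super (fin_scyc X U set0) _ _ _ _) _ => //.
  - exact: (subspace_img (sbd_linear X)).
  - by move=> _ [c [_ cU] ->]; split=> //; rewrite sbd_sbd; apply/supp0.
  - by move=> c [cU c0]; split=> //; apply: supp_sub cU.
  rewrite leq_add2r; apply: dim_le; last first.
  - by move=> c [[b [bC _] ->] [cU _]]; exists b.
  - exact: (fin_img (sbd_linear X)).
  apply: (fin_sub (fin_scyc X U0 set0)) => [|c []//].
  by apply: subspaceI => //; apply: (subspace_img (sbd_linear X)).
apply: dim_ext => c; split=> -[[cC _] c0]; split=> //; split=> //; rewrite c0.
  by case: (supp_subspace U0).
by case: (supp_subspace U).
Qed.

Lemma rcyc_trade2 X J J' D : J \subset J' ->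
  (rcyc X J D + rcyc X J' set0 <= rcyc X J' D + rcyc X J set0)%N.
Proof.
move=> JJ; apply: leq_trans (rcyc_super _ _ _ _ _) _.
by rewrite (setIidPl JJ) (setUidPr JJ) setI0 setU0 addnC.
Qed.

Definition del x D : {set {set 'I_n}} := [set F in D | x \notin F].
Definition link x D : {set {set 'I_n}} := [set F : {set 'I_n} | (x \notin F) && (x |: F \in D)].

Lemma supp_part0 x D c : supp D c -> supp (del x D) (part0 x c).
Proof. by move=> cD F; rewrite !inE ffunE negb_and negbK => /orP[/cD->|->]; rewrite ?if_same. Qed.

Lemma supp_part1 x D c : supp D c -> supp (link x D) (part1 x c).
Proof.
move=> cD F; rewrite !inE ffunE negb_and negbK; case: ifP => //= _ /cD ->.
by rewrite scaler0.
Qed.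

Lemma supp_avoid x D c : (forall F, F \in D -> x \notin F) -> supp D c ->
  forall F, x \in F -> c F = 0.
Proof. by move=> Dx cD F xF; apply: cD; apply/negP => /Dx; rewrite xF. Qed.

Lemma del_avoid x D F : F \in del x D -> x \notin F.
Proof. by rewrite inE => /andP[]. Qed.

Lemma link_avoid x D F : F \in link x D -> x \notin F.
Proof. by rewrite inE => /andP[]. Qed.

Lemma supp_glue x D c0 c1 : supp (del x D) c0 -> supp (link x D) c1 -> supp D (glue x c0 c1).
Proof.
move=> h0 h1 F FD; rewrite ffunE; case: ifP => xF.
  by rewrite h1 ?scaler0 // !inE setD1K // (negbTE FD) andbF.
by apply: h0; rewrite inE (negbTE FD).
Qed.

(** In a cycle, [part1] is minus the boundary of [part0]. So [part0] determines the cycle, and the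
    remaining condition is that its boundary lies in the link. *)
Lemma rcyc_split X x D : x \notin X -> rcyc (x |: X) D set0 = rcyc X (del x D) (link x D).
Proof.
move=> xX; rewrite /rcyc -(dim_inj (part0_linear x)) //.
  apply: dim_ext => c; split=> [[b [bD /supp0 b0] ->]|[cD cL]].
    split; first exact: supp_part0.
    have := spart0_bd b xX; rewrite b0 (lin0 (part0_linear x)) => /esym/eqP.
    rewrite addr_eq0 => /eqP ->; apply: (subspaceN (supp_subspace _)); exact: supp_part1.
  have h0 := supp_avoid (@del_avoid x D) cD.
  have h1 := supp_avoid (@link_avoid x D) cL.
  have h1' F : x \in F -> (- sbd X c) F = 0 by move=> /h1 e; rewrite ffunE e oppr0.
  exists (glue x c (- sbd X c)); last by rewrite part0_glue.
  split; first by apply: supp_glue => //; apply: (subspaceN (supp_subspace _)).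
  apply/supp0; rewrite sbd_glue // subrr.
  rewrite (linN (sbd_linear X)) sbd_sbd.
  by apply/ffunP => F; rewrite !ffunE; case: ifP; rewrite ?ffunE ?oppr0 ?scaler0.
move=> c [cD /supp0 c0] p0; apply: (part_eq0 p0).
have := spart0_bd c xX; rewrite c0 p0 (lin0 (part0_linear x)) (lin0 (sbd_linear X)).
by rewrite add0r.
Qed.

(** A chain with vanishing [part0] is a cone over some [c]. The two parts of its boundary are [c]
    and minus the boundary of [c], which explains the three families on the right. *)
Lemma rcyc_cube_aux X y D G : y \notin X ->
  rcyc (y |: X) D G = (dim (fun c => scyc (y |: X) D G c /\ part0 y c = 0%R)
    + dim (img (part0 y) (scyc (y |: X) D G)))%N /\
  dim (fun c => scyc (y |: X) D G c /\ part0 y c = 0%R) =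
    rcyc X (link y D :&: del y G) (link y G).
Proof.
move=> yX; split; first exact: (rank_nullity (part0_linear y)).
rewrite -(dim_inj (part1_linear y)); first last.
- by move=> c [_ c0] c1; apply: (part_eq0 c0 c1).
- by apply: fin_ker => //; exact: (part0_linear y).
apply: dim_ext => c; split=> [[b [[bD bG] b0] ->]|[cD cG]].
  have := spart0_bd b yX; rewrite b0 (lin0 (sbd_linear X)) add0r => e.
  split; first by apply: suppI; [apply: supp_part1 | rewrite -e; apply: supp_part0].
  rewrite -[sbd X _]opprK; apply: (subspaceN (supp_subspace _)); rewrite -spart1_bd //.
  exact: supp_part1.
have h1 : forall F, y \in F -> c F = 0.
  apply: supp_avoid cD => F; rewrite inE => /andP[/link_avoid]; exact.
have h0 : forall F, y \in F -> (0 : sch) F = 0 by move=> F _; rewrite ffunE.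
exists (glue y 0 c); last by rewrite part1_glue.
split; last by rewrite part0_glue.
split.
  apply: supp_glue; first by case: (supp_subspace (del y D)).
  by apply: supp_sub cD; apply: subsetIl.
rewrite sbd_glue // (lin0 (sbd_linear X)) add0r.
apply: supp_glue; first by apply: supp_sub cD; apply: subsetIr.
by apply: (subspaceN (supp_subspace _)).
Qed.

(** By [spart0_bd] the boundary of [part0 y c] is a difference of chains on [del y G] and on
    [link y D], hence supported on their union. *)
Lemma rcyc_cube_le X y D G : y \notin X ->
  (rcyc (y |: X) D G <=
     rcyc X (del y D) (link y D :|: del y G) + rcyc X (link y D :&: del y G) (link y G))%N.
Proof.
move=> yX; have [-> ->] := rcyc_cube_aux D G yX; rewrite addnC leq_add2r.
apply: dim_le => //; first by apply: fin_img => //; exact: (part0_linear y).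
move=> _ [c [cD cG] ->]; split; first exact: supp_part0.
have := spart0_bd c yX => /(congr1 (fun z => z - part1 y c)); rewrite addrK => <-.
apply: (subspaceD (supp_subspace _)); first by apply: supp_sub (supp_part0 (x:=y) cG); apply: subsetUr.
by apply: (subspaceN (supp_subspace _)); apply: supp_sub (supp_part1 (x:=y) cD); apply: subsetUl.
Qed.

(** Nesting lets every chain with boundary on the union be lifted. If [link y D] is the smaller
    family, put 0 at [y]; otherwise put minus the boundary there, which makes the glued chain a
    cycle. *)
Lemma rcyc_cube X y D G : y \notin X ->
  (link y D \subset del y G) || (del y G \subset link y D) ->
  rcyc (y |: X) D G =
    (rcyc X (del y D) (link y D :|: del y G) + rcyc X (link y D :&: del y G) (link y G))%N.
Proof.
move=> yX nest; apply/eqP; rewrite eqn_leq rcyc_cube_le //=.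
have [-> ->] := rcyc_cube_aux D G yX; rewrite addnC leq_add2l.
apply: dim_le => //; first by apply: fin_img => //; exact: (part0_linear y).
move=> c [cD cG].
have h0 := supp_avoid (@del_avoid y D) cD.
have h0' F : y \in F -> (0 : sch) F = 0 by move=> _; rewrite ffunE.
have z E : supp E 0 by case: (supp_subspace E).
case/orP: nest => nest.
  exists (glue y c 0); last by rewrite part0_glue.
  split; first by apply: supp_glue.
  rewrite sbd_glue // addr0 (lin0 (sbd_linear X)) oppr0.
  by apply: supp_glue => //; rewrite -(setUidPr nest).
have cL : supp (link y D) (sbd X c) by rewrite -(setUidPl nest).
have h1 := supp_avoid (@link_avoid y D) cL.
have h1' F : y \in F -> (- sbd X c) F = 0 by move=> /h1 e; rewrite ffunE e oppr0.
exists (glue y c (- sbd X c)); last by rewrite part0_glue.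
split; first by apply: supp_glue => //; apply: (subspaceN (supp_subspace _)).
rewrite sbd_glue // subrr (linN (sbd_linear X)) sbd_sbd !oppr0.
exact: supp_glue.
Qed.

Definition full Y p : {set {set 'I_n}} := [set F : {set 'I_n} | (F \subset Y) && (#|F| == p)].

(* The full simplex on a nonempty set is a cone, hence acyclic. *)
Lemma rcyc_exact X Y q U : Y \subset X -> Y != set0 -> U \subset full Y q ->
  rcyc X (full Y q.+1) U = (rcyc X (full Y q.+1) set0 + rcyc X U set0)%N.
Proof.
move=> YX /set0Pn[x xY] Uf.
have XE : x |: (X :\ x) = X by rewrite setD1K // (subsetP YX).
have nx : x \notin X :\ x by rewrite !inE eqxx.
rewrite {1}/rcyc (rank_nullity (sbd_linear X)) //; congr (_ + _)%N.
  apply: dim_ext => c; split=> [[[cD _] c0]|[cD /supp0 c0]]; first by split=> //; apply/supp0.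
  by split=> //; split=> //; rewrite c0; case: (supp_subspace U).
apply: dim_ext => c; split=> [[b [bD bU] ->]|[cU /supp0 c0]].
  by split=> //; rewrite sbd_sbd; apply/supp0.
have h0 F : x \in F -> (0 : sch) F = 0 by rewrite ffunE.
have h1 F : x \in F -> (part0 x c) F = 0 by rewrite ffunE => ->.
have gE : sbd X (glue x 0 (part0 x c)) = c.
  rewrite -XE sbd_glue // (lin0 (sbd_linear _)) add0r.
  have := spart0_bd c nx; rewrite XE c0 (lin0 (part0_linear x)) => /esym/eqP.
  rewrite addrC addr_eq0 => /eqP e.
  apply: (@part_inj k n k^o x); rewrite ?part0_glue ?part1_glue // => F xF.
  by rewrite ffunE [sbd _ _ F](bd_avoid _ _ h1 xF) ?oppr0.
exists (glue x 0 (part0 x c)); rewrite ?gE //; split; rewrite ?gE //.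
apply: supp_glue; first by case: (supp_subspace (del x (full Y q.+1))).
apply: supp_sub (supp_part0 (x:=x) cU); apply/subsetP => F; rewrite !inE => /andP[FU xF].
have := subsetP Uf _ FU; rewrite inE => /andP[FY /eqP cF].
by rewrite xF subUset sub1set xY FY cardsU1 xF cF /=.
Qed.

End Simplex.

(** * Sorting set systems *)

Section Sorting.
Variables (k : fieldType) (n : nat) (X : {set 'I_n}).
Local Open Scope nat_scope.
Local Notation fam := {set {set 'I_n}}.
Local Notation sX := (@rcyc k n X).
Implicit Types (A C D U : nat -> fam) (F : {set 'I_n}).

Definition cnt N A F := \sum_(i < N) (F \in A i : nat).
(** The decreasing rearrangement, carried out for all sets at once: the entries become nested and
    every set keeps its multiplicity. *)
Definition srt N A l : fam := [set F | l < cnt N A F].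

Lemma cntS N A F : cnt N.+1 A F = cnt N A F + (F \in A N).
Proof. by rewrite /cnt big_ord_recr. Qed.

Lemma cnt_le N A F : cnt N A F <= N.
Proof. by elim: N => [|N IH]; rewrite ?cntS /cnt ?big_ord0 //; move: IH; rewrite /cnt; case: (_ \in _); lia. Qed.

Lemma srt_set0 N l : srt N (fun=> set0) l = set0.
Proof. by apply/setP => F; rewrite !inE /cnt big1 // => i _; rewrite inE. Qed.

Lemma cnt_lt (u e : nat) : u <= e -> \sum_(l < e) (l < u : nat) = u.
Proof.
move=> ue; rewrite -(subnKC ue) big_split_ord /=.
rewrite (eq_bigr (fun=> 1)) => [|i _]; last by rewrite ltn_ord.
rewrite sum1_card card_ord big1 ?addn0 // => i _.
by rewrite ltnNge leq_addr.
Qed.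

Lemma cnt_srt N e A F : cnt N A F <= e -> cnt e (srt N A) F = cnt N A F.
Proof. by move=> le; rewrite -[RHS](cnt_lt le); apply: eq_bigr => i _; rewrite inE. Qed.

(* Sorting by adjacent exchanges: inserting the N-th term into the sorted
   prefix carries [set F in C N | m <= cnt N C F] past position m. *)
Lemma sort_le N C U :
  \sum_(l < N) sX (C l) (U l) <= \sum_(l < N) sX (srt N C l) (srt N U l).
Proof.
elim: N => [|N IH]; first by rewrite !big_ord0.
pose carry A m : fam := [set F in A N | m <= cnt N A F].
have ins m : m <= N ->
    \sum_(l < m) sX (srt N C l) (srt N U l) + sX (C N) (U N) <=
    \sum_(l < m) sX (srt N.+1 C l) (srt N.+1 U l) + sX (carry C m) (carry U m).
  elim: m => [_|m IHm mN].
    rewrite !big_ord0 !add0n; apply: rcyc_mono; apply/subsetP => F FN; by rewrite inE FN.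
  rewrite !big_ord_recr /= addnAC.
  apply: leq_trans (leq_add (IHm (ltnW mN)) (leqnn _)) _.
  rewrite -!addnA leq_add2l addnC.
  have I A : srt N A m :&: carry A m = carry A m.+1.
    by apply/setP => F; rewrite !inE; case: (F \in A N); lia.
  have O A : srt N A m :|: carry A m = srt N.+1 A m.
    by apply/setP => F; rewrite !inE cntS; case: (F \in A N) => /=; lia.
  by have := rcyc_super k X (srt N C m) (carry C m) (srt N U m) (carry U m); rewrite !I !O addnC [X in _ <= X -> _]addnC.
rewrite big_ord_recr [leqRHS]big_ord_recr /=.
apply: leq_trans (leq_add IH (leqnn _)) _; apply: leq_trans (ins N (leqnn _)) _.
rewrite leq_add2l; apply: rcyc_mono; apply/subsetP => F; rewrite !inE cntS.
  by case/andP=> ->; lia.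
by case/andP=> ->; lia.
Qed.

Lemma sum_half (x : nat -> nat) e : \sum_(l < e + e) x l./2 = (\sum_(l < e) x l).*2.
Proof.
elim: e => [|e IH]; first by rewrite !big_ord0.
rewrite addSn addnS !big_ord_recr /= IH addnn doubleD uphalf_double half_double.
by rewrite -addnA addnn.
Qed.

(** Sort the concatenation of the two sequences. A set of multiplicity 2c fills its first 2c places,
    so entry l of the result is entry [l./2] of [srt e A]. *)
Lemma sort_double e A U (V : nat -> fam) :
  (forall F, cnt e U F + cnt e V F = (cnt e A F).*2) ->
  \sum_(l < e) sX (U l) set0 + \sum_(l < e) sX (V l) set0 <= (\sum_(l < e) sX (srt e A l) set0).*2.
Proof.
move=> cntE; pose h l := if l < e then U l else V (l - e).
have hE (x : fam -> nat) : \sum_(l < e + e) x (h l) = \sum_(l < e) x (U l) + \sum_(l < e) x (V l).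
  rewrite big_split_ord /=; congr (_ + _); apply: eq_bigr => i _; rewrite /h ?ltn_ord //.
  by rewrite ltnNge leq_addr /= addKn.
rewrite -(hE (fun D : fam => sX D set0)).
apply: leq_trans (sort_le _ _ (fun=> set0)) _.
rewrite -(sum_half (fun l => sX (srt e A l) set0)) leq_eqVlt; apply/orP; left; apply/eqP.
apply: eq_bigr => l _; rewrite srt_set0; congr sX; apply/setP => F; rewrite !inE.
rewrite /cnt (hE (fun D : fam => (F \in D : nat))) -!/(cnt _ _ _) cntE.
by lia.
Qed.

(** The number of ones minus the number of adjacent pairs of ones is the number of runs. There is at
    least one run if there is a one, and there are at least two if both ends are ones but some entry
    is not. *)
Lemma cnt_and (a : nat -> bool) N :
  \sum_(i < N) (a i.+1 && a i : nat) + [&& a 0, a N & \sum_(i < N.+1) a i < N.+1]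
    + (0 < \sum_(i < N.+1) (a i : nat)) <= \sum_(i < N.+1) (a i : nat).
Proof.
elim: N => [|N IH]; first by rewrite big_ord0 big_ord_recr big_ord0 /=; case: (a 0).
rewrite big_ord_recr [in leqRHS]big_ord_recr [in X in _ + X <= _]big_ord_recr [in X in _ + X + _ <= _]big_ord_recr /=.
move: IH; set c := \sum_(i < N.+1) a i; set i := \sum_(i < N) _.
have c0 : a 0 <= c by rewrite /c big_ord_recl leq_addr.
have cN : a N <= c by rewrite /c big_ord_recr leq_addl.
by move: c0 cN; case: (a 0); case: (a N); case: (a N.+1) => /=; lia.
Qed.

Lemma cnt_or (a : nat -> bool) N :
  \sum_(i < N) (a i.+1 || a i : nat) + \sum_(i < N) (a i.+1 && a i : nat) + a 0 + a N
   = (\sum_(i < N.+1) (a i : nat)).*2.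
Proof.
elim: N => [|N IH]; first by rewrite !big_ord0 big_ord_recr big_ord0 /=; lia.
rewrite !(big_ord_recr N) [in RHS]big_ord_recr /= doubleD -IH.
by case: (a N); case: (a N.+1) => /=; lia.
Qed.

(** The arithmetic of [tot_sort] for a single set: [c] is its multiplicity in the sequence, [a0 + u]
    and [i + aN] are those among the unions and the meets of neighbours. Unions of the sorted
    sequence then lie in the sorted unions, and sorted meets lie in the meets of the sorted
    sequence. *)
Lemma run_bounds (a0 aN : bool) (i u c N l : nat) : c <= N.+1 ->
  i + [&& a0, aN & c < N.+1] + (0 < c) <= c -> u + i + a0 + aN = c.*2 -> (aN -> a0) ->
  l < N.+1 ->
  [/\ 0 < c -> l <= c -> l < a0 + u, l < i + aN -> l < c & l < i + aN -> l < N -> l.+1 < c].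
Proof.
case: a0; case: aN => c1 c2 c3 imp lN; try by have := imp isT.
- by move: c2; rewrite [[&& _, _ & _]]/=; case: (ltnP c N.+1) => cN c2; split; lia.
- by move: c2; rewrite [[&& _, _ & _]]/= => c2; split; lia.
- by move: c2; rewrite [[&& _, _ & _]]/= => c2; split; lia.
Qed.

Lemma run_bounds_cyclic (a0 aN : bool) (i u c N l : nat) : c <= N.+1 ->
  i + [&& a0, aN & c < N.+1] + (0 < c) <= c -> u + i + a0 + aN = c.*2 ->
  l < N -> (l < c -> l < u) /\ (l < i -> l.+1 < c).
Proof.
case: a0; case: aN => c1 c2 c3 lN;
  move: c2; rewrite [[&& _, _ & _]]/=; case: (ltnP c N.+1) => cN c2; split; lia.
Qed.

Definition prev A l : fam := if l is l'.+1 then A l' else set0.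

Definition srt_below e A l : fam := if l < e then srt e A l else A l.

Lemma sum_trade e C U (U' : nat -> fam) : (forall l, l < e -> U' l \subset U l) ->
  \sum_(l < e) sX (C l) (U l) + \sum_(l < e) sX (U' l) set0 <=
  \sum_(l < e) sX (C l) (U' l) + \sum_(l < e) sX (U l) set0.
Proof. by move=> sub; rewrite -!big_split; apply: leq_sum => i _; apply: rcyc_trade; apply: sub. Qed.

Lemma sum_trade2 e (I I' : nat -> fam) D : (forall l, l < e -> I l \subset I' l) ->
  \sum_(l < e) sX (I l) (D l) + \sum_(l < e) sX (I' l) set0 <=
  \sum_(l < e) sX (I' l) (D l) + \sum_(l < e) sX (I l) set0.
Proof. by move=> sub; rewrite -!big_split; apply: leq_sum => i _; apply: rcyc_trade2; apply: sub. Qed.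

(** [sort_le] sorts [C] against the unions [U], and the meets [I] against [D]. Compared with [U']
    and [I'], the sorted unions are too large and the sorted meets too small; [sum_trade] and
    [sum_trade2] bound the effect by numbers of cycles. These corrections balance by [sort_double],
    because [U] and [I] together contain each set twice as often as [A]. *)
Lemma tot_sort N C A D (A' := srt_below N.+1 A) :
  A N \subset A 0 -> A N \subset A N.+1 ->
  \sum_(l < N.+1) sX (C l) (A l :|: prev A l) + \sum_(l < N.+1) sX (A l.+1 :&: A l) (D l) <=
  \sum_(l < N.+1) sX (srt N.+1 C l) (A' l :|: prev A' l)
    + \sum_(l < N.+1) sX (A' l.+1 :&: A' l) (srt N.+1 D l).
Proof.
move=> AN0 ANN.
pose U l := A l :|: prev A l; pose I l := A l.+1 :&: A l.
pose U' l := A' l :|: prev A' l; pose I' l := A' l.+1 :&: A' l.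
have cU F : cnt N.+1 U F = (F \in A 0) + \sum_(i < N) ((F \in A i.+1) || (F \in A i) : nat).
  by rewrite /cnt big_ord_recl /= !inE orbF; congr (_ + _); apply: eq_bigr => i _; rewrite !inE.
have cI F : cnt N.+1 I F = \sum_(i < N) ((F \in A i.+1) && (F \in A i) : nat) + (F \in A N).
  rewrite cntS; congr (_ + _); first by apply: eq_bigr => i _; rewrite !inE.
  by rewrite !inE; case: (boolP (F \in A N)) => [/(subsetP ANN) ->|]; rewrite ?andbF.
have Aor F := cnt_or (fun l => F \in A l) N; have Aand F := cnt_and (fun l => F \in A l) N.
rewrite /= in Aor Aand.
have A'E l : l < N.+1 -> A' l = srt N.+1 A l by move=> lN; rewrite /A' /srt_below lN.
have FN F : F \in A N -> F \in A 0 by apply: (subsetP AN0).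
have rb F l := @run_bounds _ _ _ _ _ N l (cnt_le N.+1 A F) (Aand F) (Aor F) (FN F).
have sU l : l < N.+1 -> U' l \subset srt N.+1 U l.
  move=> lN; apply/subsetP => F; have [H1 _ _] := rb F l lN.
  rewrite /U' !inE cU (A'E l lN) inE => H; suff [? ?] : 0 < cnt N.+1 A F /\ l <= cnt N.+1 A F by apply: H1.
  case/orP: H {H1} => [|]; first by move=> H; rewrite (leq_trans _ H) // ltnW.
  case: l lN => [|l] lN; rewrite /= ?inE // (A'E l (ltnW lN)) inE => H.
  by rewrite (leq_trans _ H).
have sI l : l < N.+1 -> srt N.+1 I l \subset I' l.
  move=> lN; apply/subsetP => F; have [_ H2 H3] := rb F l lN.
  rewrite /I' !inE cI (A'E l lN) inE => H; rewrite H2 // andbT.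
  rewrite /A' /srt_below; case: ifP => lN'; first by rewrite inE H3.
  have lE : l = N by apply/eqP; rewrite eqn_leq -ltnS lN leqNgt -ltnS lN'.
  have := H2 H; rewrite lE cntS => H4; apply: (subsetP ANN); move: H4.
  by have := cnt_le N A F; case: (F \in A N) => //; rewrite addn0 leqNgt => /negbTE ->.
have U0 : U' 0 = A' 0 by rewrite /U' setU0.
have dec l : l < N -> A' l.+1 \subset A' l.
  by move=> lN; rewrite (A'E l.+1 lN) (A'E l (ltnW lN)); apply/subsetP => F; rewrite !inE; apply: ltnW.
have US l : l < N -> U' l.+1 = A' l by move=> /dec/setUidPr.
have IS l : l < N -> I' l = A' l.+1 by move=> /dec/setIidPl.
have IN : I' N = A' N.
  apply/setIidPr; rewrite A'E // /A' /srt_below ltnn; apply/subsetP => F.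
  rewrite inE cntS => H; apply: (subsetP ANN); move: H (cnt_le N A F).
  by case: (F \in A N) => //; rewrite addn0 => H1 H2; have := leq_trans H1 H2; rewrite ltnn.
pose y l := sX (srt N.+1 A l) set0.
have e1 : \sum_(l < N.+1) sX (U' l) set0 = y 0 + \sum_(l < N) y l.
  rewrite big_ord_recl /= U0 (A'E 0 isT); congr (_ + _); apply: eq_bigr => i _.
  by rewrite US // (A'E i (ltnW (ltn_ord i))).
have e2 : \sum_(l < N.+1) sX (I' l) set0 = \sum_(l < N) y l.+1 + y N.
  rewrite big_ord_recr /= IN (A'E N (leqnn _)); congr (_ + _); apply: eq_bigr => i _.
  by rewrite IS // (A'E i.+1 (ltn_ord i)).
have e3 : \sum_(l < N.+1) y l = y 0 + \sum_(l < N) y l.+1 by rewrite big_ord_recl.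
have e4 : \sum_(l < N.+1) y l = \sum_(l < N) y l + y N by rewrite big_ord_recr.
have dbl := @sort_double N.+1 A (srt N.+1 U) (srt N.+1 I).
have {}dbl : \sum_(l < N.+1) sX (srt N.+1 U l) set0 + \sum_(l < N.+1) sX (srt N.+1 I l) set0
    <= (\sum_(l < N.+1) y l).*2.
  apply: dbl => F; rewrite !cnt_srt ?cnt_le // cU cI; have := Aor F; rewrite -/(cnt _ _ _) => <-.
  by rewrite [(F \in A 0) + _]addnC -!addnA; congr (_ + _); rewrite addnCA.
have s1 := sort_le N.+1 C U; have s2 := sort_le N.+1 I D.
have t1 := sum_trade (srt N.+1 C) sU; have t2 := sum_trade2 (srt N.+1 D) sI.
apply: leq_trans (leq_add s1 s2) _.
have K (x1 x2 x3 x4 u i t j z z0 zN p q : nat) : x1 + u <= x2 + t -> x3 + i <= x4 + j ->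
  t + j <= z.*2 -> u = z0 + p -> i = q + zN -> z = z0 + q -> z = p + zN -> x1 + x3 <= x2 + x4.
  by clear; lia.
exact: (K _ _ _ _ _ _ _ _ _ _ _ _ _ t1 t2 dbl e1 e2 e3 e4).
Qed.

Lemma srt_last N A : srt N.+1 A N \subset A N.
Proof.
apply/subsetP => F; rewrite inE cntS => H; have := cnt_le N A F; move: H.
by case: (F \in A N) => //; rewrite addn0 => H1 H2; have := leq_trans H1 H2; rewrite ltnn.
Qed.

(** The cycle count of a whole line of monomials after splitting along two variables: [C], [A] and
    [D] come from faces with none, one or both of these variables. *)
Definition tot K C A D :=
  \sum_(l < K) sX (C l) (A l :|: prev A l) + \sum_(l < K) sX (A l.+1 :&: A l) (D l).

Lemma rcyc_set0 (D : fam) : sX set0 D = 0.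
Proof. by apply/eqP; rewrite -leqn0 -(cards0 {set 'I_n}); apply: rcyc_card. Qed.

Lemma tot_sort_below N K C A D : N < K -> A N \subset A 0 -> A N \subset A N.+1 ->
  tot K C A D <= tot K (srt_below N.+1 C) (srt_below N.+1 A) (srt_below N.+1 D).
Proof.
move=> /subnKC <- AN0 ANN; rewrite /tot !big_split_ord /= addnACA [leqRHS]addnACA.
apply: leq_add.
  apply: leq_trans (tot_sort C D AN0 ANN) _.
  by apply: leq_add; apply: leq_sum => i _; rewrite ?[srt_below _ C _]/srt_below ?[srt_below _ D _]/srt_below ltn_ord.
have hi B l : srt_below N.+1 B (N.+1 + l) = B (N.+1 + l) by rewrite /srt_below ltnNge leq_addr.
have pE B i : srt_below N.+1 B (N + i.+1) = B (N + i.+1) by rewrite -addSnnS hi.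
apply: leq_add; apply: leq_sum => i _; rewrite !hi; last by rewrite -!addnS !hi.
case: i => [[|i] ilt]; last by rewrite [nat_of_ord _]/= !pE.
rewrite /= !addn0 /srt_below ltnSn (setUidPl ANN) (setUidPl _) //.
exact: subset_trans (srt_last N A) ANN.
Qed.

Lemma srt_below_dec N A l : l < N -> srt_below N.+1 A l.+1 \subset srt_below N.+1 A l.
Proof.
move=> lN; rewrite /srt_below !ltnS lN (ltnW lN); apply/subsetP => F; rewrite !inE.
exact: ltnW.
Qed.

Lemma srt_meet_sub N A l : l < N ->
  srt N (fun l => A l.+1 :&: A l) l \subset srt_below N.+1 A l.+1 :&: srt_below N.+1 A l.
Proof.
move=> lN; rewrite (setIidPl (srt_below_dec A lN)) /srt_below ltnS lN; apply/subsetP => F.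
have cI : cnt N (fun l => A l.+1 :&: A l) F = \sum_(i < N) ((F \in A i.+1) && (F \in A i) : nat).
  by apply: eq_bigr => i _; rewrite !inE.
have Aor := cnt_or (fun l => F \in A l) N; have Aand := cnt_and (fun l => F \in A l) N.
rewrite !inE cI /=.
by have [_] := @run_bounds_cyclic _ _ _ _ _ N l (cnt_le N.+1 A F) Aand Aor lN.
Qed.

Lemma srt_below_last N A l : A N = set0 -> l < N -> srt_below N.+1 A l = srt N A l.
Proof.
by move=> AN lN; rewrite /srt_below ltnS (ltnW lN); apply/setP => F; rewrite !inE cntS AN inE addn0.
Qed.

(** Here both ends [C 0] and [C N.+1] are full and nothing relates [A 0] to [A N]. Acyclicity of
    [Phi] splits [sX (A 0) set0] and [sX (A N) set0] off the end terms. With these two families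
    added to the unions and meets of neighbours, each set again occurs twice as often as in [A]. *)
Lemma tot_sort_cyclic N K (Phi Psi : fam) C A D : N.+1 < K ->
  (forall G : fam, G \subset Psi -> sX Phi G = sX Phi set0 + sX G set0) ->
  C 0 = Phi -> C N.+1 = Phi -> (forall l, C l \subset Phi) -> (forall l, N.+1 < l -> C l = set0) ->
  (forall l, A l \subset Psi) -> (forall l, N < l -> A l = set0) -> D N = set0 ->
  tot K C A D <= tot K (srt_below N.+1 C) (srt_below N.+1 A) (srt_below N.+1 D).
Proof.
move=> NK exP C0 Ce CP Cbig AP Abig DN.
pose C' := srt_below N.+1 C; pose A' := srt_below N.+1 A; pose D' := srt_below N.+1 D.
rewrite -/C' -/A' -/D'.
have A'E l : l < N.+1 -> A' l = srt N.+1 A l by move=> lN; rewrite /A' /srt_below lN.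
have A'big l : N < l -> A' l = set0.
  by move=> lN; rewrite /A' /srt_below ltnNge lN /= Abig.
have A'P l : A' l \subset Psi.
  rewrite /A' /srt_below; case: ifP => // _; apply/subsetP => F; rewrite inE.
  case: (boolP (F \in Psi)) => // FP; rewrite /cnt big1 // => i _.
  by apply/eqP; rewrite eqb0; apply: contra FP; apply: (subsetP (AP i)).
have C'0 : C' 0 = Phi.
  apply/setP => F; rewrite /C' /srt_below /= inE /cnt big_ord_recl C0.
  case: (boolP (F \in Phi)) => // FP; rewrite big1 // => i _.
  by apply/eqP; rewrite eqb0; apply: contra FP; apply: (subsetP (CP _)).
have C'e : C' N.+1 = Phi by rewrite /C' /srt_below ltnn.
have C'big l : N.+1 < l -> C' l = set0.
  by move=> lN; rewrite /C' /srt_below ltnNge (ltnW lN) /= Cbig.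
have C'S l : l < N -> C' l.+1 = srt N (fun l => C l.+1) l.
  move=> lN; apply/setP => F; rewrite /C' /srt_below ltnS lN !inE /cnt big_ord_recl C0.
  case: (boolP (F \in Phi)) => // FP; rewrite !big1 // => i _;
  by apply/eqP; rewrite eqb0; apply: contra FP; apply: (subsetP (CP _)).
have D'S l : l < N -> D' l = srt N D l.
  exact: srt_below_last.
have split_tot (C1 A1 D1 : nat -> fam) :
    C1 0 = Phi -> C1 N.+1 = Phi -> (forall l, N.+1 < l -> C1 l = set0) ->
    (forall l, A1 l \subset Psi) -> (forall l, N < l -> A1 l = set0) ->
  tot K C1 A1 D1 = (sX Phi set0).*2 + (sX (A1 0) set0 + sX (A1 N) set0)
    + (\sum_(l < N) sX (C1 l.+1) (A1 l.+1 :|: A1 l) + \sum_(l < N) sX (A1 l.+1 :&: A1 l) (D1 l)).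
  move=> H0 He Hbig HA HAbig.
  rewrite /tot -(subnKC NK) !(@big_split_ord _ _ _ N.+2) /=.
  rewrite [X in _ + X + _]big1 ?addn0 => [|i _]; last by rewrite Hbig ?rcyc_set0 // leq_addr.
  rewrite [X in _ + (_ + X)]big1 ?addn0 => [|i _]; last first.
    by rewrite HAbig ?set0I ?rcyc_set0 //; clear; lia.
  rewrite big_ord_recl big_ord_recr /= H0 He setU0 (HAbig N.+1) // set0U (exP (A1 0)) // (exP (A1 N)) //.
  rewrite !big_ord_recr /= (HAbig N.+1) // (HAbig N.+2) // !set0I !rcyc_set0 !addn0.
  rewrite (_ : \sum_(i < N) sX (C1 (bump 0 i)) _ = \sum_(l < N) sX (C1 l.+1) (A1 l.+1 :|: A1 l)) //.
  by clear; lia.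
rewrite !split_tot // {split_tot}.
pose U l := A l.+1 :|: A l; pose I l := A l.+1 :&: A l.
have cU F : cnt N U F = \sum_(i < N) ((F \in A i.+1) || (F \in A i) : nat).
  by apply: eq_bigr => i _; rewrite !inE.
have cI F : cnt N I F = \sum_(i < N) ((F \in A i.+1) && (F \in A i) : nat).
  by apply: eq_bigr => i _; rewrite !inE.
have Aor F := cnt_or (fun l => F \in A l) N; have Aand F := cnt_and (fun l => F \in A l) N.
rewrite /= in Aor Aand.
have rb F l := @run_bounds_cyclic _ _ _ _ _ N l (cnt_le N.+1 A F) (Aand F) (Aor F).
have dec l : l < N -> A' l.+1 \subset A' l := @srt_below_dec N A l.
have sU l : l < N -> A' l.+1 :|: A' l \subset srt N U l.
  move=> lN; rewrite (setUidPr (dec l lN)) (A'E l (ltnW lN)); apply/subsetP => F.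
  by rewrite !inE cU; have [H _] := rb F l lN.
have sI l : l < N -> srt N I l \subset A' l.+1 :&: A' l := @srt_meet_sub N A l.
pose y l := sX (srt N.+1 A l) set0.
have e1 : \sum_(l < N) sX (A' l.+1 :|: A' l) set0 = \sum_(l < N) y l.
  by apply: eq_bigr => i _; rewrite (setUidPr (dec i (ltn_ord i))) (A'E i (ltnW (ltn_ord i))).
have e2 : \sum_(l < N) sX (A' l.+1 :&: A' l) set0 = \sum_(l < N) y l.+1.
  by apply: eq_bigr => i _; rewrite (setIidPl (dec i (ltn_ord i))) (A'E i.+1 (ltn_ord i)).
have e3 : \sum_(l < N.+1) y l = y 0 + \sum_(l < N) y l.+1 by rewrite big_ord_recl.
have e4 : \sum_(l < N.+1) y l = \sum_(l < N) y l + y N by rewrite big_ord_recr.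
(* There are only N unions and N meets; the two end families fill the places with index N. *)
have dbl := @sort_double N.+1 A (fun l => if l < N then srt N U l else A 0)
   (fun l => if l < N then srt N I l else A N).
have ext (f : nat -> fam) (B : fam) (g : fam -> nat) :
    \sum_(l < N.+1) g (if l < N then f l else B) = \sum_(l < N) g (f l) + g B.
  by rewrite big_ord_recr /= ltnn; congr (_ + _); apply: eq_bigr => i _; rewrite ltn_ord.
rewrite (ext (srt N U) (A 0) (fun D : fam => sX D set0)) (ext (srt N I) (A N) (fun D : fam => sX D set0)) in dbl.
have {}dbl := dbl _.
have {}dbl : \sum_(l < N) sX (srt N U l) set0 + sX (A 0) set0 +
     (\sum_(l < N) sX (srt N I l) set0 + sX (A N) set0) <= (\sum_(l < N.+1) y l).*2.
  apply: dbl => F; rewrite {1 2}/cnt (ext (srt N U) (A 0) (fun D : fam => (F \in D : nat))).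
  rewrite (ext (srt N I) (A N) (fun D : fam => (F \in D : nat))).
  have cs B : \sum_(l < N) (F \in srt N B l) = cnt N B F := cnt_srt (cnt_le N B F).
  rewrite !cs cU cI; have := Aor F; rewrite -/(cnt _ _ _) => <-.
  by rewrite addnACA -!addnA.
have s1 := sort_le N (fun l => C l.+1) U; have s2 := sort_le N I D.
have t1 := sum_trade (srt N (fun l => C l.+1)) sU; have t2 := sum_trade2 (srt N D) sI.
have q1 : \sum_(l < N) sX (C' l.+1) (A' l.+1 :|: A' l)
    = \sum_(l < N) sX (srt N (fun l => C l.+1) l) (A' l.+1 :|: A' l).
  by apply: eq_bigr => i _; rewrite C'S.
have q2 : \sum_(l < N) sX (A' l.+1 :&: A' l) (D' l)
    = \sum_(l < N) sX (A' l.+1 :&: A' l) (srt N D l).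
  by apply: eq_bigr => i _; rewrite D'S.
rewrite q1 q2 {q1 q2}.
rewrite -!addnA leq_add2l (A'E 0 isT) (A'E N (leqnn _)).
have K0 (a0 aN x1 x2 x3 x4 x5 x6 u i t j z z0 zN p q : nat) :
  x5 <= x1 -> x6 <= x3 -> x1 + u <= x2 + t -> x3 + i <= x4 + j ->
  t + a0 + (j + aN) <= z.*2 -> u = p -> i = q -> z = z0 + q -> z = p + zN ->
  a0 + (aN + (x5 + x6)) <= z0 + (zN + (x2 + x4)).
  by clear; lia.
exact: (K0 _ _ _ _ _ _ _ _ _ _ _ _ _ _ _ _ _ s1 s2 t1 t2 dbl e1 e2 e3 e4).
Qed.

(** With [C] empty only the meets contribute, and sorted meets lie in the meets of the sorted
    sequence. *)
Lemma tot_sort_flat N K C A D : N.+1 < K -> (forall l, C l = set0) ->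
  (forall l, N < l -> A l = set0) -> D N = set0 ->
  tot K C A D <= tot K (srt_below N.+1 C) (srt_below N.+1 A) (srt_below N.+1 D).
Proof.
move=> NK C0 Abig DN; rewrite /tot [X in X + _]big1 ?add0n => [|l _]; last by rewrite C0 rcyc_set0.
apply: leq_trans _ (leq_addl _ _).
rewrite -(subnKC (ltnW (ltnW NK))) !big_split_ord /=.
rewrite [X in _ + X]big1 ?addn0 => [|i _]; last by rewrite Abig ?set0I ?rcyc_set0 //; clear; lia.
apply: leq_trans _ (leq_addr _ _).
apply: leq_trans (sort_le N (fun l => A l.+1 :&: A l) D) _; apply: leq_sum => i _.
by apply: rcyc_mono; [apply: srt_meet_sub | rewrite srt_below_last].
Qed.

End Sorting.

(** * Koszul cycles of monomial spaces and compression *)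

Section Monomials.
Variable n : nat.
Local Open Scope nat_scope.
Local Notation mono := 'X_{1..n}.
Implicit Types (x y : 'I_n) (r s : seq 'I_n) (m R M : mono) (W : mono -> bool) (F : {set 'I_n}).

Definition mon s d m := (mdeg m == d) && [forall i, (i \notin s) ==> (m i == 0)].

Lemma monP s d m : reflect (mdeg m = d /\ forall i, i \notin s -> m i = 0) (mon s d m).
Proof.
apply: (iffP andP) => -[/eqP Hd H]; split=> //.
  by move=> i Hi; apply/eqP; apply: (implyP (forallP H i)).
by apply/forallP => i; apply/implyP => Hi; rewrite H.
Qed.

Fixpoint mons s d : seq mono :=
  if s is x :: s' then [seq (m + U_(x) *+ t)%MM | t <- iota 0 d.+1, m <- mons s' (d - t)]
  else if d is 0 then [:: 0%MM] else [::].

Lemma addUE m x t i : (m + U_(x) *+ t)%MM i = m i + (x == i) * t.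
Proof. by rewrite mnmDE mulmnE mnm1E. Qed.

Lemma mdegDU m x t : mdeg (m + U_(x) *+ t)%MM = mdeg m + t.
Proof. by rewrite mdegD mdegMn mdeg1 mul1n. Qed.

Lemma mem_mons s d m : uniq s -> (m \in mons s d) = mon s d m.
Proof.
elim: s d m => [|x s IH] d m => [_|/andP[xs us]].
  apply/idP/monP => [|[<- H]].
    by case: d => //; rewrite inE => /eqP ->; rewrite mdeg0; split=> // i _; rewrite mnm0E.
  have -> : m = 0%MM by apply/mnmP => i; rewrite H // mnm0E.
  by rewrite mdeg0 inE.
apply/allpairsPdep/monP => [[t [m' []]]|[<- H]].
  rewrite mem_iota IH // => /andP[_ td] /monP[dm' H] ->.
  rewrite mdegDU dm' subnK //; split=> // i; rewrite inE negb_or => /andP[ix ins].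
  by rewrite addUE H // eq_sym (negbTE ix).
have mE : (m - U_(x) *+ m x + U_(x) *+ m x)%MM = m.
  apply/mnmP => i; rewrite addUE mnmBE mulmnE mnm1E.
  by case: eqP => [->|_]; rewrite ?mul1n ?mul0n ?subnn ?subn0 ?addn0.
have dE : mdeg m = mdeg (m - U_(x) *+ m x)%MM + m x by rewrite -{1}mE mdegDU.
exists (m x), (m - U_(x) *+ m x)%MM; split=> //.
  by rewrite mem_iota add0n ltnS dE leq_addl.
rewrite IH //; apply/monP; split; first by rewrite dE addnK.
move=> i ins; rewrite mnmBE mulmnE mnm1E; case: eqP => [<-|/eqP xi].
  by rewrite mul1n subnn.
by rewrite H // inE negb_or eq_sym xi.
Qed.

Lemma uniq_mons s d : uniq s -> uniq (mons s d).
Proof.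
elim: s d => [|x s IH] d; first by case: d.
move=> /andP[xs us]; apply: allpairs_uniq_dep => [||[t1 m1] [t2 m2]].
- exact: iota_uniq.
- by move=> t _; apply: IH.
move=> /allpairsPdep[t [m [_ + [-> ->]]]] /allpairsPdep[t' [m' [_ + [-> ->]]]] /=.
rewrite !mem_mons // => /monP[_ H] /monP[_ H'] e.
have et : t = t'.
  by have := congr1 (fun m : mono => m x) e; rewrite !addUE eqxx !mul1n H // H'.
by move: e; rewrite et => /addIm ->.
Qed.

Lemma mons_perm s s' d : uniq s -> perm_eq s s' -> perm_eq (mons s d) (mons s' d).
Proof.
move=> us ss'; have us' : uniq s' by rewrite -(perm_uniq ss').
apply: uniq_perm; rewrite ?uniq_mons // => m; rewrite !mem_mons //.
rewrite /mon; congr (_ && _); apply: eq_forallb => i; by rewrite (perm_mem ss').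
Qed.

Lemma sum_mons_cons x s d (f : mono -> nat) :
  \sum_(m <- mons (x :: s) d) f m =
  \sum_(t < d.+1) \sum_(m <- mons s (d - t)) f (m + U_(x) *+ t)%MM.
Proof.
rewrite -(big_mkord xpredT (fun t => \sum_(m <- mons s (d - t)) f (m + U_(x) *+ t)%MM)).
by rewrite /index_iota subn0; apply: big_allpairs_dep.
Qed.

Lemma sum_triangle J (h : nat -> nat -> nat) :
  \sum_(t < J.+1) \sum_(u < (J - t).+1) h t u = \sum_(mu < J.+1) \sum_(l < mu.+1) h l (mu - l).
Proof.
elim: J => [|J IH]; first by rewrite !big_ord1.
rewrite big_ord_recr [RHS]big_ord_recr /= -IH subnn big_ord1 [X in _ = _ + X]big_ord_recr /= subnn.
rewrite addnA; congr (_ + _); rewrite -big_split; apply: eq_bigr => t _ /=.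
by rewrite big_ord_recr /= subSn // -ltnS.
Qed.

(** Groups the monomials into lines: [R] is free of [x] and [y], and [mu] is the sum of their two
    exponents. *)
Lemma sum_mons_cons2 x y s j (f : mono -> nat) :
  \sum_(m <- mons (x :: y :: s) j) f m = \sum_(mu < j.+1) \sum_(R <- mons s (j - mu))
    \sum_(l < mu.+1) f (R + U_(x) *+ l + U_(y) *+ (mu - l))%MM.
Proof.
rewrite sum_mons_cons.
under eq_bigr do rewrite sum_mons_cons.
rewrite (sum_triangle j (fun t u => \sum_(R <- mons s (j - t - u)) f (R + U_(y) *+ u + U_(x) *+ t)%MM)).
apply: eq_bigr => mu _; rewrite exchange_big; apply: eq_bigr => l _ /=.
have lmu : l <= mu by rewrite -ltnS.
rewrite -subnDA (subnKC lmu); apply: eq_bigr => R _.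
by rewrite -addmA [(U_(y) *+ _ + _)%MM]addmC addmA.
Qed.

Definition size_in s d W := \sum_(m <- mons s d) (W m : nat).

Definition mset F : mono := [multinom (i \in F : nat) | i < n].

Lemma msetE F i : mset F i = (i \in F).
Proof. by rewrite mnmE. Qed.

Lemma mdeg_mset F : mdeg (mset F) = #|F|.
Proof.
rewrite mdegE -sum1_card [RHS]big_mkcond; apply: eq_bigr => i _.
by rewrite msetE; case: (i \in F).
Qed.

Definition divides F M := [forall i in F, 0 < M i].

Lemma dividesP F M : reflect (forall i, i \in F -> 0 < M i) (divides F M).
Proof. exact: forall_inP. Qed.

(** In multidegree [M] the coefficient at [F] is a multiple of one monomial, [M] divided by the
    product of [F]. So Koszul chains with coefficients in [W] are, in this multidegree, simplicial
    chains on this family. *)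
Definition facets p W M : {set {set 'I_n}} :=
  [set F : {set 'I_n} | [&& #|F| == p, divides F M & W (M - mset F)%MM]].

Section Cycles.
Variable k : fieldType.

(* The dimension of the space of Koszul p-cycles of total degree j in the
   variables s, with coefficients in the span of the monomials of W. *)
Definition cycles s p j W :=
  \sum_(M <- mons s j) @rcyc k n [set i in s] (facets p W M) set0.

Lemma cycles_perm s s' p j W : uniq s -> perm_eq s s' -> cycles s p j W = cycles s' p j W.
Proof.
move=> us ss'; rewrite /cycles (perm_big _ (mons_perm j us ss')) /=.
have -> // : [set i in s] = [set i in s'].
by apply/setP => i; rewrite !inE (perm_mem ss').
Qed.

Lemma divides_card F M : divides F M -> #|F| <= mdeg M.
Proof.
move=> /dividesP FM; rewrite -mdeg_mset !mdegE; apply: leq_sum => i _.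
by rewrite msetE; case: (boolP (i \in F)) => [/FM|].
Qed.

Lemma mdeg_sub_mset F M : divides F M -> mdeg (M - mset F)%MM = mdeg M - #|F|.
Proof.
move=> /dividesP FM; rewrite -mdeg_mset -{2}(_ : (M - mset F + mset F)%MM = M) ?mdegD ?addnK //.
apply/mnmP => i; rewrite mnmDE mnmBE msetE; case: (boolP (i \in F)) => [/FM|_].
  exact: subnK.
by rewrite subn0 addn0.
Qed.

Lemma mon_sub_mset s j p F M : mon s j M -> divides F M -> #|F| = p -> mon s (j - p) (M - mset F)%MM.
Proof.
move=> /monP[dM sM] FM cF; apply/monP; split; first by rewrite mdeg_sub_mset // cF dM.
by move=> i /sM Mi; rewrite mnmBE Mi.
Qed.

Lemma eq_facets s d p M W W' : (forall m, mon s d m -> W m = W' m) -> mon s (d + p) M ->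
  facets p W M = facets p W' M.
Proof.
move=> WW' HM; apply/setP => F; rewrite !inE; case: eqP => //= cF.
case: (boolP (divides F M)) => //= FM; apply: WW'.
by have := mon_sub_mset HM FM cF; rewrite addnK.
Qed.

Lemma eq_cycles s d p W W' : uniq s -> (forall m, mon s d m -> W m = W' m) ->
  cycles s p (d + p) W = cycles s p (d + p) W'.
Proof.
move=> us WW'; rewrite /cycles !big_seq; apply: eq_bigr => M; rewrite mem_mons // => HM.
by rewrite (eq_facets WW' HM).
Qed.

End Cycles.

Lemma eq_size_in s d W W' : uniq s -> (forall m, mon s d m -> W m = W' m) ->
  size_in s d W = size_in s d W'.
Proof.
move=> us WW'; rewrite /size_in !big_seq; apply: eq_bigr => m; rewrite mem_mons // => Hm.
by rewrite WW'.
Qed.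

Lemma size_in_perm s s' d W : uniq s -> perm_eq s s' -> size_in s d W = size_in s' d W.
Proof. by move=> us ss'; rewrite /size_in (perm_big _ (mons_perm d us ss')). Qed.

Lemma size_in_mono s d W W' : uniq s -> (forall m, mon s d m -> W m -> W' m) ->
  size_in s d W <= size_in s d W'.
Proof.
move=> us WW'; rewrite /size_in !big_seq; apply: leq_sum => m; rewrite mem_mons // => Hm.
by have := WW' m Hm; case: (W m) => // ->.
Qed.

Lemma size_in_sub_eq s d W W' : uniq s -> (forall m, mon s d m -> W m -> W' m) ->
  size_in s d W' <= size_in s d W -> forall m, mon s d m -> W' m -> W m.
Proof.
move=> us WW' le m Hm W'm; apply: contraLR le => nWm; rewrite -ltnNge.
have mi : m \in mons s d by rewrite mem_mons.
rewrite /size_in [X in _ < X](bigD1_seq m) ?uniq_mons // [X in X < _](bigD1_seq m) ?uniq_mons //.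
rewrite /= (negbTE nWm) W'm add0n add1n ltnS.
rewrite big_seq_cond [leqRHS]big_seq_cond; apply: leq_sum => m'; rewrite mem_mons // => /andP[Hm' _].
by have := WW' m' Hm'; case: (W m') => // ->.
Qed.

Definition base x y m : mono := [multinom (if (i == x) || (i == y) then 0 else m i) | i < n].

Definition onto x y R l nu : mono := (R + U_(x) *+ l + U_(y) *+ nu)%MM.

(** Truncated subtraction would place all [l > mu] at exponent 0 of [y]; the guard excludes them. *)
Definition line x y R mu W l := (l <= mu) && W (onto x y R l (mu - l)).

Arguments line : simpl never.

(* On each line {R x^l y^(mu - l)}, keep the part with l >= e and move the rest
   to the smallest exponents of x. *)
Definition compress y x e W : mono -> bool := fun m =>
  if e <= m x then W m
  else m x < \sum_(l < e) (line x y (base x y m) (m x + m y) W l : nat).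

Arguments compress : simpl never.

Lemma ontoE x y R l nu i : onto x y R l nu i = R i + (x == i) * l + (y == i) * nu.
Proof. by rewrite /onto !addUE. Qed.

Lemma onto_base x y m : x != y -> onto x y (base x y m) (m x) (m y) = m.
Proof.
move=> xy; apply/mnmP => i; rewrite ontoE mnmE ![_ == i]eq_sym.
case: eqP => [->|_]; first by rewrite (negbTE xy) mul1n mul0n addn0.
by case: eqP => [->|_]; rewrite ?mul1n ?mul0n ?addn0.
Qed.

Lemma base_onto x y R l nu : R x = 0 -> R y = 0 -> base x y (onto x y R l nu) = R.
Proof.
move=> Rx Ry; apply/mnmP => i; rewrite mnmE ontoE.
case: eqP => [->|/eqP ix]; first by rewrite Rx.
case: eqP => [->|/eqP iy]; first by rewrite Ry.
by rewrite ![_ == i]eq_sym (negbTE ix) (negbTE iy) !mul0n !addn0.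
Qed.

Lemma line_compress x y e R mu W l : x != y -> R x = 0 -> R y = 0 ->
  line x y R mu (compress y x e W) l =
  if l < e then l < \sum_(i < e) (line x y R mu W i : nat) else line x y R mu W l.
Proof.
move=> xy Rx Ry; rewrite {1 3}/line /compress base_onto // !ontoE Rx Ry !eqxx.
rewrite (negbTE xy) eq_sym (negbTE xy) !mul1n !mul0n !addn0 add0n [e <= l]leqNgt.
case: (ltnP l e) => [le|//]; rewrite add0n.
case: (leqP l mu) => [lmu|lmu] /=; first by rewrite (subnKC lmu).
apply/esym/negbTE; rewrite -leqNgt.
apply: leq_trans (lmu); rewrite -[leqRHS](cnt_lt (leq_trans lmu (ltnW le))).
by apply: leq_sum => i _; rewrite /line ltnS; case: (i <= mu); case: (W _).
Qed.

Lemma size_in_compress r x y e W d : uniq [:: x, y & r] ->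
  size_in [:: x, y & r] d (compress y x e W) = size_in [:: x, y & r] d W.
Proof.
move=> /=; rewrite inE negb_or => /and3P[/andP[xy xr] yr ur].
rewrite /size_in !sum_mons_cons2; apply: eq_bigr => mu _; rewrite !big_seq; apply: eq_bigr => R.
rewrite mem_mons // => /monP[_ HR]; have Rx := HR x xr; have Ry := HR y yr.
have cut (V : mono -> bool) K : mu < K -> \sum_(l < mu.+1) (V (onto x y R l (mu - l)) : nat) = \sum_(l < K) (line x y R mu V l : nat).
  move=> muK; rewrite -(subnKC muK) big_split_ord /= [X in _ + X]big1 ?addn0 => [|i _].
    by apply: eq_bigr => l _; rewrite /line -ltnS ltn_ord.
  by rewrite /line leqNgt ltnS leq_addr.
have K : mu < e + mu.+1 by rewrite addnS ltnS leq_addl.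
rewrite (cut (compress y x e W) _ K) (cut W _ K) !big_split_ord /=; congr (_ + _).
  rewrite -[RHS](@cnt_lt (\sum_(i < e) (line x y R mu W i : nat)) e); last first.
    by rewrite -[leqRHS]card_ord -sum1_card; apply: leq_sum => i _; exact: leq_b1.
  by apply: eq_bigr => i _; rewrite line_compress // ltn_ord.
by apply: eq_bigr => i _; rewrite line_compress // ltnNge leq_addr.
Qed.

Section LineCycles.
Variables (k : fieldType) (x y : 'I_n) (r : seq 'I_n) (p j mu : nat) (R : mono).
Hypotheses (us : uniq [:: x, y & r]) (muj : mu <= j) (HR : mon r (j - mu) R).
Local Notation X := [set i in r].

Definition line_sel c F := [&& x \notin F, y \notin F, #|F| + c == p & divides F R].

(** The number [c] counts how many of [x] and [y] are added to [F]; dividing by them shortens the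
    line by [c]. *)
Definition line_fam W c l : {set {set 'I_n}} :=
  [set F | [&& line_sel c F, c <= mu & line x y (R - mset F)%MM (mu - c) W l]].

Let xy : x != y. Proof. by move: us; rewrite /= inE negb_or => /and3P[/andP[]]. Qed.
Let Rx : R x = 0.
Proof. by have /monP[_] := HR; apply; move: us; rewrite /= inE negb_or => /and3P[/andP[]]. Qed.
Let Ry : R y = 0.
Proof. by have /monP[_] := HR; apply; move: us; rewrite /= inE negb_or => /and3P[/andP[]]. Qed.

Lemma mem_line_fam W c l F : (F \in line_fam W c l) =
  [&& line_sel c F, l + c <= mu & W (onto x y (R - mset F)%MM l (mu - c - l))].
Proof.
rewrite inE /line; congr (_ && _).
case: (leqP c mu) => /= cmu; last by rewrite leqNgt (leq_trans cmu) // leq_addl.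
by rewrite leq_subRL // addnC.
Qed.

(** Compression acts separately on the line through each [R - mset F], and sorting acts separately
    on each [F]. On one line both move the chosen points below [e] to the front. *)
Lemma line_fam_compress W c l e : line_fam (compress y x e W) c l = srt_below e (line_fam W c) l.
Proof.
have Bx F : (R - mset F)%MM x = 0 by rewrite mnmBE Rx.
have By F : (R - mset F)%MM y = 0 by rewrite mnmBE Ry.
apply/setP => F; rewrite inE line_compress // /srt_below.
case: ifP => le; last by rewrite inE.
rewrite inE /cnt; under [in RHS]eq_bigr do rewrite inE.
case: (line_sel c F) => /=; last by rewrite big1.
by case: (c <= mu) => /=; last by rewrite big1.
Qed.

Lemma sub_mset_onto F l nu : divides F R -> x \notin F -> y \notin F ->
  (onto x y R l nu - mset F)%MM = onto x y (R - mset F)%MM l nu.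
Proof.
move=> /dividesP FR xF yF; apply/mnmP => i; rewrite mnmBE !ontoE mnmBE msetE.
case: (boolP (i \in F)) => iF; last by rewrite !subn0.
have xi : x == i = false by apply: contraNF xF => /eqP ->.
have yi : y == i = false by apply: contraNF yF => /eqP ->.
by rewrite xi yi !mul0n !addn0.
Qed.

Lemma divides_onto F l nu : x \notin F -> y \notin F -> divides F (onto x y R l nu) = divides F R.
Proof.
move=> xF yF; apply/dividesP/dividesP => H i iF; have := H i iF; rewrite ontoE.
  have -> : x == i = false by apply: contraNF xF => /eqP ->.
  have -> : y == i = false by apply: contraNF yF => /eqP ->.
  by rewrite !mul0n !addn0.
by move=> Ri; rewrite -addnA ltn_addr.
Qed.

Lemma dividesU1 z F M : divides (z |: F) M = (0 < M z) && divides F M.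
Proof.
apply/dividesP/andP => [H|[Mz /dividesP H] i]; last by case/setU1P => [->|/H].
by split; [apply: H; rewrite setU11 | apply/dividesP => i iF; apply: H; rewrite setU1r].
Qed.

Lemma sub_mset_U1 z F M : z \notin F -> (M - mset (z |: F))%MM = (M - U_(z) - mset F)%MM.
Proof.
move=> zF; apply/mnmP => i; rewrite !mnmBE !msetE mnm1E in_setU1 [i == z]eq_sym.
by case: (eqVneq z i) => [<-|_] /=; rewrite ?(negbTE zF) ?subn0.
Qed.

Lemma onto_sub_x l nu : 0 < l -> (onto x y R l nu - U_(x))%MM = onto x y R l.-1 nu.
Proof.
move=> l0; apply/mnmP => i; rewrite mnmBE !ontoE mnm1E.
case: eqP => [<-|_]; last by rewrite subn0 !mul0n.
by rewrite Rx eq_sym (negbTE xy) !mul1n mul0n !addn0 subn1.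
Qed.

Lemma onto_sub_y l nu : (onto x y R l nu - U_(y))%MM = onto x y R l nu.-1.
Proof.
apply/mnmP => i; rewrite mnmBE !ontoE mnm1E.
case: (eqVneq y i) => [<-|_]; last by rewrite subn0 !mul0n.
by rewrite Ry (negbTE xy) !mul1n mul0n !add0n subn1.
Qed.

Lemma onto_x l nu : onto x y R l nu x = l.
Proof. by rewrite ontoE Rx eqxx eq_sym (negbTE xy) mul1n mul0n addn0. Qed.

Lemma onto_y l nu : onto x y R l nu y = nu.
Proof. by rewrite ontoE Ry eqxx (negbTE xy) mul1n mul0n. Qed.

Section Slices.
Variables (W : mono -> bool) (l : nat).
Hypothesis lmu : l <= mu.
Local Notation M := (onto x y R l (mu - l)).

Lemma del_del : del y (del x (facets p W M)) = line_fam W 0 l.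
Proof.
apply/setP => F; rewrite mem_line_fam !inE /line_sel !addn0 subn0 lmu.
case: (boolP (x \in F)) => xF; rewrite ?andbF //=.
case: (boolP (y \in F)) => yF; rewrite ?andbF //= !andbT.
rewrite divides_onto // -andbA; case: (#|F| == p) => //=.
by case: (boolP (divides F R)) => //= FR; rewrite sub_mset_onto.
Qed.

Lemma link_del : link y (del x (facets p W M)) = line_fam W 1 l.
Proof.
apply/setP => F; rewrite mem_line_fam !inE /line_sel negb_or xy /=.
case: (boolP (x \in F)) => xF; rewrite ?andbF //=.
case: (boolP (y \in F)) => yF; rewrite ?andbF //= !andbT.
rewrite cardsU1 yF addnC dividesU1 onto_y subn_gt0 divides_onto // sub_mset_U1 //.
rewrite onto_sub_y (_ : (mu - l).-1 = mu - 1 - l) ?addn1; last by rewrite -subn1 subnAC.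
case: (boolP (divides F R)) => FR; rewrite ?andbF //= sub_mset_onto //.
by case: (_ == p); case: (l < mu).
Qed.

Lemma del_link : del y (link x (facets p W M)) = prev (line_fam W 1) l.
Proof.
apply/setP => F; case: (posnP l) => [l0|l0].
  rewrite l0 /= !inE; case: (boolP (x \in F)) => xF; rewrite ?andbF //=.
  by rewrite dividesU1 onto_x ltnn /= andbF.
rewrite -[in RHS](prednK l0) /= mem_line_fam !inE /line_sel.
case: (boolP (x \in F)) => xF; rewrite ?andbF //=.
case: (boolP (y \in F)) => yF; rewrite ?andbF //= !andbT.
rewrite cardsU1 xF addnC dividesU1 onto_x l0 divides_onto // sub_mset_U1 // onto_sub_x //.
rewrite addn1 [l.-1 + 1]addn1 prednK // lmu /= (_ : mu - 1 - l.-1 = mu - l); last first.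
  by rewrite -subnDA add1n prednK.
by case: (boolP (divides F R)) => FR; rewrite ?andbF //= sub_mset_onto // andbT.
Qed.

Lemma link_link : link y (link x (facets p W M)) = prev (line_fam W 2) l.
Proof.
apply/setP => F; case: (posnP l) => [l0|l0].
  rewrite l0 /= !inE; case: (boolP (x \in F)) => xF; rewrite ?orbT ?andbF //=.
  by rewrite dividesU1 onto_x ltnn /= !andbF.
rewrite -[in RHS](prednK l0) /= mem_line_fam !inE /line_sel negb_or xy /=.
case: (boolP (x \in F)) => xF; rewrite ?andbF //=.
case: (boolP (y \in F)) => yF; rewrite ?andbF //= .
have xyF : x \notin y |: F by rewrite in_setU1 negb_or xy.
rewrite cardsU1 xyF cardsU1 yF addnC [1 + #|F|]addnC -addnA dividesU1 onto_x l0 dividesU1 onto_y.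
rewrite divides_onto // sub_mset_U1 // onto_sub_x // sub_mset_U1 //.
rewrite onto_sub_y subn_gt0 (_ : (l.-1 + 2 <= mu) = (l < mu)); last by rewrite addn2 prednK.
rewrite (_ : (mu - l).-1 = mu - 2 - l.-1); last by rewrite -subn1 -!subnDA addn1 add2n prednK.
case: (boolP (divides F R)) => FR; rewrite ?andbF //= sub_mset_onto //.
by case: (_ == p); case: (l < mu).
Qed.

Let yX : y \notin X. Proof. by move: us; rewrite /= !inE => /and3P[]. Qed.

Let xX : x \notin y |: X.
Proof. by move: us; rewrite /= !inE => /and3P[]. Qed.

Lemma rcyc_facets : rcyc k (x |: (y |: X)) (facets p W M) set0 =
  rcyc k (y |: X) (del x (facets p W M)) (link x (facets p W M)).
Proof. exact: rcyc_split. Qed.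

Lemma facets_le : rcyc k (x |: (y |: X)) (facets p W M) set0 <=
  rcyc k X (line_fam W 0 l) (line_fam W 1 l :|: prev (line_fam W 1) l)
  + rcyc k X (line_fam W 1 l :&: prev (line_fam W 1) l) (prev (line_fam W 2) l).
Proof.
rewrite rcyc_facets; apply: leq_trans (rcyc_cube_le _ _ _ yX) _.
by rewrite del_del link_del del_link link_link.
Qed.

Lemma facets_eq : (forall i, line_fam W 1 i.+1 \subset line_fam W 1 i \/
    line_fam W 1 i \subset line_fam W 1 i.+1) ->
  rcyc k (x |: (y |: X)) (facets p W M) set0 =
  rcyc k X (line_fam W 0 l) (line_fam W 1 l :|: prev (line_fam W 1) l)
  + rcyc k X (line_fam W 1 l :&: prev (line_fam W 1) l) (prev (line_fam W 2) l).
Proof.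
move=> nest; rewrite rcyc_facets rcyc_cube ?del_del ?link_del ?del_link ?link_link //.
by case: l => [|i] /=; rewrite ?sub0set ?orbT //; case: (nest i) => ->; rewrite ?orbT.
Qed.

End Slices.
Lemma line_fam_big W c l : mu < l + c -> line_fam W c l = set0.
Proof. by move=> big; apply/setP => F; rewrite mem_line_fam inE leqNgt big andbF. Qed.

Lemma tot_line W K : mu < K -> tot k X K (line_fam W 0) (line_fam W 1) (line_fam W 2) =
  \sum_(l < mu.+1) (rcyc k X (line_fam W 0 l) (line_fam W 1 l :|: prev (line_fam W 1) l)
  + rcyc k X (line_fam W 1 l :&: prev (line_fam W 1) l) (prev (line_fam W 2) l)).
Proof.
move=> muK; rewrite /tot -(subnKC muK) !big_split_ord /= big_split /=; congr (_ + _).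
  rewrite [X in _ + X]big1 ?addn0 // => i _.
  by rewrite line_fam_big ?rcyc_set0 // addn0 leq_addr.
rewrite [X in _ + X]big1 ?addn0 => [|i _]; last first.
  by rewrite [line_fam W 1 _.+1]line_fam_big ?set0I ?rcyc_set0 //; clear; lia.
rewrite [RHS]big_ord_recl big_ord_recr /= setI0 rcyc_set0 add0n.
by rewrite [line_fam W 1 mu.+1]line_fam_big ?set0I ?rcyc_set0 ?addn0 // addn1.
Qed.

Section Compress.
Variables (d e : nat) (W : mono -> bool).
Hypotheses (dp : d + p = j) (e0 : 0 < e).
Hypothesis Wx : forall m, mon [:: x, y & r] d m -> e <= m x -> W m.
Hypothesis Wy : forall m, mon [:: x, y & r] d m -> e <= m y -> W m.

Lemma line_full c l F : line_sel c F -> l + c <= mu -> (e <= l) || (e <= mu - c - l) ->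
  F \in line_fam W c l.
Proof.
move=> sel lc elc; rewrite mem_line_fam sel lc /=.
have /and4P[xF yF /eqP cF FR] := sel; have /monP[dR sR] := HR.
have Fl := divides_card FR; rewrite dR in Fl.
have Hm : mon [:: x, y & r] d (onto x y (R - mset F)%MM l (mu - c - l)).
  apply/monP; split; last first.
    move=> i; rewrite !inE !negb_or ontoE => /and3P[ix iy ir].
    by rewrite mnmBE sR // ![_ == i]eq_sym (negbTE ix) (negbTE iy).
  rewrite !mdegDU mdeg_sub_mset // dR; move: dp muj cF lc Fl; clear; lia.
case/orP: elc => el; [apply: Wx => // | apply: Wy => //]; rewrite ontoE mnmBE ?Rx ?Ry eqxx.
  by rewrite mul1n; apply: leq_trans el (leq_trans (leq_addl _ l) (leq_addr _ _)).
by rewrite mul1n (leq_trans el) // leq_addl.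
Qed.

Lemma line_fam_sel c l F : F \in line_fam W c l -> line_sel c F.
Proof. by rewrite mem_line_fam => /and3P[]. Qed.

Lemma line_sel_full q c F : p = q + c -> line_sel c F = (F \in full [set i | 0 < R i] q).
Proof.
move=> pq; rewrite /line_sel inE pq eqn_add2r.
have -> : F \subset [set i | 0 < R i] = divides F R.
  by apply/subsetP/dividesP => H i /H; rewrite inE.
case: (boolP (divides F R)) => [/dividesP FR|]; rewrite ?andbF //= andbT.
have -> : x \notin F by apply/negP => /FR; rewrite Rx.
by have -> : y \notin F by apply/negP => /FR; rewrite Ry.
Qed.

Lemma line_sel_lt c F : p < c -> line_sel c F = false.
Proof.
by move=> pc; rewrite /line_sel; case: eqP; rewrite ?andbF // => H; move: pc; rewrite -H ltnNge leq_addl.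
Qed.

Lemma tot_line_compress K : mu < K -> e < K ->
  tot k X K (line_fam W 0) (line_fam W 1) (line_fam W 2) <=
  tot k X K (line_fam (compress y x e W) 0) (line_fam (compress y x e W) 1)
    (line_fam (compress y x e W) 2).
Proof.
move=> muK eK.
have cE c : line_fam (compress y x e W) c = srt_below e (line_fam W c).
  by apply: functional_extensionality => l; rewrite line_fam_compress.
rewrite !cE; case: e e0 eK line_full => // N _ NK lf.
(* For [mu] below e the family [line_fam W 1 N] is empty. For [mu] above e the entries at 0 and at e
   are full, since the exponent of [y], respectively [x], reaches e. Both situations give the
   containments of [tot_sort_below]; at [mu] equal to e they can fail. *)
case: (ltngtP mu N.+1) => [lt|gt|muE].
- have A0 : line_fam W 1 N = set0 by rewrite line_fam_big // addn1.
  by apply: tot_sort_below; rewrite ?A0 ?sub0set // ltnW.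
- apply: tot_sort_below; rewrite ?(ltnW NK) //; apply/subsetP => F /line_fam_sel sel.
    by apply: lf => //; move: gt; clear; lia.
  by apply: lf; rewrite // ?leqnn // addn1.
have D0 : line_fam W 2 N = set0 by rewrite line_fam_big // muE addn2.
have A0 l : N < l -> line_fam W 1 l = set0 by move=> Nl; rewrite line_fam_big // muE addn1 ltnS.
have C0 : line_fam W 0 0 = full [set i | 0 < R i] p.
  apply/setP => F; rewrite -(@line_sel_full p 0) ?addn0 //.
  by apply/idP/idP => [/line_fam_sel //|sel]; apply: lf; rewrite // !subn0 muE leqnn orbT.
have CN : line_fam W 0 N.+1 = full [set i | 0 < R i] p.
  apply/setP => F; rewrite -(@line_sel_full p 0) ?addn0 //.
  by apply/idP/idP => [/line_fam_sel //|sel]; apply: lf; rewrite // ?leqnn // addn0 muE.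
have CP l : line_fam W 0 l \subset full [set i | 0 < R i] p.
  by apply/subsetP => F /line_fam_sel; rewrite (@line_sel_full p 0) ?addn0.
have Cbig l : N.+1 < l -> line_fam W 0 l = set0 by move=> Nl; rewrite line_fam_big // muE addn0.
have [p0|p0] := posnP p.
  apply: (@tot_sort_cyclic _ _ _ _ _ (full [set i | 0 < R i] p) set0) => //.
    move=> G; rewrite subset0 => /eqP ->.
    by rewrite rcyc_set0 addn0.
  move=> l; apply/subsetP => F /line_fam_sel; by rewrite line_sel_lt ?p0.
have pE : p = p.-1 + 1 by rewrite addn1 prednK.
have [Y0|Y0] := eqVneq [set i | 0 < R i] set0.
  apply: tot_sort_flat => // l; apply/setP => F; rewrite [RHS]inE; apply/negP => /(subsetP (CP l)).
  by rewrite Y0 inE subset0 => /andP[/eqP ->]; rewrite cards0 eq_sym gtn_eqF.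
apply: (@tot_sort_cyclic _ _ _ _ _ (full [set i | 0 < R i] p) (full [set i | 0 < R i] p.-1)) => //.
  move=> G GP; rewrite -(prednK p0) in GP *; apply: rcyc_exact => //.
  apply/subsetP => i; rewrite !inE; apply: contraLR => ir.
  by have /monP[_ ->] := HR.
by move=> l; apply/subsetP => F /line_fam_sel; rewrite (line_sel_full _ pE).
Qed.

(** Sorted entries decrease, and from e on an entry is full as long as the line reaches it. Nesting
    makes [facets_le] an equality after compression, so an upper bound for [W] is compared with an
    exact value. *)
Lemma line_compress_nest i : line_fam (compress y x e W) 1 i.+1 \subset line_fam (compress y x e W) 1 i \/
    line_fam (compress y x e W) 1 i \subset line_fam (compress y x e W) 1 i.+1.
Proof.
rewrite !line_fam_compress; case: e e0 line_full => // N _ lf.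
case: (ltngtP i N) => iN.
- by left; apply: srt_below_dec.
- rewrite /srt_below ltnNge (leqW iN) ltnNge iN /=; left; apply/subsetP => F; rewrite mem_line_fam => /and3P[sel le _].
  by apply: lf; rewrite ?iN // (leq_trans _ le) // ltnW.
rewrite iN; case: (leqP mu N.+1) => [muN|muN].
  by left; rewrite {1}/srt_below ltnn line_fam_big ?sub0set // addn1 ltnS.
right; apply: subset_trans (_ : line_fam W 1 N \subset _).
  by rewrite /srt_below ltnSn srt_last.
rewrite /srt_below ltnn; apply/subsetP => F /line_fam_sel sel.
by apply: lf; rewrite ?leqnn // addn1.
Qed.

Lemma line_cycles_le : \sum_(l < mu.+1) rcyc k (x |: (y |: X)) (facets p W (onto x y R l (mu - l))) set0
  <= \sum_(l < mu.+1) rcyc k (x |: (y |: X)) (facets p (compress y x e W) (onto x y R l (mu - l))) set0.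
Proof.
apply: (@leq_trans (tot k X (mu + e).+1 (line_fam W 0) (line_fam W 1) (line_fam W 2))).
  rewrite tot_line ?ltnS ?leq_addr //; apply: leq_sum => l _; apply: facets_le.
  by rewrite -ltnS.
apply: leq_trans (tot_line_compress _ _) _; rewrite ?ltnS ?leq_addr ?leq_addl //.
rewrite tot_line ?ltnS ?leq_addr //; apply: leq_sum => l _; rewrite facets_eq //.
  by rewrite -ltnS.
exact: line_compress_nest.
Qed.

End Compress.
End LineCycles.

Theorem cycles_compress (k : fieldType) r x y p d e W : uniq [:: x, y & r] -> 0 < e ->
  (forall m, mon [:: x, y & r] d m -> e <= m x -> W m) ->
  (forall m, mon [:: x, y & r] d m -> e <= m y -> W m) ->
  cycles k [:: x, y & r] p (d + p) W <= cycles k [:: x, y & r] p (d + p) (compress y x e W).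
Proof.
move=> us e0 Wx Wy; rewrite /cycles !sum_mons_cons2; apply: leq_sum => mu _.
have -> : [set i in [:: x, y & r]] = x |: (y |: [set i in r]) by apply/setP => i; rewrite !inE.
rewrite !big_seq; apply: leq_sum => R; rewrite mem_mons; last by case/and3P: us.
move=> HR; apply: (@line_cycles_le k x y r p (d + p) mu R us _ HR d) => //.
by rewrite -ltnS.
Qed.

End Monomials.

(** * Stable monomial spaces *)

Section Stable.
Variable n : nat.
Local Open Scope nat_scope.
Local Notation mono := 'X_{1..n}.
Implicit Types (x y z : 'I_n) (s : seq 'I_n) (m R : mono) (W V : mono -> bool) (E : 'I_n -> nat).

Lemma perm_two s x y : uniq s -> x \in s -> y \in s -> x != y ->
  perm_eq s [:: x, y & rem y (rem x s)].
Proof.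
move=> us xs ys xy; apply: (perm_trans (perm_to_rem xs)); rewrite perm_cons perm_to_rem //.
by rewrite mem_rem_uniq // inE /= eq_sym xy.
Qed.

Lemma mon_perm s s' d m : perm_eq s s' -> mon s d m = mon s' d m.
Proof. by move=> ss'; rewrite /mon; congr (_ && _); apply: eq_forallb => i; rewrite (perm_mem ss'). Qed.

Lemma cycles_compress_in (k : fieldType) s x y p d e W : uniq s -> x \in s -> y \in s -> x != y ->
  0 < e -> (forall m, mon s d m -> e <= m x -> W m) -> (forall m, mon s d m -> e <= m y -> W m) ->
  cycles k s p (d + p) W <= cycles k s p (d + p) (compress y x e W).
Proof.
move=> us xs ys xy e0 Wx Wy; have ps := perm_two us xs ys xy.
rewrite !(cycles_perm k p (d + p) _ us ps); apply: cycles_compress => //.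
- by rewrite -(perm_uniq ps).
- by move=> m; rewrite -(mon_perm d m ps); apply: Wx.
- by move=> m; rewrite -(mon_perm d m ps); apply: Wy.
Qed.

Lemma size_in_compress_in s x y e W d : uniq s -> x \in s -> y \in s -> x != y ->
  size_in s d (compress y x e W) = size_in s d W.
Proof.
move=> us xs ys xy; have ps := perm_two us xs ys xy.
by rewrite !(size_in_perm d _ us ps) size_in_compress // -(perm_uniq ps).
Qed.

(** The two stretches of true values are disjoint because [h <= lo]; the term [lo] stands on the
    right to avoid a subtraction. *)
Lemma count_lt (f : nat -> bool) h lo hi e : h <= lo -> lo <= hi -> hi <= e ->
  (forall l, l < h -> f l) -> (forall l, lo <= l -> l < hi -> f l) ->
  h + hi <= \sum_(l < e) (f l : nat) + lo.
Proof.
move=> hlo lohi hie fh fhi.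
rewrite -{1}(@cnt_lt h e) ?(leq_trans hlo) ?(leq_trans lohi) // -{1}(@cnt_lt hi e) //.
rewrite -[X in _ <= _ + X](@cnt_lt lo e) ?(leq_trans lohi) // -!big_split; apply: leq_sum => l _ /=.
case: (ltnP l h) => [lh|_]; first by rewrite fh // (leq_trans lh hlo); case: (l < hi).
case: (ltnP l lo) => [lo'|lo']; first by case: (l < hi); case: (f l).
by case: (ltnP l hi) => // lhi; rewrite fhi.
Qed.

(* The hypothesis lists the points of the line through m on the y side of m. *)
Lemma compress_mem x y e W m : (e <= m x -> W m) ->
  (forall l, l <= m x -> W (onto x y (base x y m) l (m x + m y - l))) -> compress y x e W m.
Proof.
move=> He Hl; rewrite /compress; case: (leqP e (m x)) => [/He -> //|lt].
have := @count_lt (line x y (base x y m) (m x + m y) W) (m x).+1 (m x).+1 (m x).+1 e.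
rewrite leq_add2r; apply=> //.
  move=> l; rewrite ltnS => lm; by rewrite /line Hl // (leq_trans lm) // leq_addr.
by move=> l lo hi; have := leq_trans hi lo; rewrite ltnn.
Qed.

Lemma mon_onto s d x y m l nu : x \in s -> y \in s -> x != y -> mon s d m -> l + nu = m x + m y ->
  mon s d (onto x y (base x y m) l nu).
Proof.
move=> xs ys xy /monP[dm sm] lE; apply/monP; split; last first.
  move=> i iS; rewrite ontoE mnmE; have := sm i iS => mi.
  have -> : x == i = false by apply: contraNF iS => /eqP <-.
  have -> : y == i = false by apply: contraNF iS => /eqP <-.
  by rewrite mi if_same.
rewrite -dm -{2}(onto_base m xy) !mdegDU -!addnA; by rewrite lE.
Qed.

Definition contains_powers s d E W := forall x m, x \in s -> mon s d m -> E x <= m x -> W m.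

(** Strong stability relative to the powers. Variables of smaller index are the larger ones, and
    monomials with [E x <= m x] are exempt because removing one [x] may leave the power. *)
Definition stable s d E W := forall x y m, x \in s -> y \in s -> y < x -> mon s d m ->
  W m -> 0 < m x -> m x < E x -> W (m - U_(x) + U_(y))%MM.

Lemma compress_powers s d E x y W : x \in s -> y \in s -> x != y -> E y <= E x ->
  contains_powers s d E W -> contains_powers s d E (compress y x (E x) W).
Proof.
move=> xs ys xy Eyx cW z m zs Hm Ez; have [zx|zx] := eqVneq z x.
  by rewrite /compress -zx Ez; apply: (cW z).
apply: compress_mem => [_|l lm]; first exact: (cW z).
have lE : l + (m x + m y - l) = m x + m y by rewrite subnKC // (leq_trans lm) // leq_addr.
apply: (cW z) => //; first exact: mon_onto.
rewrite ontoE mnmE (negbTE zx) /= [x == z]eq_sym (negbTE zx) mul0n addn0.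
have [zy|zy] := eqVneq z y; last by rewrite mul0n addn0.
rewrite mul1n add0n; apply: (leq_trans Ez); rewrite zy leq_subRL ?leq_add2r //.
by rewrite (leq_trans lm) // leq_addr.
Qed.

(** A strictly increasing weight is smallest when the chosen positions come first, and only then.
    The equality case shows that a set whose potential does not drop is fixed. *)
Lemma sorted_sum_le (f : nat -> bool) (g : nat -> nat) N : {homo g : i j / i < j} ->
  let c := \sum_(l < N) (f l : nat) in
  \sum_(l < N) (l < c) * g l <= \sum_(l < N) f l * g l /\
  (\sum_(l < N) f l * g l <= \sum_(l < N) (l < c) * g l -> forall l, l < N -> f l = (l < c)).
Proof.
move=> gh; elim: N => [|N [IH1 IH2]] /=; first by rewrite !big_ord0.
move: IH1 IH2; rewrite !(big_ord_recr N); set c := \sum_(l < N) (f l : nat) => IH1 IH2 /=.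
have cN : c <= N by rewrite /c -[leqRHS]card_ord -sum1_card; apply: leq_sum => i _; apply: leq_b1.
case fN: (f N) => /=.
  have cE : \sum_(l < N) (l < c + 1) * g l + (N < c + 1) * g N = \sum_(l < N) (l < c) * g l + g c.
    move: cN; rewrite leq_eqVlt addn1 => /orP[/eqP ->|cN].
      rewrite ltnSn mul1n; congr (_ + _); apply: eq_bigr => i _.
      by rewrite ltn_ord (ltn_trans (ltn_ord i)).
    rewrite ltnS leqNgt cN mul0n addn0.
    rewrite (bigD1 (Ordinal cN)) //= [X in _ = X + _](bigD1 (Ordinal cN)) //= ltnSn ltnn mul1n mul0n add0n addnC.
    congr (_ + _); apply: eq_bigr => i /eqP ic; congr (nat_of_bool _ * _).
    by rewrite ltnS leq_eqVlt; case: eqP => // iE; case: ic; apply: val_inj.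
  have gcN : g c <= g N by apply: ltnW_homo.
  rewrite cE mul1n; split=> [|le l]; first exact: leq_add.
  have le1 : \sum_(l < N) f l * g l <= \sum_(l < N) (l < c) * g l.
    by rewrite -(leq_add2r (g N)) (leq_trans le) // leq_add2l.
  have cE' : c = N.
    apply/eqP; rewrite eqn_leq cN leqNgt; apply/negP => /gh; apply/negP; rewrite -leqNgt.
    by rewrite -(leq_add2l (\sum_(l < N) (l < c) * g l)) (leq_trans _ le) // leq_add2r.
  rewrite ltnS leq_eqVlt => /orP[/eqP ->|lN]; first by rewrite fN cE' addn1 ltnSn.
  by rewrite (IH2 le1) // cE' lN addn1 ltnS (ltnW lN).
rewrite addn0 mul0n addn0 [N < c]ltnNge cN mul0n addn0; split=> // le l.
rewrite ltnS leq_eqVlt => /orP[/eqP ->|lN]; first by rewrite fN ltnNge cN.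
exact: IH2.
Qed.

Lemma leq_sum_eq (T : eqType) (s : seq T) (a b : T -> nat) :
  (forall i, i \in s -> a i <= b i) -> \sum_(i <- s) b i <= \sum_(i <- s) a i ->
  forall i, i \in s -> b i <= a i.
Proof.
elim: s => // z s IH ab; rewrite !big_cons => le i.
have sab : \sum_(i <- s) a i <= \sum_(i <- s) b i.
  by rewrite !big_seq; apply: leq_sum => i' i's; apply: ab; rewrite inE i's orbT.
have az := ab z (mem_head _ _).
rewrite inE => /orP[/eqP ->|]; first by rewrite -(leq_add2r (\sum_(i <- s) a i)) (leq_trans _ le) // leq_add2l.
apply: IH => [i' i's|]; first by apply: ab; rewrite inE i's orbT.
by rewrite -(leq_add2l (a z)) (leq_trans _ le) // leq_add2r.
Qed.

Definition weight m := \sum_(i < n) i * m i.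

Definition potential s d W := \sum_(m <- mons s d) W m * weight m.

Lemma weight_addU m x t : weight (m + U_(x) *+ t)%MM = weight m + x * t.
Proof.
rewrite /weight (bigD1 x) //= [in RHS](bigD1 x) //= addUE eqxx mul1n mulnDr addnAC.
congr (_ + _ + _); apply: eq_bigr => i /negbTE ix.
by rewrite addUE eq_sym ix mul0n addn0.
Qed.

(** Along a line the weight is affine in the exponent of [x] with slope [x - y > 0], so
    [sorted_sum_le] applies to its first [e] points. *)
Lemma potential_compress r d e W x y : uniq [:: x, y & r] -> y < x ->
  potential [:: x, y & r] d (compress y x e W) <= potential [:: x, y & r] d W /\
  (potential [:: x, y & r] d W <= potential [:: x, y & r] d (compress y x e W) ->
   forall m, mon [:: x, y & r] d m -> compress y x e W m = W m).
Proof.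
move=> us yx; have /and3P[] := us; rewrite inE negb_or => /andP[xy xr] yr ur.
pose P mu R V := \sum_(l < mu.+1) V (onto x y R l (mu - l)) * weight (onto x y R l (mu - l)).
have PE V : potential [:: x, y & r] d V = \sum_(mu < d.+1) \sum_(R <- mons r (d - mu)) P mu R V.
  exact: sum_mons_cons2.
have loc mu R : R \in mons r (d - mu) ->
  P mu R (compress y x e W) <= P mu R W /\ (P mu R W <= P mu R (compress y x e W) ->
    forall l, l <= mu -> compress y x e W (onto x y R l (mu - l)) = W (onto x y R l (mu - l))).
  rewrite mem_mons // => /monP[_ HR]; have Rx := HR x xr; have Ry := HR y yr.
  pose g l := weight R + y * mu + (x - y) * l.
  have gh : {homo g : i j / i < j} by move=> i j ij; rewrite ltn_add2l ltn_pmul2l // subn_gt0.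
  have gE l : l <= mu -> weight (onto x y R l (mu - l)) = g l.
    move=> lmu; rewrite /onto !weight_addU /g -!addnA; congr (_ + _).
    rewrite -{2}(subnKC lmu) mulnDr addnAC -mulnDl subnKC ?(ltnW yx) //.
  have PL V : P mu R V = \sum_(l < e) line x y R mu V l * g l
      + \sum_(l < mu.+1) line x y R mu V (e + l) * g (e + l).
    have cut K : mu < K -> P mu R V = \sum_(l < K) line x y R mu V l * g l.
      move=> muK; rewrite -(subnKC muK) big_split_ord /= [X in _ + X]big1 ?addn0 => [|i _].
        by apply: eq_bigr => l _; rewrite /line -ltnS ltn_ord gE // -ltnS.
      by rewrite /line leqNgt ltnS leq_addr.
    by rewrite (cut (e + mu.+1)) ?big_split_ord // addnS ltnS leq_addl.
  have hi l : line x y R mu (compress y x e W) (e + l) = line x y R mu W (e + l).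
    by rewrite line_compress // ltnNge leq_addr.
  have lo : \sum_(l < e) line x y R mu (compress y x e W) l * g l
      = \sum_(l < e) (l < \sum_(i < e) (line x y R mu W i : nat)) * g l.
    by apply: eq_bigr => l _; rewrite line_compress // ltn_ord.
  have [le eq] := sorted_sum_le (line x y R mu W) e gh.
  rewrite !PL lo; under [X in _ + X <= _]eq_bigr do rewrite hi.
  under [X in _ <= _ + X -> _]eq_bigr do rewrite hi.
  rewrite !leq_add2r; split=> // /eq {}eq l lmu.
  have := line_compress e mu W l xy Rx Ry; rewrite /line lmu /= => ->.
  by case: ltnP => // le'; have := eq l le'; rewrite /line lmu /= => ->.
have le1 mu : \sum_(R <- mons r (d - mu)) P mu R (compress y x e W) <= \sum_(R <- mons r (d - mu)) P mu R W.
  by rewrite !big_seq; apply: leq_sum => R /loc[].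
rewrite !PE; split; first by apply: leq_sum => mu _; apply: le1.
move=> le m; rewrite -mem_mons // => Hm.
have Hm' : mon [:: x, y & r] d m by rewrite -mem_mons.
have {Hm'} [dm sm] := monP _ _ _ Hm'.
pose R := base x y m; pose mu := m x + m y.
have dE : mdeg R + mu = d by rewrite -dm -[in RHS](onto_base m xy) !mdegDU addnA.
have HR : R \in mons r (d - mu).
  rewrite mem_mons //; apply/monP; split; first by rewrite -dE addnK.
  by move=> i ir; rewrite mnmE; case: ifP => // /negbT; rewrite negb_or => /andP[ix iy]; apply: sm; rewrite !inE !negb_or ix iy.
have mud : mu < d.+1 by rewrite ltnS -dE leq_addl.
have := @leq_sum_eq _ (index_enum 'I_d.+1) _ _ (fun i _ => le1 i) le (Ordinal mud) (mem_index_enum _).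
move=> /(leq_sum_eq (fun R HR => (loc mu R HR).1)) /(_ R HR) /(loc mu R HR).2 /(_ (m x) (leq_addr _ _)).
by rewrite addKn onto_base.
Qed.

Lemma shiftE x y m : x != y -> 0 < m x ->
  (m - U_(x) + U_(y))%MM = onto x y (base x y m) (m x).-1 (m y).+1.
Proof.
move=> xy mx; apply/mnmP => i; rewrite mnmDE mnmBE !mnm1E ontoE mnmE ![_ == i]eq_sym.
case: eqP => [->|_] /=; first by rewrite (negbTE xy) mul1n mul0n !addn0 subn1.
by case: eqP => [->|_] /=; rewrite ?mul1n ?mul0n subn0 ?addn0 ?addn1.
Qed.

Lemma stable_of_compress s d E W :
  (forall x y m, x \in s -> y \in s -> y < x -> mon s d m -> compress y x (E x) W m = W m) ->
  stable s d E W.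
Proof.
move=> fix_W x y m xs ys yx Hm Wm mx mE.
have xy : x != y by rewrite -(inj_eq val_inj) gtn_eqF.
rewrite shiftE //; have Hm' : mon s d (onto x y (base x y m) (m x).-1 (m y).+1).
  by apply: mon_onto => //; rewrite addnS -addSn prednK.
rewrite -(fix_W x y) //; move: Wm; rewrite -(fix_W x y) // /compress leqNgt mE /=.
rewrite ontoE mnmE eqxx /= add0n mul1n eq_sym (negbTE xy) mul0n addn0.
have Bx : base x y m x = 0 by rewrite mnmE eqxx.
have By : base x y m y = 0 by rewrite mnmE eqxx orbT.
rewrite [E x <= _]leqNgt (leq_ltn_trans (leq_pred _) mE) /= (base_onto _ _ Bx By).
rewrite ontoE By eqxx (negbTE xy) mul0n mul1n !add0n addnS -addSn prednK //.
exact: ltnW.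
Qed.

Lemma potential_perm s s' d W : uniq s -> perm_eq s s' -> potential s d W = potential s' d W.
Proof. by move=> us ss'; rewrite /potential (perm_big _ (mons_perm d us ss')). Qed.

(** A compression that changes [W] strictly lowers the potential, and a set fixed by all of them is
    stable. Since [E y <= E x], the set [W] contains the multiples of both powers with exponent
    [E x], as the compression requires. *)
Lemma exists_stable (k : fieldType) s E p d W : uniq s -> (forall x, x \in s -> 0 < E x) ->
  (forall x y, x \in s -> y \in s -> y < x -> E y <= E x) -> contains_powers s d E W ->
  exists W', [/\ size_in s d W' = size_in s d W,
    cycles k s p (d + p) W <= cycles k s p (d + p) W', contains_powers s d E W' & stable s d E W'].
Proof.
move=> us E0 Emono; elim: {W}_.+1 {-2}W (ltnSn (potential s d W)) => // N IH W WN cW.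
pose ok x y := [&& x \in s, y \in s & y < x] ==> all (fun m => compress y x (E x) W m == W m) (mons s d).
have [/forallP allok|] := boolP [forall x, [forall y, ok x y]].
  exists W; split=> //; apply: stable_of_compress => x y m xs ys yx Hm.
  have /forallP/(_ y) := allok x; rewrite /ok xs ys yx /= => /allP/(_ m) H; apply/eqP/H.
  by rewrite mem_mons.
rewrite negb_forall => /existsP[x]; rewrite negb_forall => /existsP[y].
rewrite negb_imply => /andP[/and3P[xs ys yx] /allPn[m Hm neq]].
have xy : x != y by rewrite -(inj_eq val_inj) gtn_eqF.
have ps := perm_two us xs ys xy.
have us' : uniq [:: x, y & rem y (rem x s)] by rewrite -(perm_uniq ps).
have [le eq] := potential_compress d (E x) W us' yx.
rewrite -!(potential_perm d _ us ps) in le eq.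
have lt : potential s d (compress y x (E x) W) < potential s d W.
  rewrite ltnNge; apply: contra neq => /eq H; apply/eqP; apply: H.
  by rewrite -(mon_perm d m ps) -mem_mons.
have cW' := compress_powers xs ys xy (Emono x y xs ys yx) cW.
have [W' [sW' zW' cW'' stW']] := IH _ (leq_trans lt WN) cW'.
exists W'; split=> //; first by rewrite sW' size_in_compress_in.
apply: leq_trans zW'; apply: cycles_compress_in => //; first exact: E0.
  by move=> m' Hm' Em; apply: (cW x).
by move=> m' Hm' Em; apply: (cW y) => //; apply: leq_trans Em; apply: Emono.
Qed.

End Stable.

(** * Lex-plus-powers monomial spaces *)

Section LexPlus.
Variable n : nat.
Local Open Scope nat_scope.
Local Notation mono := 'X_{1..n}.
Implicit Types (x y z i : 'I_n) (s : seq 'I_n) (m u v : mono) (W V L : mono -> bool) (E : 'I_n -> nat).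

Definition in_powers E s m := has (fun x => E x <= m x) s.

Lemma contains_powersP s d E W :
  contains_powers s d E W <-> (forall m, mon s d m -> in_powers E s m -> W m).
Proof.
split=> [H m Hm /hasP[x xs Ex]|H x m xs Hm Ex]; first exact: (H x).
by apply: H => //; apply/hasP; exists x.
Qed.

Definition lexp s d E W := contains_powers s d E W /\
  forall u v, mon s d u -> mon s d v -> ~~ in_powers E s u -> W u -> (u < v)%O -> W v.

(** Outside the powers both sets are upper segments of one total order, hence comparable by
    inclusion. *)
Lemma lexp_total s d E A B : uniq s -> lexp s d E A -> lexp s d E B ->
  size_in s d A <= size_in s d B -> forall m, mon s d m -> A m -> B m.
Proof.
move=> us [/contains_powersP PA LA] [/contains_powersP PB LB] le m Hm Am.
apply/negPn/negP => nBm; case/negP: (nBm); apply: (size_in_sub_eq us _ le) => // v Hv Bv.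
have [Pv|nPv] := boolP (in_powers E s v); first exact: PA.
have nPm : ~~ in_powers E s m by apply: contra nBm; apply: PB.
case: (Order.TotalTheory.ltgtP v m) => [vm|mv|-> //]; last exact: LA mv.
by case/negP: nBm; apply: LB vm.
Qed.

Definition lex_sorted s d E : seq mono :=
  sort (fun u v => (v <= u)%O) [seq m <- mons s d | ~~ in_powers E s m].

(** Only the monomials of [W] outside the powers are counted and moved to the top of the order, so
    the size is kept once [W] contains the powers. *)
Definition lexify s d E W : mono -> bool := fun m =>
  in_powers E s m || (m \in take (size_in s d (fun m => W m && ~~ in_powers E s m)) (lex_sorted s d E)).

Lemma mem_lex_sorted s d E m : uniq s ->
  (m \in lex_sorted s d E) = mon s d m && ~~ in_powers E s m.
Proof. by move=> us; rewrite mem_sort mem_filter mem_mons // andbC. Qed.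

Lemma lexify_lexp s d E W : uniq s -> lexp s d E (lexify s d E W).
Proof.
move=> us; split=> [|u v Hu Hv nPu].
  by apply/contains_powersP => m _ Pm; rewrite /lexify Pm.
rewrite {1}/lexify (negbTE nPu) /= /lexify; set k := size_in _ _ _ => uk uv.
have [//|nPv] := boolP (in_powers E s v); rewrite /=.
have ul : u \in lex_sorted s d E by rewrite mem_lex_sorted // Hu.
have vl : v \in lex_sorted s d E by rewrite mem_lex_sorted // Hv.
move: uk; rewrite !in_take // => uk; rewrite (leq_ltn_trans _ uk) // leqNgt; apply/negP => lt.
have tr : transitive (fun u v : mono => (v <= u)%O).
  by move=> a b c ba ac; apply: Order.POrderTheory.le_trans ac ba.
have so : sorted (fun u v : mono => (v <= u)%O) (lex_sorted s d E).
  by apply: sort_sorted => a b; apply: Order.TotalTheory.le_total.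
have := sorted_ltn_index tr so _ _ ul vl lt.
by rewrite Order.TotalTheory.leNgt uv.
Qed.

Lemma size_in_split s d W (Q : pred mono) :
  size_in s d W = size_in s d (fun m => W m && Q m) + size_in s d (fun m => W m && ~~ Q m).
Proof.
rewrite /size_in -big_split; apply: eq_bigr => m _ /=.
by case: (W m); case: (Q m).
Qed.

Lemma size_lexify s d E W : uniq s -> contains_powers s d E W ->
  size_in s d (lexify s d E W) = size_in s d W.
Proof.
move=> us /contains_powersP PW.
rewrite (size_in_split s d W (in_powers E s)) (size_in_split s d _ (in_powers E s)); congr (_ + _).
  apply: eq_size_in => // m Hm; rewrite /lexify.
  by case: (boolP (in_powers E s m)) => [Pm|]; rewrite ?andbF // (PW m).
set k := size_in s d (fun m => W m && ~~ in_powers E s m).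
have ul : uniq (lex_sorted s d E) by rewrite sort_uniq filter_uniq // uniq_mons.
have -> : size_in s d (fun m => lexify s d E W m && ~~ in_powers E s m)
    = \sum_(m <- lex_sorted s d E) (m \in take k (lex_sorted s d E) : nat).
  rewrite (perm_big _ (permEl (perm_sort _ _))) /= big_filter /size_in [RHS]big_mkcond /=.
  apply: eq_bigr => m _; rewrite /lexify -/k.
  by case: (in_powers E s m); rewrite ?andbF //= andbT.
have szk : k <= size (lex_sorted s d E).
  rewrite size_sort -sum1_size big_filter /k /size_in [leqRHS]big_mkcond; apply: leq_sum => m _.
  by case: (W m); case: (in_powers E s m).
rewrite -{1}(cat_take_drop k (lex_sorted s d E)) big_cat /=.
rewrite big_seq (eq_bigr (fun=> 1)) => [|m -> //]; rewrite -big_seq sum1_size size_take_min.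
rewrite (minn_idPl szk) big_seq big1 ?addn0 // => m md.
have := ul; rewrite -{1}(cat_take_drop k (lex_sorted s d E)) cat_uniq => /and3P[_ /hasPn H _].
by rewrite (negbTE (H m md)).
Qed.

Definition up s E W : mono -> bool := fun m =>
  in_powers E s m || has (fun y => (0 < m y) && W (m - U_(y))%MM) s.

Lemma gt_ordF x y : y < x -> (x == y) = false.
Proof. by move=> yx; rewrite -(inj_eq val_inj) gtn_eqF. Qed.

Lemma submUK m x : 0 < m x -> (m - U_(x) + U_(x) *+ 1)%MM = m.
Proof.
move=> mx; apply/mnmP => i; rewrite addUE mnmBE mnm1E muln1.
by case: eqP => [<-|_]; rewrite ?subnK // subn0 addn0.
Qed.

Lemma mdegBU m x d : 0 < m x -> mdeg m = d.+1 -> mdeg (m - U_(x))%MM = d.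
Proof. by move=> mx dm; have := mdegDU (m - U_(x))%MM x 1; rewrite submUK // dm addn1 => -[]. Qed.

Lemma mon_sub1 s d y m : mon s d.+1 m -> 0 < m y -> mon s d (m - U_(y))%MM.
Proof.
move=> /monP[dm sm] my; apply/monP; split; first exact: mdegBU.
by move=> i iS; rewrite mnmBE sm.
Qed.

Lemma up_mono s d E W V : (forall m, mon s d m -> W m -> V m) ->
  forall m, mon s d.+1 m -> up s E W m -> up s E V m.
Proof.
move=> WV m Hm /orP[Pm|/hasP[y ys /andP[my Wm]]]; first by rewrite /up Pm.
by apply/orP; right; apply/hasP; exists y; rewrite // my /=; apply: WV Wm; apply: mon_sub1.
Qed.

Lemma last_var s d m : mon s d.+1 m -> exists2 z, z \in s /\ 0 < m z & forall i, z < i -> m i = 0.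
Proof.
move=> /monP[dm sm].
have [i mi] : exists i, 0 < m i.
  apply/existsP; rewrite -[[exists _, _]]negbK negb_exists; apply/negP => /forallP H.
  suff : mdeg m = 0 by rewrite dm.
  by rewrite mdegE big1 // => i _; apply/eqP; rewrite -leqn0 leqNgt.
case: (@arg_maxnP _ i (fun i => 0 < m i) (fun i => nat_of_ord i) mi) => z mz zmax.
exists z; first by split=> //; apply: contraLR mz => zs; rewrite sm.
by move=> j zj; apply/eqP; rewrite -leqn0 leqNgt; apply: contraL zj => /zmax; rewrite -leqNgt.
Qed.

Lemma mdeg_lt u v i : (forall j, u j <= v j) -> u i < v i -> mdeg u < mdeg v.
Proof.
move=> le lt; rewrite !mdegE (bigD1 i) //= [X in _ < X](bigD1 i) //= -addSn.
by apply: leq_add => //; apply: leq_sum.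
Qed.

(** A first difference before [z] survives both divisions. If it occurs at [z] itself, then [v] ends
    there and equality of degrees forces [u] to continue beyond [z]; a reversed order of the
    quotients would contradict their degrees. *)
Lemma lt_sub_last d u v y z : mdeg u = d.+1 -> mdeg v = d.+1 ->
  0 < u y -> 0 < v z -> (forall i, y < i -> u i = 0) -> (forall i, z < i -> v i = 0) ->
  (u < v)%O -> ((u - U_(y))%MM <= (v - U_(z))%MM)%O.
Proof.
move=> du dv uy vz uy0 vz0 uv.
have du' := mdegBU uy du; have dv' := mdegBU vz dv.
rewrite Order.TotalTheory.leNgt; apply/negP => /(ltmcP (etrans dv' (esym du'))) [i eqi lti].
move/(ltmcP (etrans du (esym dv))): uv => [j eqj ltj].
have sub m x k : x != k -> (m - U_(x))%MM k = m k by move=> /negbTE xk; rewrite mnmBE mnm1E xk subn0.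
have jz : j <= z by rewrite leqNgt; apply/negP => /vz0 vj; rewrite vj in ltj.
have le_u k : (u - U_(y))%MM k <= u k by rewrite mnmBE leq_subr.
move: jz; rewrite leq_eqVlt => /orP[/eqP/val_inj jz|jz].
  have yz : z < y.
    rewrite ltnNge; apply/negP => yz; suff : mdeg u < mdeg v by rewrite du dv ltnn.
    apply: (@mdeg_lt _ _ j) => // k; case: (ltngtP k j) => [/eqj -> //|kj|/val_inj ->]; last exact: ltnW.
    by rewrite uy0 // (leq_ltn_trans yz) // -jz.
  have u'E (k : 'I_n) : k <= z -> (u - U_(y))%MM k = u k.
    by move=> kz; apply: sub; rewrite gt_ordF // (leq_ltn_trans kz).
  suff : mdeg (v - U_(z))%MM < mdeg (u - U_(y))%MM by rewrite du' dv' ltnn.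
  have zi : z < i.
    rewrite ltnNge; apply/negP => iz; move: lti; rewrite u'E // mnmBE mnm1E.
    move: iz; rewrite leq_eqVlt => /orP[/eqP/val_inj ->|iz].
      by rewrite eqxx subn1 prednK // leqNgt -jz ltj.
    by rewrite gt_ordF // subn0 eqj ?ltnn // jz.
  apply: (@mdeg_lt _ _ i) => // k; case: (ltnP k i) => [/eqi -> //|ik].
  by rewrite mnmBE vz0 // (leq_trans zi).
have v'E (k : 'I_n) : k <= j -> (v - U_(z))%MM k = v k.
  by move=> kj; apply: sub; rewrite gt_ordF // (leq_ltn_trans kj).
case: (ltngtP i j) => [ij|ji|/val_inj ij].
- move: lti; by rewrite (v'E i (ltnW ij)) ltnNge -(eqj _ ij) le_u.
- have := eqi _ ji; rewrite v'E // => e; by have := le_u j; rewrite -e leqNgt ltj.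
- by move: lti; rewrite ij (v'E j (leqnn _)) ltnNge (leq_trans (le_u j)) // ltnW.
Qed.

(** Dividing by the last variable gives the largest of the quotients, so membership in [up] may be
    tested there. [lt_sub_last] then carries it from [u] to [v]. *)
Lemma up_lexp s d E L : lexp s d E L -> lexp s d.+1 E (up s E L).
Proof.
move=> [/contains_powersP PL LL]; split=> [|u v Hu Hv nPu].
  by apply/contains_powersP => m _ Pm; rewrite /up Pm.
rewrite /up (negbTE nPu) /= => /hasP[y0 y0s /andP[uy0 Ly0]] uv.
have [//|nPv] := boolP (in_powers E s v).
have [du su] := monP _ _ _ Hu; have [dv sv] := monP _ _ _ Hv.
have [y [ys uy] ymax] := last_var Hu; have [z [zs vz] zmax] := last_var Hv.
apply/orP; right; apply/hasP; exists z; rewrite // vz /=.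
have nP m x : ~~ in_powers E s m -> ~~ in_powers E s (m - U_(x))%MM.
  move=> /hasPn H; apply/hasPn => k ks; apply: contra (H k ks) => /leq_trans; apply.
  by rewrite mnmBE leq_subr.
have Hu' x : 0 < u x -> mon s d (u - U_(x))%MM by move=> ux; apply: mon_sub1.
have Hv' := mon_sub1 Hv vz.
have Ly : L (u - U_(y))%MM.
  have [<- //|y0y] := eqVneq y0 y.
  apply: (LL (u - U_(y0))%MM) => //; rewrite ?Hu' ?nP //.
  have ley : y0 < y.
    rewrite ltn_neqAle (inj_eq val_inj) y0y leqNgt; apply/negP => /ymax uy00.
    by rewrite uy00 in uy0.
  apply/ltmcP; first by rewrite !(mdegBU (d := d)).
  exists y0; rewrite ?mnmBE ?mnm1E.
    move=> k ky0; rewrite !mnmBE !mnm1E !gt_ordF //.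
    exact: ltn_trans ley.
  by rewrite eqxx eq_sym (negbTE y0y) subn0 subn1 ltn_predL.
have := lt_sub_last du dv uy vz ymax zmax uv.
rewrite Order.POrderTheory.le_eqVlt => /orP[/eqP <- //|lt].
by apply: LL lt; rewrite ?Hu' ?nP.
Qed.

End LexPlus.

(** * Comparison with lex-plus-powers spaces *)

Section Slices.
Variable n : nat.
Local Open Scope nat_scope.
Local Notation mono := 'X_{1..n}.
Implicit Types (x y z i : 'I_n) (s : seq 'I_n) (F : {set 'I_n}) (m u v R : mono) (W V L : mono -> bool) (E : 'I_n -> nat).

Definition sec x t W : mono -> bool := fun m => W (m + U_(x) *+ t)%MM.

Definition strip x m : mono := (m - U_(x) *+ m x)%MM.

Lemma stripK x m : (strip x m + U_(x) *+ m x)%MM = m.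
Proof.
apply/mnmP => i; rewrite addUE mnmBE mulmnE mnm1E.
by case: eqP => [->|_]; rewrite ?mul1n ?mul0n ?subnn ?subn0 ?addn0.
Qed.

Lemma strip_addU x m t : m x = 0 -> strip x (m + U_(x) *+ t)%MM = m.
Proof.
move=> mx; apply/mnmP => i; rewrite mnmBE addUE mulmnE addUE eqxx mnm1E mx mul1n add0n.
by case: eqP => _; rewrite ?mul1n ?mul0n ?addnK ?subn0 ?addn0.
Qed.

Lemma strip_x x m : strip x m x = 0.
Proof. by rewrite mnmBE mulmnE mnm1E eqxx mul1n subnn. Qed.

Lemma strip_ne x m i : x != i -> strip x m i = m i.
Proof. by move=> xi; rewrite mnmBE mulmnE mnm1E (negbTE xi) mul0n subn0. Qed.

Lemma mon_strip x s d m : mon (x :: s) d m -> mon s (d - m x) (strip x m) /\ m x <= d.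
Proof.
move=> /monP[dm sm].
have e : mdeg (strip x m) + m x = d by rewrite -(mdegDU _ x) stripK.
split; last by rewrite -e leq_addl.
apply/monP; split; first by rewrite -e addnK.
move=> i iS; case: (eqVneq x i) => [<-|xi]; first exact: strip_x.
by rewrite strip_ne // sm // inE negb_or eq_sym xi.
Qed.

Lemma mon_addU x s d t m : t <= d -> mon s (d - t) m -> mon (x :: s) d (m + U_(x) *+ t)%MM.
Proof.
move=> td /monP[dm sm]; apply/monP; split; first by rewrite mdegDU dm subnK.
by move=> i; rewrite inE negb_or eq_sym => /andP[/negbTE xi iS]; rewrite addUE xi sm.
Qed.

Section Step.
Variables (x : 'I_n) (s : seq 'I_n) (E : 'I_n -> nat) (d : nat).
Hypotheses (us : uniq (x :: s)) (xmax : forall y, y \in s -> y < x) (Ex : 0 < E x).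

Let xs : x \notin s. Proof. by case/andP: us. Qed.
Let us' : uniq s. Proof. by case/andP: us. Qed.

Definition last_stable W := forall y m, y \in s -> mon (x :: s) d m ->
  W m -> 0 < m x -> m x < E x -> W (m - U_(x) + U_(y))%MM.

Lemma mon_x t m : mon s t m -> m x = 0.
Proof. by move=> /monP[_]; apply. Qed.

Lemma addU_x t m : mon s (d - t) m -> (m + U_(x) *+ t)%MM x = t.
Proof. by move=> Hm; rewrite addUE eqxx mul1n (mon_x Hm). Qed.

Lemma in_powers_sec t m : t < E x -> mon s (d - t) m ->
  in_powers E (x :: s) (m + U_(x) *+ t)%MM = in_powers E s m.
Proof.
move=> te Hm; rewrite /in_powers /= (addU_x Hm) leqNgt te /=; apply: eq_in_has => y ys.
rewrite addUE; case: eqP => [xy|_]; last by rewrite addn0.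
by have := xs; rewrite xy ys.
Qed.

Lemma mon_shift y m : y \in s -> mon (x :: s) d m -> 0 < m x -> mon (x :: s) d (m - U_(x) + U_(y))%MM.
Proof.
move=> ys Hm mx; have xy : x != y by apply: contraNneq xs => ->.
by rewrite shiftE //; apply: mon_onto; rewrite ?mem_head ?inE ?ys ?orbT // addnS -addSn prednK.
Qed.

Lemma shift_x y m : y \in s -> (m - U_(x) + U_(y))%MM x = (m x).-1.
Proof.
move=> ys; have yx : y == x = false by apply: contraNF xs => /eqP <-.
by rewrite mnmDE mnmBE !mnm1E eqxx yx subn1 addn0.
Qed.

Lemma lexp_last_stable L : lexp (x :: s) d E L -> last_stable L.
Proof.
move=> [/contains_powersP PL LL] y m ys Hm Lm mx mE.
have yx : y == x = false by apply: contraNF xs => /eqP <-.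
have Hm' := mon_shift ys Hm mx.
have [Pm|nPm] := boolP (in_powers E (x :: s) m).
  apply: PL => //; apply/hasP; have /hasP[z] := Pm; rewrite inE => /orP[/eqP -> Ez|zs Ez].
    by move: mE; rewrite ltnNge Ez.
  exists z; first by rewrite inE zs orbT.
  rewrite mnmDE mnmBE (leq_trans Ez) // (leq_trans _ (leq_addr _ _)) // mnm1E.
  have -> : x == z = false by apply: contraNF xs => /eqP ->.
  by rewrite subn0.
apply: LL nPm Lm _ => //; apply/ltmcP.
  by have /monP[-> _] := Hm; have /monP[-> _] := Hm'.
exists y => [j jy|]; rewrite mnmDE mnmBE !mnm1E.
  have jx : j < x := ltn_trans jy (xmax ys).
  by rewrite (gt_ordF jx) (gt_ordF jy) subn0 addn0.
by rewrite eqxx eq_sym yx subn0 addn1.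
Qed.

(** Induction on [v x - u x]; at equal exponents both lie in one section, which is a lex segment.
    Otherwise one [x] of [v] is traded for a variable in which [v] is smaller than [u], which keeps
    [v] off the powers. A variable other than the first difference [i] leaves that difference in
    place; if there is none, trading for [i] stays below [u] or reaches it. *)
Lemma lower_mem V u v : contains_powers (x :: s) d E V -> last_stable V ->
  (forall t, t <= d -> t < E x -> lexp s (d - t) E (sec x t V)) ->
  mon (x :: s) d u -> mon (x :: s) d v -> ~~ in_powers E (x :: s) u -> ~~ in_powers E (x :: s) v ->
  u x <= v x -> (v <= u)%O -> V v -> V u.
Proof.
move=> PV SV LV Hu Hv nPu; move eN: (v x - u x) => N.
elim: N v eN Hv => [|N IH] v eN Hv nPv uvx; rewrite Order.POrderTheory.le_eqVlt => /orP[/eqP <- //|vu] Vv.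
  have uv : u x = v x by apply/eqP; rewrite eqn_leq uvx -subn_eq0 eN.
  have [Hu' ud] := mon_strip Hu; have [Hv' vd] := mon_strip Hv.
  have vE : v x < E x by move: nPv; rewrite /in_powers /= negb_or -ltnNge => /andP[].
  have [_ /(_ (strip x v) (strip x u))] := LV _ vd vE.
  rewrite /sec stripK -uv stripK; apply=> //; rewrite ?uv //.
    by rewrite -(in_powers_sec vE) // stripK.
  by rewrite -(ltmc_add2l _ _ (U_(x) *+ v x)) stripK -uv stripK.
have [du su] := monP _ _ _ Hu; have [dv sv] := monP _ _ _ Hv.
have lt_x : u x < v x by rewrite -subn_gt0 eN.
have [i eqi lti] := ltmcP (etrans dv (esym du)) vu.
have iS : i \in s.
  have : i \in x :: s by apply: contraLR lti => /su ->.
  by rewrite inE => /orP[/eqP ix|//]; move: lti; rewrite ix ltnNge (ltnW lt_x).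
have ux_small y : y \in s -> u y < E y.
  by move=> ys; move: nPu; rewrite ltnNge => /hasPn; apply; rewrite inE ys orbT.
have vE : v x < E x by move: nPv; rewrite /in_powers /= negb_or -ltnNge => /andP[].
have vx0 : 0 < v x by apply: leq_ltn_trans lt_x.
have step y : y \in s -> v y < u y -> ((v - U_(x) + U_(y))%MM <= u)%O -> V u.
  move=> ys vy le; apply: (IH (v - U_(x) + U_(y))%MM) => //.
  - by rewrite shift_x // -subn1 subnAC eN subn1.
  - exact: mon_shift.
  - apply/hasPn => z; rewrite inE -ltnNge => /orP[/eqP ->|zs].
      by rewrite shift_x // (leq_ltn_trans _ vE) // leq_pred.
    have xz : x == z = false by apply: contraNF xs => /eqP ->.
    rewrite mnmDE mnmBE !mnm1E xz subn0; case: eqP => [<-|_].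
      by rewrite addn1 (leq_ltn_trans _ (ux_small _ ys)).
    by rewrite addn0 ltnNge; move/hasPn: nPv; apply; rewrite inE zs orbT.
  - by rewrite shift_x // -ltnS prednK.
  - exact: SV.
have [/hasP[j js /andP[ji ltj]]|/hasPn none] := boolP (has (fun j => (j != i) && (v j < u j)) s).
  apply: (step j js ltj); apply: Order.POrderTheory.ltW; apply/ltmcP.
    by have /monP[-> _] := mon_shift js Hv vx0.
  have ij : i < j.
    rewrite ltnNge leq_eqVlt (inj_eq val_inj) (negbTE ji) /=; apply/negP => /eqi e.
    by rewrite e ltnn in ltj.
  exists i => [z zi|]; rewrite mnmDE mnmBE !mnm1E.
    by rewrite (gt_ordF (ltn_trans zi (xmax iS))) (gt_ordF (ltn_trans zi ij)) subn0 addn0 eqi.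
  by rewrite (gt_ordF (xmax iS)) (gt_ordF ij) subn0 addn0.
apply: (step i iS lti).
have Hv' := mon_shift iS Hv vx0; have [dv' sv'] := monP _ _ _ Hv'.
have ge_z z : z != i -> u z <= (v - U_(x) + U_(i))%MM z.
  move=> zi; rewrite mnmDE mnmBE !mnm1E [i == z]eq_sym (negbTE zi) addn0.
  case: (eqVneq x z) => [<-|xz]; first by rewrite subn1 -ltnS prednK.
  rewrite subn0; have [zs|zs] := boolP (z \in s); first by have := none z zs; rewrite zi -leqNgt.
  by rewrite su // inE negb_or eq_sym xz.
have v'i : (v - U_(x) + U_(i))%MM i = (v i).+1.
  by rewrite mnmDE mnmBE !mnm1E eqxx (gt_ordF (xmax iS)) subn0 addn1.
have : (v - U_(x) + U_(i))%MM i <= u i by rewrite v'i.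
rewrite leq_eqVlt => /orP[/eqP eqvi|ltvi].
  suff -> : (v - U_(x) + U_(i))%MM = u by [].
  apply/esym/mnmP => z; apply/eqP; rewrite eqn_leq.
  have ge z' : u z' <= (v - U_(x) + U_(i))%MM z'.
    by case: (eqVneq z' i) => [->|/ge_z //]; rewrite eqvi.
  rewrite ge /= leqNgt; apply/negP => /(mdeg_lt ge).
  by rewrite du dv' ltnn.
apply: Order.POrderTheory.ltW; apply/ltmcP; first by rewrite dv' du.
exists i => // z zi; rewrite mnmDE mnmBE !mnm1E.
by rewrite (gt_ordF (ltn_trans zi (xmax iS))) (gt_ordF zi) subn0 addn0 eqi.
Qed.

(* Elements of L outside V have a larger exponent of x than those of V outside L. *)
Lemma compare_sections V L : contains_powers (x :: s) d E V -> last_stable V ->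
  (forall t, t <= d -> t < E x -> lexp s (d - t) E (sec x t V)) ->
  lexp (x :: s) d E L -> size_in (x :: s) d V = size_in (x :: s) d L ->
  (forall m, mon (x :: s) d m -> m x = 0 -> L m -> V m) /\
  (forall m, mon (x :: s) d m -> (m x).+1 = E x -> V m -> L m).
Proof.
move=> PV SV LV [PL LL] sz.
have /contains_powersP PV' := PV; have /contains_powersP PL' := PL.
have key u v : mon (x :: s) d u -> mon (x :: s) d v -> L u -> ~~ V u -> V v -> ~~ L v -> v x < u x.
  move=> Hu Hv Lu nVu Vv nLv; rewrite ltnNge; apply: contra nVu => uv.
  have nPv : ~~ in_powers E (x :: s) v by apply: contra nLv; apply: PL'.
  have [Pu|nPu] := boolP (in_powers E (x :: s) u); first exact: PV'.
  apply: (lower_mem PV SV LV Hu Hv) => //.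
  rewrite Order.TotalTheory.leNgt; apply: contra nLv; exact: LL.
(* At an extreme exponent of [x], a single element in one difference of the two sets forces the
   other difference to be empty; equal sizes then empty both. *)
split=> m Hm mx Hin; apply/negPn/negP => nin; case/negP: (nin).
  apply: (@size_in_sub_eq _ (x :: s) d V L) => //; last by rewrite sz.
  move=> v Hv Vv; apply/negPn/negP => nLv.
  by have := key _ _ Hm Hv Hin nin Vv nLv; rewrite mx.
apply: (@size_in_sub_eq _ (x :: s) d L V) => //; last by rewrite sz.
move=> u Hu Lu; apply/negPn/negP => nVu; have := key _ _ Hu Hm Lu nVu Hin nin.
move=> lt; case/negP: nVu; apply: (PV x) => //; first exact: mem_head.
by rewrite -mx.
Qed.

(** The intermediate set between [W] and [L]: every section is a lex segment with the powers, but
    the sizes of the sections are still those of [W]. *)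
Definition lexsec W : mono -> bool := fun m =>
  if m x < E x then lexify s (d - m x) E (sec x (m x) W) (strip x m) else true.

Lemma sec_lexsec W t m : t < E x -> mon s (d - t) m ->
  sec x t (lexsec W) m = lexify s (d - t) E (sec x t W) m.
Proof. by move=> te Hm; rewrite /sec /lexsec (addU_x Hm) te strip_addU // (mon_x Hm). Qed.

Lemma sec_powers W t : t <= d -> contains_powers (x :: s) d E W ->
  contains_powers s (d - t) E (sec x t W).
Proof.
move=> td PW y m ys Hm Ey; apply: (PW y); [by rewrite inE ys orbT | exact: mon_addU |].
by rewrite addUE (leq_trans Ey) // leq_addr.
Qed.

Lemma sec_full W t m : t <= d -> E x <= t -> contains_powers (x :: s) d E W -> mon s (d - t) m ->
  sec x t W m.
Proof.
move=> td te PW Hm; apply: (PW x); [exact: mem_head | exact: mon_addU |].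
by rewrite (addU_x Hm).
Qed.

Lemma lexsec_lexp W t : t <= d -> t < E x -> lexp s (d - t) E (sec x t (lexsec W)).
Proof.
move=> td te; have [/contains_powersP P1 L1] := lexify_lexp (d - t) E (sec x t W) us'; split.
  by apply/contains_powersP => m Hm /(P1 m Hm); rewrite sec_lexsec.
by move=> u v Hu Hv nPu; rewrite !sec_lexsec //; apply: L1.
Qed.

Lemma lexsec_powers W : contains_powers (x :: s) d E (lexsec W).
Proof.
apply/contains_powersP => m Hm; rewrite /lexsec; case: ltnP => // mE.
have [Hm' md] := mon_strip Hm.
rewrite -{1}(stripK x m) (in_powers_sec mE) // => Pm.
by rewrite /lexify Pm.
Qed.

Lemma size_lexsec_sec W t : contains_powers (x :: s) d E W -> t <= d ->
  size_in s (d - t) (sec x t (lexsec W)) = size_in s (d - t) (sec x t W).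
Proof.
move=> PW td; case: (ltnP t (E x)) => te.
  rewrite -(size_lexify us' (sec_powers td PW)); apply: eq_size_in => // m Hm.
  by rewrite sec_lexsec.
apply: eq_size_in => // m Hm.
by rewrite !sec_full //; apply: lexsec_powers.
Qed.

Lemma size_sec W : size_in (x :: s) d W = \sum_(t < d.+1) size_in s (d - t) (sec x t W).
Proof. exact: sum_mons_cons. Qed.

Lemma size_lexsec W : contains_powers (x :: s) d E W ->
  size_in (x :: s) d (lexsec W) = size_in (x :: s) d W.
Proof.
move=> PW; rewrite !size_sec; apply: eq_bigr => t _; apply: size_lexsec_sec => //.
by rewrite -ltnS.
Qed.

Lemma stable_sec W t : t <= d -> stable (x :: s) d E W -> stable s (d - t) E (sec x t W).
Proof.
move=> td SW a b m sa sb ba Hm Wm ma mE.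
have ax : x == a = false by apply: contraNF xs => /eqP ->.
have := SW a b (m + U_(x) *+ t)%MM; rewrite !inE sa sb !orbT addUE ax mul0n addn0 /sec.
move=> /(_ isT isT ba (mon_addU x td Hm) Wm ma mE).
congr (is_true (W _)); apply/mnmP => i; rewrite !(mnmDE, mnmBE, mulmnE, mnm1E).
case: (eqVneq a i) => [ai|_]; last by rewrite !subn0 addnAC.
by rewrite -ai ax mul0n !addn0.
Qed.

Lemma last_stable_of W : stable (x :: s) d E W -> last_stable W.
Proof.
by move=> SW y m ys Hm Wm mx mE; apply: (SW x y m) => //; rewrite ?mem_head ?inE ?ys ?orbT ?xmax.
Qed.

Lemma up_sec_sub W t m : contains_powers (x :: s) d E W -> last_stable W -> t < d -> t.+1 < E x ->
  mon s (d - t) m -> up s E (sec x t.+1 W) m -> sec x t W m.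
Proof.
move=> PW SW td te Hm /orP[Pm|/hasP[y ys /andP[my Wm]]].
  by have /contains_powersP := sec_powers (ltnW td) PW; apply.
have xy : x == y = false by apply: contraNF xs => /eqP ->.
have Hm' : mon s (d - t.+1) (m - U_(y))%MM by apply: mon_sub1 => //; rewrite -subSn // subSS.
have := SW y _ ys (mon_addU x td Hm') Wm; rewrite (addU_x Hm') => /(_ isT te).
congr (is_true (W _)); apply/mnmP => i; rewrite !(mnmDE, mnmBE, mulmnE, mnm1E).
case: (eqVneq x i) => [<-|xi].
  by rewrite eq_sym xy !mul1n subn0 addn0 -addnBA ?subn1.
by rewrite !mul0n !addn0 subn0; case: (eqVneq y i) => [<-|]; rewrite ?subn0 ?addn0 // subnK.
Qed.

(** The minimal growth theorem of Macaulay, in the form of Clements and Lindstrom with powers of the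
    variables, for stable sets in the variables [s]. *)
Definition growth_bound D := forall A B, contains_powers s D E A -> stable s D E A ->
  lexp s D E B -> size_in s D A = size_in s D B ->
  size_in s D.+1 (up s E B) <= size_in s D.+1 (up s E A).

(** Stability means that [up] of section [t.+1] lies in section [t]. For lexified sections both are
    lex segments, so the inclusion reduces to an inequality of sizes, which follows from the growth
    bound and the stability of [W]. *)
Lemma lexsec_last_stable W : (forall D, growth_bound D) ->
  contains_powers (x :: s) d E W -> stable (x :: s) d E W -> last_stable (lexsec W).
Proof.
move=> IH PW SW y m ys Hm; have [Hm' md] := mon_strip Hm.
have xy : x == y = false by apply: contraNF xs => /eqP ->.
rewrite {1}/lexsec => + mx mE; rewrite mE => Vm.
rewrite /lexsec shift_x // (leq_ltn_trans (leq_pred _) mE).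
have -> : strip x (m - U_(x) + U_(y))%MM = (strip x m + U_(y))%MM.
  apply/mnmP => i; rewrite /strip !(mnmDE, mnmBE, mulmnE, mnm1E) eqxx [y == x]eq_sym xy addn0.
  case: (eqVneq x i) => [<-|xi]; last by rewrite !mul0n !subn0.
  by rewrite eq_sym xy !mul1n !addn0 !subnn.
case: (m x) mx mE md Hm' Vm => // t _ /= te td Hm' Vm.
have St := stable_sec td SW; have Pt := sec_powers td PW.
have gt := IH _ _ _ Pt St (lexify_lexp _ E _ us') (esym (size_lexify us' Pt)).
have dS : (d - t.+1).+1 = d - t by rewrite -subSn // subSS.
have Pt' := sec_powers (ltnW td) PW.
apply: (lexp_total us' (up_lexp (lexify_lexp (d - t.+1) E (sec x t.+1 W) us'))).
- by rewrite dS; apply: lexify_lexp.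
- apply: leq_trans gt _; rewrite dS size_lexify //; apply: size_in_mono => // m' Hm''.
  by apply: up_sec_sub => //; apply: last_stable_of.
- apply/monP; have /monP[dm sm] := Hm'; split; first by rewrite mdegD mdeg1 dm addn1.
  move=> i iS; rewrite mnmDE mnm1E sm //; case: eqP => // yi; by rewrite yi (negbTE iS) in ys.
apply/orP; right; apply/hasP; exists y => //.
rewrite mnmDE mnm1E eqxx addn1 /=.
rewrite (_ : (strip x m + U_(y) - U_(y))%MM = strip x m) //.
by apply/mnmP => i; rewrite mnmBE mnmDE addnK.
Qed.

(** Below the power, section [t.+1] of [up] is section [t] of [W]: dividing by [x] gives it, and
    dividing by another variable gives nothing new by stability. Hence only section 0 really
    grows. *)
Lemma size_up W : contains_powers (x :: s) d E W -> last_stable W ->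
  size_in (x :: s) d.+1 (up (x :: s) E W) = size_in s d.+1 (up s E (sec x 0 W))
   + \sum_(t < d.+1) (if t.+1 < E x then size_in s (d - t) (sec x t W) else size_in s (d - t) (fun=> true)).
Proof.
move=> PW SW; rewrite /size_in sum_mons_cons big_ord_recl /=; congr (_ + _).
  rewrite subn0 !big_seq; apply: eq_bigr => m; rewrite mem_mons // => Hm.
  have mx := mon_x Hm; congr nat_of_bool.
  rewrite mulm0n addm0 {1}/up {1}/in_powers -cat1s !has_cat !has_seq1 mx ltnn leqNgt Ex !orFb.
  by congr (_ || _); apply: eq_in_has => y ys; rewrite /sec mulm0n addm0.
apply: eq_bigr => t _; rewrite /bump /= add1n subSS; have td : t <= d by rewrite -ltnS.
case: ifP => te; rewrite !big_seq; apply: eq_bigr => m; rewrite mem_mons // => Hm.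
  congr nat_of_bool; apply/idP/idP => [|Wm]; last first.
    apply/orP; right; apply/hasP; exists x; first exact: mem_head.
    rewrite addUE eqxx mul1n addnS /=.
    rewrite (_ : (m + U_(x) *+ t.+1 - U_(x))%MM = (m + U_(x) *+ t)%MM) //.
    apply/mnmP => i; rewrite !(mnmDE, mnmBE, mulmnE, mnm1E).
    by case: eqP => _; rewrite ?mul0n ?subn0 // !mul1n addnS subn1.
  case/orP => [/hasP[z]|/hasP[z]]; rewrite inE => /orP[/eqP ->|zs].
  - by rewrite addUE eqxx mul1n (mon_x Hm) add0n leqNgt te.
  - have xz : x == z = false by apply: contraNF xs => /eqP ->.
    rewrite addUE xz mul0n addn0 => Ez; apply: (PW z); rewrite ?inE ?zs ?orbT //.
      exact: mon_addU.
    by rewrite addUE xz mul0n addn0.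
  - move=> /andP[_]; congr (is_true (W _)); apply/mnmP => i; rewrite !(mnmDE, mnmBE, mulmnE, mnm1E).
    by case: eqP => _; rewrite ?mul0n ?subn0 // !mul1n addnS subn1.
  - have xz : x == z = false by apply: contraNF xs => /eqP ->.
    rewrite addUE xz mul0n addn0 => /andP[mz Wm].
    case: (ltnP t d) => [td'|dt].
      apply: (up_sec_sub PW SW td' te Hm); apply/orP; right; apply/hasP; exists z; rewrite // mz /= /sec.
      move: Wm; congr (is_true (W _)); apply/mnmP => i; rewrite !(mnmDE, mnmBE, mulmnE, mnm1E).
      by case: (eqVneq z i) => [<-|]; rewrite ?xz ?mul0n ?addn0 ?subn0.
    have /monP[dm _] := Hm; have /eqP := dm; rewrite (eqP (dt : d - t == 0)) mdeg_eq0 => /eqP m0.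
    by rewrite m0 mnm0E in mz.
rewrite /up (_ : in_powers _ _ _ = true) //; apply/hasP; exists x; first exact: mem_head.
by rewrite addUE eqxx mul1n (mon_x Hm) add0n leqNgt te.
Qed.

Lemma growth_step : (forall D, growth_bound D) ->
  forall W L, contains_powers (x :: s) d E W -> stable (x :: s) d E W ->
  lexp (x :: s) d E L -> size_in (x :: s) d W = size_in (x :: s) d L ->
  size_in (x :: s) d.+1 (up (x :: s) E L) <= size_in (x :: s) d.+1 (up (x :: s) E W).
Proof.
move=> IH W L PW SW LL sz; have SV := lexsec_last_stable IH PW SW.
have SW' := last_stable_of SW; have SL := lexp_last_stable LL; have [PL _] := LL.
have PV := lexsec_powers W; have szV := size_lexsec PW.
have [c0 ce] := compare_sections PV SV (fun t td te => lexsec_lexp W td te) LL (etrans szV sz).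
apply: (@leq_trans (size_in (x :: s) d.+1 (up (x :: s) E (lexsec W)))); rewrite !size_up //.
  apply: leq_add.
    apply: size_in_mono => //; apply: up_mono => m Hm; rewrite -[d]subn0 in Hm.
    apply: c0; first exact: mon_addU.
    by rewrite (addU_x Hm).
  (* Adding the common total size on both sides cancels the sections below [E x - 1]; what remains
     is section [E x - 1], where [ce] applies, and the full sections above it. *)
  rewrite -(leq_add2r (size_in (x :: s) d (lexsec W))) {2}szV sz !size_sec -!big_split /=.
  apply: leq_sum => t _; have td : t <= d by rewrite -ltnS.
  case: (ltngtP t.+1 (E x)) => [te|te|te]; first by rewrite addnC.
    rewrite leq_add2l; apply: size_in_mono => // m Hm _; exact: sec_full.
  rewrite leq_add2l; apply: size_in_mono => // m Hm; apply: ce; first exact: mon_addU.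
  by rewrite (addU_x Hm).
apply: leq_add; last first.
  by apply: leq_sum => t _; case: ifP => // _; rewrite size_lexsec_sec // -ltnS.
rewrite -[d]subn0; have Pt := sec_powers (leq0n d) PW.
have := IH _ _ _ Pt (stable_sec (leq0n d) SW) (lexify_lexp _ E _ us') (esym (size_lexify us' Pt)).
apply: leq_trans; apply: size_in_mono => //; apply: up_mono => m Hm.
by rewrite sec_lexsec.
Qed.

Section CycleSlices.
Variables (k : fieldType) (p : nat).
Local Notation X := [set i in s].

(** A face through [x] uses one factor [x], so after removing [x] it has one vertex less and its
    coefficient lies in section [t - 1]. *)
Definition link_slice W t R : {set {set 'I_n}} :=
  if t is t'.+1 then if p is p'.+1 then facets p' (sec x t' W) R else set0 else set0.

Definition slice W t :=
  \sum_(R <- mons s (d + p - t)) rcyc k X (facets p (sec x t W) R) (link_slice W t R).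

Definition slice_size W t := \sum_(R <- mons s (d + p - t)) #|facets p (sec x t W) R|.

Lemma sub_mset_addU F R t : x \notin F ->
  (R + U_(x) *+ t - mset F)%MM = (R - mset F + U_(x) *+ t)%MM.
Proof.
move=> xF; apply/mnmP => i; rewrite !(mnmDE, mnmBE, mulmnE, mnm1E, msetE).
by case: (eqVneq x i) => [<-|_]; rewrite ?(negbTE xF) ?subn0 // !mul0n !addn0.
Qed.

Lemma divides_addU F R t : x \notin F -> divides F (R + U_(x) *+ t)%MM = divides F R.
Proof.
move=> xF; apply: eq_forallb_in => i iF; rewrite addUE.
have -> : x == i = false by apply: contraNF xF => /eqP ->.
by rewrite addn0.
Qed.

Lemma divides_notin F R : R x = 0 -> divides F R -> x \notin F.
Proof. by move=> Rx /dividesP FR; apply/negP => /FR; rewrite Rx. Qed.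

Lemma del_slice W t R : R x = 0 -> del x (facets p W (R + U_(x) *+ t)%MM) = facets p (sec x t W) R.
Proof.
move=> Rx; apply/setP => F; rewrite !inE; case: (boolP (x \in F)) => xF.
  rewrite andbF; apply/esym/and3P => -[_ /(divides_notin Rx)]; by rewrite xF.
by rewrite andbT divides_addU // sub_mset_addU.
Qed.

Lemma link_sliceE W t R : R x = 0 -> link x (facets p W (R + U_(x) *+ t)%MM) = link_slice W t R.
Proof.
move=> Rx; apply/setP => F; rewrite !inE; case: (boolP (x \in F)) => xF /=.
  apply/esym; rewrite /link_slice; case: t => [|t]; rewrite ?inE //; case: (p) => [|p'].
    by rewrite inE.
  by rewrite inE; apply/and3P => -[_ /(divides_notin Rx)]; rewrite xF.
rewrite cardsU1 xF dividesU1 divides_addU // sub_mset_U1 // addUE Rx eqxx add0n mul1n.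
rewrite /link_slice; case: t => [|t]; rewrite ?inE ?andbF //=.
case: (p) => [|p']; rewrite ?inE // add1n eqSS.
rewrite (_ : (R + U_(x) *+ t.+1 - U_(x) - mset F)%MM = (R - mset F + U_(x) *+ t)%MM) //.
apply/mnmP => i; rewrite !(mnmDE, mnmBE, mulmnE, mnm1E, msetE).
case: (eqVneq x i) => [<-|_]; last by rewrite !mul0n !addn0 subn0.
by rewrite Rx !mul1n (negbTE xF) !add0n subn0 subn1.
Qed.

Lemma cycles_slices W : cycles k (x :: s) p (d + p) W = \sum_(t < (d + p).+1) slice W t.
Proof.
rewrite /cycles sum_mons_cons; apply: eq_bigr => t _; rewrite /slice !big_seq; apply: eq_bigr => R.
rewrite mem_mons // => HR; have Rx := mon_x HR.
have -> : [set i in x :: s] = x |: X by apply/setP => i; rewrite !inE.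
by rewrite rcyc_split ?inE // del_slice // link_sliceE.
Qed.

Lemma mon_facet t q F R : t <= d + q -> mon s (d + q - t) R -> #|F| = q -> divides F R ->
  t <= d /\ mon s (d - t) (R - mset F)%MM.
Proof.
move=> tdq HR cF FR; have := divides_card FR; have /monP[-> _] := HR; rewrite cF => le.
have td : t <= d by move: le tdq; clear; lia.
by split=> //; have := mon_sub_mset HR FR cF; rewrite subnAC addnK.
Qed.

Lemma slice_le_size W t : slice W t <= slice_size W t.
Proof. by apply: leq_sum => R _; apply: rcyc_card. Qed.

Lemma slice0 W : slice W 0 = cycles k s p (d + p) (sec x 0 W).
Proof. by rewrite /slice subn0. Qed.

(** Deleting a vertex [y] from a face, on the side of the link, replaces one [x] by [y] in the full
    monomial. By stability every boundary face is allowed, so every chain counts. *)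
Lemma slice_eq_size W t : last_stable W -> 0 < t -> t < E x -> t <= d + p ->
  slice W t = slice_size W t.
Proof.
move=> SW t0 te tdp; rewrite /slice /slice_size !big_seq; apply: eq_bigr => R.
rewrite mem_mons // => HR; apply: rcyc_eq_card => y F; rewrite inE => ys yF.
rewrite inE cardsU1 yF dividesU1 => /and3P[/eqP cF /andP[Ry FR] WF].
have cyF : #|y |: F| = p by rewrite cardsU1 yF.
have DyF : divides (y |: F) R by rewrite dividesU1 Ry.
have [td HRF] := mon_facet tdp HR cyF DyF.
case: t t0 te tdp HR td HRF WF => // t _ te tdp HR td HRF WF.
rewrite /link_slice; move: cF; case: (p) => // p'; rewrite add1n => -[cF].
rewrite inE cF eqxx FR /=.
have := SW y _ ys (mon_addU x td HRF) WF; rewrite (addU_x HRF) => /(_ isT te).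
congr (is_true (W _)); apply/mnmP => i; rewrite !(mnmDE, mnmBE, mulmnE, mnm1E, msetE) !inE.
have xy : x == y = false by apply: contraNF xs => /eqP ->.
case: (eqVneq x i) => [<-|xi].
  by rewrite [y == x]eq_sym xy !mul1n addn0 (mon_x HR) !sub0n !add0n subn1.
rewrite !mul0n !addn0 subn0; case: (eqVneq i y) => [->|iy].
  by rewrite (negbTE yF) /= subn0 subn1 addn1 prednK.
by rewrite /= addn0.
Qed.

Lemma facets_full W t R : contains_powers (x :: s) d E W -> E x <= t -> t <= d + p ->
  mon s (d + p - t) R -> facets p (sec x t W) R = facets p (fun=> true) R.
Proof.
move=> PW te tdp HR; apply/setP => F; rewrite !inE; case: eqP => //= cF.
case: (boolP (divides F R)) => //= FR; have [td HRF] := mon_facet tdp HR cF FR.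
exact: sec_full.
Qed.

Lemma link_slice_sub W V t R : t < d + p -> mon s (d + p - t.+1) R ->
  (forall m, t <= d -> mon s (d - t) m -> sec x t W m -> sec x t V m) ->
  link_slice W t.+1 R \subset link_slice V t.+1 R.
Proof.
rewrite /link_slice; case: (p) => [|p'] tdp HR WV //.
apply/subsetP => F; rewrite !inE => /and3P[cF FR WF]; rewrite cF FR /=.
have HR' : mon s (d + p' - t) R by move: HR; rewrite addnS subSS.
have tdp' : t <= d + p' by rewrite addnS ltnS in tdp.
have [td HRF] := mon_facet tdp' HR' (eqP cF) FR.
exact: WV.
Qed.

Lemma slice_size_full W V t : contains_powers (x :: s) d E W -> contains_powers (x :: s) d E V ->
  E x <= t -> t <= d + p -> slice_size W t = slice_size V t.
Proof.
move=> PW PV te tdp; rewrite /slice_size !big_seq; apply: eq_bigr => R.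
by rewrite mem_mons // => HR; rewrite !facets_full.
Qed.

Lemma slice_full_le W V t : contains_powers (x :: s) d E W -> contains_powers (x :: s) d E V ->
  E x <= t.+1 -> t < d + p ->
  (forall m, t <= d -> mon s (d - t) m -> sec x t W m -> sec x t V m) ->
  slice W t.+1 <= slice V t.+1.
Proof.
move=> PW PV te tdp WV; rewrite /slice !big_seq; apply: leq_sum => R.
rewrite mem_mons // => HR; rewrite !facets_full //; apply: rcyc_mono => //.
exact: link_slice_sub.
Qed.

End CycleSlices.

(** Each pair of a face [F] and a monomial [m] of [W] occurs exactly once, in multidegree
    [m + mset F]. *)
Lemma facets_count p D W : \sum_(R <- mons s (D + p)) #|facets p W R|
  = #|full [set i in s] p| * size_in s D W.
Proof.
pose P F R : nat := divides F R && W (R - mset F)%MM.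
have cE R : R \in mons s (D + p) -> #|facets p W R| = \sum_(F in full [set i in s] p) P F R.
  rewrite mem_mons // => /monP[_ sR]; rewrite -sum1_card [LHS]big_mkcond [RHS]big_mkcond /=.
  apply: eq_bigr => F _; rewrite !inE /P; case: eqP => cF; rewrite ?andbF //= andbT.
  case: (boolP (divides F R)) => [/dividesP FR|]; rewrite ?if_same //=.
  have -> : F \subset [set i in s].
    by apply/subsetP => i /FR; rewrite inE; apply: contraLR => /sR ->.
  by case: (W _).
rewrite big_seq (eq_bigr _ cE) -big_seq exchange_big /= -sum_nat_const; apply: eq_bigr => F.
rewrite inE => /andP[FX /eqP cF].
have FK m : (m + mset F - mset F)%MM = m by apply/mnmP => i; rewrite mnmBE mnmDE addnK.
rewrite /size_in.
transitivity (\sum_(R <- [seq (m + mset F)%MM | m <- mons s D]) (W (R - mset F)%MM : nat)); last first.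
  by rewrite big_map; apply: eq_bigr => m _; rewrite FK.
have pe : perm_eq [seq (m + mset F)%MM | m <- mons s D] [seq R <- mons s (D + p) | divides F R].
  apply: uniq_perm.
  - by rewrite map_inj_uniq ?uniq_mons // => a b /(congr1 (fun m => m - mset F)%MM); rewrite !FK.
  - by rewrite filter_uniq // uniq_mons.
  move=> R; rewrite mem_filter mem_mons //; apply/mapP/andP => [[m]|[FR HR]].
    rewrite mem_mons // => /monP[dm sm] ->; split.
      by apply/dividesP => i iF; rewrite mnmDE msetE iF addn1.
    apply/monP; split; first by rewrite mdegD dm mdeg_mset cF.
    move=> i iS; rewrite mnmDE sm // msetE; case: (boolP (i \in F)) => // /(subsetP FX).
    by rewrite inE (negbTE iS).
  exists (R - mset F)%MM; first by rewrite mem_mons //; have := mon_sub_mset HR FR cF; rewrite addnK.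
  apply/mnmP => i; rewrite mnmDE mnmBE msetE; case: (boolP (i \in F)) => [/(dividesP _ _ FR)|_].
    by move=> Ri; rewrite subnK.
  by rewrite subn0 addn0.
rewrite (perm_big _ pe) big_filter [RHS]big_mkcond /=; apply: eq_bigr => R _.
by rewrite /P; case: (divides F R).
Qed.

Lemma sum_slice_size p W : \sum_(t < (d + p).+1) slice_size p W t
  = #|full [set i in s] p| * size_in (x :: s) d W.
Proof.
rewrite size_sec big_distrr /= -addSn big_split_ord /= [X in _ + X]big1 ?addn0 => [|i _].
  apply: eq_bigr => t _; rewrite -facets_count /slice_size addnBAC //.
  by rewrite -ltnS.
rewrite /slice_size big_seq big1 // => R; rewrite mem_mons // => HR.
apply/eqP; rewrite cards_eq0; apply/eqP/setP => F; rewrite !inE; apply/and3P => -[/eqP cF FR _].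
have [] := mon_facet _ HR cF FR; last by move=> td; move: td; clear; lia.
by have := ltn_ord i; clear; lia.
Qed.

Lemma slice_size_eq p W V t : t <= d + p ->
  (t <= d -> size_in s (d - t) (sec x t W) = size_in s (d - t) (sec x t V)) ->
  slice_size p W t = slice_size p V t.
Proof.
move=> tdp sz; case: (leqP t d) => td.
  by rewrite /slice_size -!addnBAC // !facets_count sz.
rewrite /slice_size !big_seq; apply: eq_bigr => R; rewrite mem_mons // => HR.
apply: eq_card => F; rewrite !inE; case: eqP => //= cF; case: (boolP (divides F R)) => //= FR.
by have [] := mon_facet tdp HR cF FR; rewrite leqNgt td.
Qed.

(** At the exponent [E x] the family is the full simplex on the support of [R], which is not empty
    because [t < d]. The cone argument splits off the cycles of section [t], to which induction
    applies. *)
Lemma slice_exact k p' W t : E x = t.+1 -> t < d -> contains_powers (x :: s) d E W ->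
  slice k p'.+1 W t.+1 =
  \sum_(R <- mons s (d - t + p')) rcyc k [set i in s] (full [set i | 0 < R i] p'.+1) set0
  + cycles k s p' (d - t + p') (sec x t W).
Proof.
move=> Et td PW; have dE : d + p'.+1 - t.+1 = d - t + p' by rewrite addnS subSS addnBAC // ltnW.
have tdp : t.+1 <= d + p'.+1 by rewrite (leq_trans td) // leq_addr.
rewrite /slice dE /cycles -big_split !big_seq; apply: eq_bigr => R; rewrite mem_mons // => HR /=.
rewrite facets_full ?Et ?dE //; have /monP[dR sR] := HR.
have -> : facets p'.+1 (fun=> true) R = full [set i | 0 < R i] p'.+1.
  apply/setP => F; rewrite !inE andbT andbC; congr (_ && _).
  by apply/dividesP/subsetP => H i /H; rewrite inE.
apply: rcyc_exact.
- by apply/subsetP => i; rewrite !inE; apply: contraLR => /sR ->.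
- apply/negP => /eqP R0; suff : mdeg R = 0 by rewrite dR => /eqP; rewrite addn_eq0 subn_eq0 leqNgt td.
  rewrite mdegE big1 // => i _; apply/eqP; rewrite -leqn0 leqNgt; apply/negP => Ri.
  by have := in_set0 i; rewrite -R0 inE Ri.
apply/subsetP => F; rewrite !inE => /and3P[-> /dividesP FR _]; rewrite andbT.
by apply/subsetP => i /FR; rewrite inE.
Qed.

(** [W] and [lexsec W] are compared slice by slice: induction serves the exponents 0 and [E x],
    stability those in between. Between [lexsec W] and [L] the total sizes of the slices agree, so
    each slice may be corrected by its size; the differences left at 0 and at [E x] are decided by
    [compare_sections]. *)
Lemma lex_max_step k : (forall D, growth_bound D) ->
  (forall p D A B, contains_powers s D E A -> lexp s D E B -> size_in s D A = size_in s D B ->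
     cycles k s p (D + p) A <= cycles k s p (D + p) B) ->
  forall p W L, contains_powers (x :: s) d E W -> stable (x :: s) d E W ->
  lexp (x :: s) d E L -> size_in (x :: s) d W = size_in (x :: s) d L ->
  cycles k (x :: s) p (d + p) W <= cycles k (x :: s) p (d + p) L.
Proof.
move=> grow IH p W L PW SW LL sz; have SV := lexsec_last_stable grow PW SW.
have SL := lexp_last_stable LL; have [PL _] := LL.
have PV := lexsec_powers W; have szV := size_lexsec PW.
have [c0 ce] := compare_sections PV SV (fun t td te => lexsec_lexp W td te) LL (etrans szV sz).
have IHsec q t : t <= d -> t < E x ->
    cycles k s q (d - t + q) (sec x t W) <= cycles k s q (d - t + q) (sec x t (lexsec W)).
  move=> td te; apply: IH; [exact: sec_powers | exact: lexsec_lexp |].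
  by rewrite size_lexsec_sec.
have secE (A B : mono -> bool) t : (forall m, mon (x :: s) d m -> m x = t -> A m -> B m) ->
    forall m, t <= d -> mon s (d - t) m -> sec x t A m -> sec x t B m.
  by move=> AB m td Hm; apply: AB; [exact: mon_addU | exact: addU_x].
have full_sec (A B : mono -> bool) t : E x <= t -> contains_powers (x :: s) d E B ->
    forall m, t <= d -> mon s (d - t) m -> sec x t A m -> sec x t B m.
  by move=> te PB m td Hm _; apply: sec_full.
apply: (@leq_trans (cycles k (x :: s) p (d + p) (lexsec W))); rewrite !cycles_slices.
  apply: leq_sum => -[t /= tlt] _; have tdp : t <= d + p := tlt.
  case: (posnP t) => [->|t0].
    by have := IHsec p 0 (leq0n d) Ex; rewrite subn0 !slice0.
  have szt : slice_size p W t = slice_size p (lexsec W) t.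
    by apply: slice_size_eq => // td; rewrite size_lexsec_sec.
  case: (ltngtP t (E x)) => te.
  - by rewrite [leqRHS]slice_eq_size // -szt slice_le_size.
  - case: t tlt t0 te tdp szt => // t' _ _ te tdp szt.
    by apply: slice_full_le => //; [exact: ltnW | exact: full_sec].
  case: t tlt t0 te tdp szt => // t' _ _ te tdp szt.
  move: tdp; clear szt; case: p => [|p'] tdp.
    rewrite /slice !big_seq; apply: leq_sum => R; rewrite mem_mons // => HR.
    have Ete : E x <= t'.+1 by rewrite te.
    by rewrite /= (facets_full PW Ete tdp HR) (facets_full PV Ete tdp HR).
  case: (ltnP t' d) => td.
    rewrite !slice_exact //; rewrite leq_add2l; apply: IHsec; first exact: ltnW.
    by rewrite -te.
  apply: leq_trans (slice_le_size _ _ _ _) _.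
  rewrite (@leq_trans 0) // leqn0; apply/eqP; rewrite /slice_size big_seq big1 // => R.
  rewrite mem_mons // => HR; apply/eqP; rewrite cards_eq0; apply/eqP/setP => F; rewrite !inE.
  by apply/and3P => -[/eqP cF FR _]; have [] := mon_facet tdp HR cF FR; rewrite ltnNge td.
have szz : \sum_(t < (d + p).+1) slice_size p (lexsec W) t = \sum_(t < (d + p).+1) slice_size p L t.
  by rewrite !sum_slice_size szV sz.
rewrite -(leq_add2r (\sum_(t < (d + p).+1) slice_size p L t)) -{2}szz -!big_split /=.
apply: leq_sum => -[t /= tlt] _; have tdp : t <= d + p := tlt.
case: (posnP t) => [->|t0].
  rewrite /slice /slice_size -!big_split /= !big_seq; apply: leq_sum => R; rewrite mem_mons // => HR.
  apply: rcyc_lipschitz; apply/subsetP => F; rewrite !inE => /and3P[cF FR LF].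
  have [_ HRF] := mon_facet (leq0n (d + p)) HR (eqP cF) FR; rewrite cF FR /=.
  by apply: (secE L) LF => // m Hm m0; apply: c0.
case: (ltngtP t (E x)) => te.
- by rewrite !slice_eq_size // addnC.
- rewrite (slice_size_full PV PL (ltnW te) tdp) leq_add2r.
  case: t tlt t0 te tdp => // t' _ _ te tdp.
  by apply: slice_full_le => //; [exact: ltnW | exact: full_sec].
rewrite (slice_size_full PV PL _ tdp) ?te // leq_add2r -te.
case: t tlt t0 te tdp => // t' _ _ te tdp.
apply: slice_full_le => //; first by rewrite te.
by apply: (secE (lexsec W) L) => m Hm mt; apply: ce => //; rewrite mt.
Qed.

End Step.
Definition decreasing s := pairwise (fun x y => y < x) s.

Lemma decreasing_uniq s : decreasing s -> uniq s.
Proof. by apply: pairwise_uniq => x; rewrite ltnn. Qed.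

Lemma decreasing_cons x s : decreasing (x :: s) ->
  [/\ uniq (x :: s), (forall y, y \in s -> y < x) & decreasing s].
Proof.
move=> H; have us := decreasing_uniq H; move: H; rewrite /decreasing /= => /andP[/allP ? ?].
by split.
Qed.

Lemma growth s E d W L : decreasing s -> (forall x, x \in s -> 0 < E x) ->
  contains_powers s d E W -> stable s d E W -> lexp s d E L -> size_in s d W = size_in s d L ->
  size_in s d.+1 (up s E L) <= size_in s d.+1 (up s E W).
Proof.
elim: s d W L => [|x s IH] d W L ds E0; first by rewrite /size_in big_nil.
have [us xmax ds'] := decreasing_cons ds.
apply: (growth_step us xmax); first by apply: E0; rewrite mem_head.
move=> D A B PA SA LB szAB; apply: IH => // y ys; by apply: E0; rewrite inE ys orbT.
Qed.

Theorem lex_max (k : fieldType) s E p d W L : decreasing s ->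
  (forall x, x \in s -> 0 < E x) -> (forall x y, x \in s -> y \in s -> y < x -> E y <= E x) ->
  contains_powers s d E W -> lexp s d E L -> size_in s d W = size_in s d L ->
  cycles k s p (d + p) W <= cycles k s p (d + p) L.
Proof.
elim: s p d W L => [|x s IH] p d W L ds E0 Em PW LL sz.
  case: d PW LL sz => [|d] _ _ sz; last by rewrite /cycles big_nil.
  rewrite (@eq_cycles _ k [::] 0 p W L) // => m /monP[dm sm].
  have -> : m = 0%MM by apply/mnmP => i; rewrite sm // mnm0E.
  by move: sz; rewrite /size_in !big_seq1; case: (W _); case: (L _).
have us := decreasing_uniq ds.
have [W' [sz' le PW' SW']] := exists_stable k p us E0 Em PW.
apply: leq_trans le _.
have [_ xmax ds'] := decreasing_cons ds.
have E0' y : y \in s -> 0 < E y by move=> ys; apply: E0; rewrite inE ys orbT.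
apply: (lex_max_step us xmax) PW' SW' LL (etrans sz' sz).
- by apply: E0; rewrite mem_head.
- by move=> D A B; apply: growth.
move=> q D A B; apply: IH => // a b sa sb; apply: Em; by rewrite inE ?sa ?sb orbT.
Qed.

End Slices.

(** * Coprime monomials *)

Section Coprime.
Variable n : nat.
Local Open Scope nat_scope.
Local Notation mono := 'X_{1..n}.
Implicit Types (x y z : 'I_n) (s : seq 'I_n) (m g : mono) (W : mono -> bool) (E : 'I_n -> nat).

Definition contains_multiples s d g W :=
  forall m, mon s d m -> (forall z, g z <= m z) -> W m.

Lemma mon_le s d m x y : mon s d m -> x != y -> m x + m y <= d.
Proof.
move=> /monP[<- _] xy; rewrite mdegE (bigD1 x) //= (bigD1 y) 1?eq_sym //=.
by rewrite addnA leq_addr.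
Qed.

(** The exponent [d.+1] compresses whole lines. On the line of [m] the multiples of [g] run from
    exponent [g x] of [x] up to [m x + m y - g y]; there are more than [m x] of them as soon as
    [g x + g y <= m y]. So the factors of [g] in [x] and [y] merge into a power of [y]. *)
Lemma compress_merge s d x y g W : x \in s -> y \in s -> x != y ->
  contains_multiples s d g W ->
  contains_multiples s d (onto x y (base x y g) 0 (g x + g y)) (compress y x d.+1 W).
Proof.
move=> xs ys xy gW m Hm gm; have mxy := mon_le Hm xy.
have my : g x + g y <= m y.
  have := gm y; by rewrite ontoE mnmE eqxx orbT (negbTE xy) mul0n mul1n !add0n.
rewrite /compress ltnNge (leq_trans _ mxy) ?leq_addr //=.
have gz z : z != x -> z != y -> g z <= m z.
  move=> zx zy; have := gm z; rewrite ontoE mnmE (negbTE zx) (negbTE zy).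
  by rewrite ![_ == z]eq_sym (negbTE zx) (negbTE zy) !mul0n !addn0.
have := @count_lt (line x y (base x y m) (m x + m y) W) 0 (g x) (m x + m y - g y).+1 d.+1.
rewrite add0n => cl; suff cl' : (m x + m y - g y).+1 <=
    \sum_(l < d.+1) (line x y (base x y m) (m x + m y) W l : nat) + g x.
  by rewrite -(ltn_add2r (g x)) (leq_trans _ cl') //; move: my; clear; lia.
apply: cl => //.
- by move: my; clear; lia.
- by rewrite ltnS (leq_trans (leq_subr _ _)).
move=> l gl; rewrite ltnS => lg.
have lmu : l <= m x + m y by rewrite (leq_trans lg) // leq_subr.
rewrite /line lmu /=; apply: gW => [|z]; first by apply: mon_onto; rewrite // subnKC.
rewrite ontoE mnmE; have [->|zx] := eqVneq z x.
  by rewrite /= [y == x]eq_sym (negbTE xy) mul1n mul0n addn0.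
have [->|zy] := eqVneq z y.
  rewrite /= mul0n mul1n !add0n leq_subRL //.
  by move: my lg; clear; lia.
by rewrite /= !mul0n !addn0; apply: gz.
Qed.

Lemma compress_swap s d x y E W : x \in s -> y \in s -> y < x -> E x < E y ->
  contains_powers s d E W ->
  contains_powers s d (E \o tperm x y) (compress y x (E y) W).
Proof.
move=> xs ys yx Exy PW z m zs Hm Ez.
have xy : x != y by rewrite gt_ordF.
have [zx|zx] := eqVneq z x.
  rewrite zx /= tpermL in Ez; rewrite /compress Ez; apply: (PW x) => //.
  by rewrite (leq_trans (ltnW Exy)).
have [zy|zy] := eqVneq z y; last first.
  rewrite /= tpermD 1?eq_sym // in Ez; apply: compress_mem => [_|l lm]; first exact: (PW z).
  have lE : l + (m x + m y - l) = m x + m y by rewrite subnKC // (leq_trans lm) // leq_addr.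
  apply: (PW z) => //; first exact: mon_onto.
  by rewrite ontoE mnmE (negbTE zx) (negbTE zy) (leq_trans Ez) // -addnA leq_addr.
rewrite zy /= tpermR in Ez; rewrite /compress; case: (leqP (E y) (m x)) => [le|lt].
  by apply: (PW x) => //; rewrite (leq_trans (ltnW Exy)).
pose mu := m x + m y; rewrite -/mu.
have lineP l : l <= mu -> (E x <= l) || (E y <= mu - l) -> line x y (base x y m) mu W l.
  move=> lmu Hl; rewrite /line lmu /=.
  have Ho : mon s d (onto x y (base x y m) l (mu - l)) by apply: mon_onto; rewrite // subnKC.
  case/orP: Hl => Hl; [apply: (PW x) | apply: (PW y)] => //; rewrite ontoE mnmE eqxx ?orbT /=.
    by rewrite mul1n add0n (leq_trans Hl) // leq_addr.
  by rewrite (negbTE xy) mul1n.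
have [muE|muE] := ltnP mu (E y).
  have := @count_lt (line x y (base x y m) mu W) 0 (E x) mu.+1 (E y).
  move=> cl; suff cl' : 0 + mu.+1 <= \sum_(l < E y) (line x y (base x y m) mu W l : nat) + E x.
    by rewrite -(ltn_add2r (E x)) (leq_trans _ cl') //; move: Ez; rewrite /mu; clear; lia.
  apply: cl => //; first by move: Ez; rewrite /mu; clear; lia.
  by move=> l Hl; rewrite ltnS => lmu; apply: lineP; rewrite // Hl.
(* The points with exponent of [y] at least [E y] may reach past [E x]; the [minn] keeps the two
   stretches disjoint. *)
have := @count_lt (line x y (base x y m) mu W) (minn (mu - E y).+1 (E x)) (E x) (E y) (E y).
move=> cl; suff cl' : minn (mu - E y).+1 (E x) + E y <= \sum_(l < E y) (line x y (base x y m) mu W l : nat) + E x.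
  by rewrite -(ltn_add2r (E x)) (leq_trans _ cl') //; move: Ez lt muE Exy; rewrite /mu; clear; lia.
apply: cl => //; first exact: geq_minr; first exact: ltnW.
  by move=> l Hl; apply: lineP; move: Hl muE Exy; clear; lia.
by move=> l H1 H2; apply: lineP; rewrite ?H1 // (leq_trans (ltnW H2)).
Qed.

Lemma sum_pair_lt (F G : 'I_n -> nat) x y : x != y -> F x + F y < G x + G y ->
  (forall z, z != x -> z != y -> F z = G z) -> \sum_z F z < \sum_z G z.
Proof.
move=> xy lt FG; rewrite (bigD1 x) // (bigD1 y) 1?eq_sym //= [X in _ < X](bigD1 x) //.
rewrite [X in _ < _ + X](bigD1 y) 1?eq_sym //= !addnA -addSn leq_add //.
by apply: leq_sum => z /andP[zx zy]; rewrite FG.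
Qed.

Lemma exists_swap (k : fieldType) s E p d W : uniq s -> (forall x, x \in s) ->
  contains_powers s d E W -> exists E' W',
  [/\ size_in s d W' = size_in s d W, cycles k s p (d + p) W <= cycles k s p (d + p) W',
    contains_powers s d E' W', perm_eq (map E' (enum 'I_n)) (map E (enum 'I_n))
    & forall x y, y < x -> E' y <= E' x].
Proof.
(* The weights [n - x] fall with [x], so moving a smaller exponent to a smaller index lowers
   [Phi]. *)
move=> us sT; pose Phi E0 := \sum_(x < n) (n - x) * E0 x.
elim: {E}_.+1 {-2}E (ltnSn (Phi E)) W => // N IH E EN W PW.
have [/forallP ok|] := boolP [forall x : 'I_n, [forall y : 'I_n, (y < x) ==> (E y <= E x)]].
  exists E, W; split=> // x y yx; have /forallP/(_ y) := ok x; by rewrite yx.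
rewrite negb_forall => /existsP[x]; rewrite negb_forall => /existsP[y].
rewrite negb_imply -ltnNge => /andP[yx Exy].
have xy : x != y by rewrite gt_ordF.
have PW' := compress_swap (sT x) (sT y) yx Exy PW.
have lt : Phi (E \o tperm x y) < Phi E.
  apply: (sum_pair_lt xy) => /= [|z zx zy]; last by rewrite tpermD // eq_sym.
  have K (a b u v : nat) : a < b -> u < v -> a * v + b * u < a * u + b * v by clear; nia.
  by rewrite tpermL tpermR; apply: K => //; apply: ltn_sub2l.
have [E' [W' [sz le PE' pE' mE']]] := IH _ (leq_trans lt EN) _ PW'.
exists E', W'; split=> //.
- by rewrite sz size_in_compress_in.
- apply: leq_trans le; apply: cycles_compress_in => //; first exact: leq_ltn_trans Exy.
    by move=> m Hm le; apply: (PW x) => //; apply: leq_trans le; apply: ltnW.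
  by move=> m Hm le; apply: (PW y).
apply: (perm_trans pE'); rewrite (map_comp E); apply: perm_map; apply: uniq_perm.
- by rewrite map_inj_uniq ?enum_uniq //; apply: perm_inj.
- exact: enum_uniq.
move=> z; rewrite mem_enum; apply/mapP; exists (tperm x y z); rewrite ?mem_enum //.
by rewrite tpermK.
Qed.

Lemma perm_powers r (sigma : 'I_r -> 'I_n) E (g : 'I_r -> nat) c : injective sigma ->
  (forall i, E (sigma i) = g i) -> (forall x, x \notin codom sigma -> E x = c) ->
  perm_eq (map E (enum 'I_n)) (map g (enum 'I_r) ++ nseq (n - r) c).
Proof.
move=> inj Eg Ec; pose rest := [seq x <- enum 'I_n | x \notin codom sigma].
have pe : perm_eq (enum 'I_n) (map sigma (enum 'I_r) ++ rest).
  apply: uniq_perm; first exact: enum_uniq.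
    rewrite cat_uniq map_inj_uniq ?enum_uniq // filter_uniq ?enum_uniq // andbT /=.
    by apply/hasPn => x; rewrite mem_filter => /andP[].
  move=> x; have xT : x \in enum 'I_n by rewrite mem_enum.
  rewrite xT mem_cat [x \in rest]mem_filter xT andbT.
  suff -> : (x \in map sigma (enum 'I_r)) = (x \in codom sigma) by case: (x \in _).
  by apply/mapP/codomP => -[i]; [move=> _ -> | move=> ->]; exists i; rewrite ?mem_enum.
have szr : size rest = n - r.
  have : size (enum 'I_n) = size (map sigma (enum 'I_r)) + size rest.
    by rewrite -size_cat; apply: perm_size.
  rewrite (size_map sigma) -!cardT !card_ord => e.
  have rn : r <= n by rewrite e leq_addr.
  by apply/eqP; rewrite -(eqn_add2l r) -e subnKC.
apply: (perm_trans (perm_map E pe)); rewrite map_cat -map_comp.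
rewrite (eq_map (Eg : E \o sigma =1 g)); rewrite (_ : map E rest = nseq (n - r) c) //.
rewrite -szr (_ : map E rest = map (fun=> c) rest); first by elim: (rest) => //= x l ->.
by apply/eq_in_map => x; rewrite mem_filter => /andP[/Ec].
Qed.

(** Merging two variables of one [f i] shrinks its support, and the other monomials avoid both
    variables, so they do not change. Once every support is a single variable, coprimality makes the
    choice of variables injective. *)
Lemma exists_merge (k : fieldType) r s p d W (f : 'I_r -> mono) : uniq s -> (forall x, x \in s) ->
  (forall i, 0 < mdeg (f i)) -> (forall i j x, i != j -> 0 < f i x -> f j x = 0) ->
  (forall i, contains_multiples s d (f i) W) -> exists W' (sigma : 'I_r -> 'I_n),
  [/\ size_in s d W' = size_in s d W, cycles k s p (d + p) W <= cycles k s p (d + p) W',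
    injective sigma & forall i m, mon s d m -> mdeg (f i) <= m (sigma i) -> W' m].
Proof.
move=> us sT; pose supp_size (f : 'I_r -> mono) := \sum_i \sum_z (0 < f i z : nat).
elim: {f}_.+1 {-2}f (ltnSn (supp_size f)) W => // N IH f fN W f0 cop fW.
have [/forallP none|] := boolP [forall i, [forall x : 'I_n, [forall y : 'I_n,
    ~~ [&& x != y, 0 < f i x & 0 < f i y]]]].
  have /fin_all_exists[sigma sP] i : exists x, 0 < f i x.
    apply/existsP; rewrite -[[exists _, _]]negbK negb_exists; apply/negP => /forallP H.
    have := f0 i; rewrite mdegE big1 // => x _; apply/eqP; by rewrite -leqn0 leqNgt.
  exists W, sigma; split=> //.
    move=> i j sij; apply/eqP; apply: contraT => ij; have := sP j.
    by rewrite -sij (cop i j).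
  move=> i m Hm le; apply: (fW i) => // z.
  have fz x : x != sigma i -> f i x = 0.
    move=> xi; apply/eqP; rewrite -leqn0 leqNgt; apply/negP => fx.
    by have /forallP/(_ x)/forallP/(_ (sigma i)) := none i; rewrite xi fx sP.
  have [->|/fz -> //] := eqVneq z (sigma i); apply: leq_trans le.
  by rewrite mdegE (bigD1 (sigma i)) //= leq_addr.
rewrite negb_forall => /existsP[i]; rewrite negb_forall => /existsP[x].
rewrite negb_forall => /existsP[y]; rewrite negbK => /and3P[xy fx fy].
pose f' j := onto x y (base x y (f j)) 0 (f j x + f j y).
have others j : j != i -> f j x = 0 /\ f j y = 0.
  by move=> ji; split; apply: (cop i); rewrite 1?eq_sym.
have f'x j : f' j x = 0 by rewrite ontoE mnmE eqxx [y == x]eq_sym (negbTE xy) muln0.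
have f'y j : f' j y = f j x + f j y by rewrite ontoE mnmE eqxx orbT (negbTE xy) mul1n.
have f'z j z : z != x -> z != y -> f' j z = f j z.
  move=> zx zy; rewrite ontoE mnmE (negbTE zx) (negbTE zy).
  by rewrite ![_ == z]eq_sym (negbTE zx) (negbTE zy) !mul0n !addn0.
have df' j : mdeg (f' j) = mdeg (f j).
  by rewrite -[in RHS](onto_base (f j) xy) !mdegDU addn0 addnA.
have le_ss j : \sum_z (0 < f' j z : nat) <= \sum_z (0 < f j z : nat).
  have [->|/others[jx jy]] := eqVneq j i.
    apply: ltnW; apply: (sum_pair_lt xy); first by rewrite f'x f'y fx fy addn_gt0 fx.
    by move=> z zx zy; rewrite f'z.
  apply: leq_sum => z _; have [->|zx] := eqVneq z x; first by rewrite f'x.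
  have [->|zy] := eqVneq z y; first by rewrite f'y jx jy.
  by rewrite f'z.
have lt : supp_size f' < supp_size f.
  rewrite /supp_size (bigD1 i) //= [X in _ < X](bigD1 i) //= -addSn leq_add //; last exact: leq_sum.
  apply: (sum_pair_lt xy); first by rewrite f'x f'y fx fy addn_gt0 fx.
  by move=> z zx zy; rewrite f'z.
have [|||W' [sigma [sz le inj HW']]] := IH f' (leq_trans lt fN) (compress y x d.+1 W).
- by move=> j; rewrite df'.
- move=> j1 j2 z j12; have [->|zx] := eqVneq z x; first by rewrite f'x.
  have [->|zy] := eqVneq z y; last by rewrite !f'z //; apply: cop.
  rewrite !f'y; have [j1i _|/others[-> ->] //] := eqVneq j1 i.
  by have [-> ->] : f j2 x = 0 /\ f j2 y = 0 by apply: others; rewrite -j1i eq_sym.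
- by move=> j; apply: compress_merge.
exists W', sigma; split=> //.
- by rewrite sz size_in_compress_in.
- have big m z : mon s d m -> d.+1 <= m z -> W m.
    by move=> /monP[<- _]; rewrite mdegE (bigD1 z) //= ltnNge leq_addr.
  by apply: leq_trans le; apply: cycles_compress_in => // m Hm; apply: big.
by move=> j m Hm; rewrite -df'; apply: HW'.
Qed.

Theorem cycles_coprime (k : fieldType) r (hr : r <= n) s p d E W L (f : 'I_r -> mono) :
  decreasing s -> (forall x, x \in s) -> (forall i, 0 < mdeg (f i)) ->
  (forall i j x, i != j -> 0 < f i x -> f j x = 0) ->
  (forall x y, y < x -> E y <= E x) ->
  (forall i, E (widen_ord hr i) = minn (mdeg (f i)) d.+1) -> (forall x, r <= x -> E x = d.+1) ->
  (forall i, contains_multiples s d (f i) W) -> lexp s d E L ->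
  size_in s d W = size_in s d L -> cycles k s p (d + p) W <= cycles k s p (d + p) L.
Proof.
move=> ds sT f0 cop Emono Ew Ebig fW LL sz; have us := decreasing_uniq ds.
have [W1 [sigma [sz1 le1 inj HW1]]] := exists_merge k p us sT f0 cop fW.
(* Variables that carry no power get the exponent [d.+1], which no monomial of degree d attains. *)
pose E1 x := if [pick i | sigma i == x] is Some i then minn (mdeg (f i)) d.+1 else d.+1.
have E1s i : E1 (sigma i) = minn (mdeg (f i)) d.+1.
  rewrite /E1; case: pickP => [j /eqP/inj -> //|/(_ i)]; by rewrite eqxx.
have E1c x : x \notin codom sigma -> E1 x = d.+1.
  rewrite /E1 => xs; case: pickP => // i /eqP ix; case/negP: xs; rewrite -ix; exact: codom_f.
have le_d m x : mon s d m -> m x <= d.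
  by move=> /monP[<- _]; rewrite mdegE (bigD1 x) //= leq_addr.
have PW1 : contains_powers s d E1 W1.
  move=> x m _ Hm; rewrite /E1; case: pickP => [i /eqP <-|_]; last by rewrite ltnNge le_d.
  by rewrite geq_min [d < _]ltnNge le_d // orbF; apply: HW1.
have [E2 [W2 [sz2 le2 PW2 pE2 mE2]]] := exists_swap k p us sT PW1.
have pe1 := perm_powers inj E1s E1c.
have winj : injective (widen_ord hr) by move=> i j /(congr1 val) /= /val_inj.
have pe : perm_eq (map E (enum 'I_n)) (map E2 (enum 'I_n)).
  rewrite perm_sym; apply: (perm_trans pE2); apply: (perm_trans pe1); rewrite perm_sym.
  apply: (perm_powers winj Ew) => x xs; apply: Ebig; rewrite leqNgt; apply: contra xs => xr.
  by apply/codomP; exists (Ordinal xr); apply: val_inj.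
have sorted_map (F : 'I_n -> nat) : (forall x y, y < x -> F y <= F x) -> sorted leq (map F (enum 'I_n)).
  move=> Fm; rewrite sorted_map; apply: (@sub_sorted _ (relpre val ltn)).
    by move=> x y /= xy; apply: Fm.
  by rewrite -sorted_map val_enum_ord iota_ltn_sorted.
(* Both exponent sequences are nondecreasing rearrangements of the same list, hence equal. *)
have EE x : E2 x = E x.
  have /eq_in_map := sorted_eq leq_trans anti_leq (sorted_map _ Emono) (sorted_map _ mE2) pe.
  by move=> ->; rewrite ?mem_enum.
apply: leq_trans le1 (leq_trans le2 _).
apply: (@lex_max _ k s E) => //.
- move=> x _; case: (ltnP x r) => [xr|/Ebig -> //].
  have -> : x = widen_ord hr (Ordinal xr) by apply: val_inj.
  by rewrite Ew leq_min f0.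
- by move=> x y _ _; apply: Emono.
- by move=> x m xs Hm; rewrite -EE; apply: PW2.
by rewrite sz2 sz1.
Qed.

End Coprime.

(** * Initial monomials *)

Section KoszulChains.
Variables (k : fieldType) (n : nat) (V : lmodType k) (mu : 'I_n -> V -> V).
Hypothesis mul : forall x, linear (mu x).
Implicit Types (U : V -> Prop) (c : {ffun {set 'I_n} -> V}).

Definition kchain U p c := forall F : {set 'I_n}, if #|F| == p then U (c F) else c F = 0.

Definition kcyc U p c := kchain U p c /\ bd mu [set: 'I_n] c = 0.

Lemma kchainE U p : kchain U p =
  (fun c => forall F : {set 'I_n}, if F \in [set F : {set 'I_n} | #|F| == p] then U (c F) else c F = 0).
Proof. by apply: pred_ext => c; split=> H F; have := H F; rewrite inE. Qed.

Lemma has_dim_kchain U p d : has_dim U d -> has_dim (kchain U p) ('C(n, p) * d).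
Proof.
move=> Ud; rewrite kchainE -[n in 'C(n, p)]card_ord.
rewrite -(card_draws 'I_n p); exact: has_dim_ffun.
Qed.

Lemma fin_kchain U p : fin U -> fin (kchain U p).
Proof. by case=> d /(has_dim_kchain p); exists ('C(n, p) * d)%N. Qed.

Lemma dim_kchain U p : fin U -> dim (kchain U p) = ('C(n, p) * dim U)%N.
Proof. by move=> /dimP /(has_dim_kchain p)/dimE. Qed.

Lemma subspace_kchain U p : subspace U -> subspace (kchain U p).
Proof.
move=> sU; split=> [F|a u v cu cv F]; rewrite !ffunE; first by case: ifP => // _; case: sU.
have := cu F; have := cv F; case: ifP => _; first by move=> ? ?; apply: sU.2.
by move=> -> ->; rewrite scaler0 addr0.
Qed.

Lemma fin_kcyc U p : fin U -> fin (kcyc U p).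
Proof. by move=> fU; apply: (fin_ker (bd_linear mul _)); apply: fin_kchain. Qed.

Lemma subspace_kcyc U p : subspace U -> subspace (kcyc U p).
Proof.
move=> sU; apply: subspaceI; first exact: subspace_kchain.
exact: (subspace_ker (bd_linear mul _)).
Qed.

End KoszulChains.

Section InitialMonomials.
Variables (k : fieldType) (n : nat).
Local Notation poly := {mpoly k[n]}.
Implicit Types (f g : poly) (I L : poly -> Prop) (F : {set 'I_n}) (m M : 'X_{1..n}).

Definition mulX (x : 'I_n) f : poly := 'X_x * f.

Lemma mulX_linear x : linear (mulX x).
Proof. by move=> a u v; rewrite /mulX mulrDr scalerAr. Qed.

Lemma mulXC x y f : mulX x (mulX y f) = mulX y (mulX x f).
Proof. by rewrite /mulX mulrCA. Qed.

Lemma mcoeff_mulX x f m : (mulX x f)@_m = if (0 < m x)%N then f@_(m - U_(x)) else 0.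
Proof.
rewrite /mulX; case: posnP => [m0|mx]; last first.
  have e : (U_(x) *+ 1)%MM = U_(x)%MM :> 'X_{1..n} by apply/mnmP => i; rewrite mulmnE muln1.
  by rewrite -{1}(submUK mx) e addmC mulrC mcoeffMX.
rewrite mcoeffM big1 // => -[a b] /= /eqP mE; rewrite mcoeffX; case: eqP => [e|_]; last by rewrite mul0r.
by have := congr1 (fun u : 'X_{1..n} => u x) mE; rewrite m0 mnmDE -e mnm1E eqxx.
Qed.

Lemma mcoeff_linear m : linear (mcoeff m : poly -> k^o).
Proof. by move=> a u v; rewrite mcoeffD mcoeffZ. Qed.

Definition piece I (d : int) : poly -> Prop := fun f => I f /\ homog_int d f.

Lemma subspace_homog (d : int) : subspace (homog_int d : poly -> Prop).
Proof.
split=> [m|a u v hu hv m]; first by rewrite msupp0.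
move=> /msuppD_le; rewrite mem_cat => /orP[/msuppZ_le/hu //|/hv //].
Qed.

Lemma ideal_subspace I : is_ideal I -> subspace I.
Proof.
case=> I0 ID IM; split=> // a u v Iu Iv; apply: ID => //.
by rewrite -mul_mpolyC; apply: IM.
Qed.

Lemma subspace_piece I d : subspace I -> subspace (piece I d).
Proof. by move=> sI; apply: subspaceI => //; apply: subspace_homog. Qed.

(** A boolean by excluded middle, because the combinatorial part counts members of boolean sets. *)
Definition initial I m : bool :=
  if excluded_middle_informative (exists f, [/\ piece I (mdeg m) f, f@_m != 0 &
    forall m', (m < m')%O -> f@_m' = 0]) then true else false.

Lemma initialP I m : reflect (exists f, [/\ piece I (mdeg m) f, f@_m != 0 &
    forall m', (m < m')%O -> f@_m' = 0]) (initial I m).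
Proof. by rewrite /initial; case: excluded_middle_informative => H; constructor. Qed.

(** In decreasing order, since the induction on variables slices by the head of the list, which must
    be the last variable. *)
Definition vars : seq 'I_n := rev (enum 'I_n).

Lemma mem_vars x : x \in vars.
Proof. by rewrite mem_rev mem_enum. Qed.

Lemma vars_decreasing : decreasing vars.
Proof.
rewrite /decreasing -sorted_pairwise; last by move=> a b c /= ba cb; apply: ltn_trans cb ba.
rewrite /vars rev_sorted.
have := iota_ltn_sorted 0 n; rewrite -val_enum_ord sorted_map; exact: sub_sorted.
Qed.

Lemma vars_uniq : uniq vars.
Proof. exact: decreasing_uniq vars_decreasing. Qed.

Lemma mon_vars d m : mon vars d m = (mdeg m == d).
Proof.
by apply/monP/eqP => [[]//|dm]; split=> // i; rewrite mem_vars.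
Qed.

Definition desc d : seq 'X_{1..n} := sort (fun u v => (v <= u)%O) (mons vars d).

Lemma mem_desc d m : (m \in desc d) = (mdeg m == d).
Proof. by rewrite mem_sort mem_mons ?vars_uniq // mon_vars. Qed.

Lemma desc_index d m m' : m \in desc d -> m' \in desc d ->
  (index m' (desc d) < index m (desc d))%N = (m < m')%O.
Proof.
move=> md m'd.
have tr : transitive (fun u v : 'X_{1..n} => (v <= u)%O).
  by move=> a b c ba ac; apply: Order.POrderTheory.le_trans ac ba.
have so : sorted (fun u v : 'X_{1..n} => (v <= u)%O) (desc d).
  by apply: sort_sorted => a b; apply: Order.TotalTheory.le_total.
apply/idP/idP => [lt|mm'].
  have := sorted_ltn_index tr so _ _ m'd md lt; rewrite Order.POrderTheory.le_eqVlt => /orP[/eqP e|//].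
  by move: lt; rewrite e ltnn.
rewrite ltnNge leq_eqVlt; apply/negP => /orP[/eqP e|lt].
  by move: mm'; rewrite -[m'](nth_index 0%MM m'd) -e nth_index // Order.POrderTheory.ltxx.
have := sorted_ltn_index tr so _ _ md m'd lt.
by rewrite Order.TotalTheory.leNgt mm'.
Qed.

Lemma homog_supp (d : nat) f m : homog_int d f -> f@_m != 0 -> mdeg m = d.
Proof. by rewrite -mcoeff_msupp => H /H []. Qed.

(** Filter by the vanishing of coefficients from the largest monomial down: the piece at [m] is the
    space of leading coefficients at [m], a line or zero. *)
Lemma dim_piece I d : subspace I -> fin (piece I d%:Z) -> dim (piece I d%:Z) = size_in vars d (initial I).
Proof.
move=> sI fI.
have ud : uniq (desc d) by rewrite sort_uniq uniq_mons // vars_uniq.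
rewrite (dim_filtration (f := fun m => mcoeff m : poly -> k^o) (s := desc d)) //; first last.
- move=> f [_ hf] H; apply/mpolyP => m; rewrite mcoeff0.
  have [//|fm] := eqVneq f@_m 0; apply: H; by rewrite mem_desc (homog_supp hf fm).
- by move=> m; apply: mcoeff_linear.
rewrite (perm_big _ (permEl (perm_sort _ _))) /= /size_in !big_seq; apply: eq_bigr => m.
rewrite mem_mons ?vars_uniq // mon_vars => /eqP dm.
have md : m \in desc d by rewrite mem_desc dm.
set U := img _ _; have sU : subspace U.
  apply: (subspace_img (mcoeff_linear m)); apply: subspaceI; first exact: subspace_piece.
  split=> [t _|a u v hu hv t ht]; first exact: mcoeff0.
  by rewrite mcoeffD mcoeffZ hu // hv // mulr0 addr0.
case: (initialP I m) => [[f [[If hf] fm fz]]|nin].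
  have Ua (a : k^o) : U a.
    rewrite -[a](mulfVK fm) -scaleoE; apply: (subspaceZ _ sU); exists f => //; split.
      by rewrite -dm.
    move=> m'; have [m'd|m'd] := boolP (m' \in desc d); first by rewrite desc_index // => /fz.
    by move=> _; apply/eqP; apply: contraR m'd => /(homog_supp hf); rewrite mem_desc -dm => ->.
  apply: dimE; exists (fun=> 1); split=> [a|c]; last first.
    by move=> e i; move: e; rewrite big_ord1 scaleoE mulr1 (ord1 i).
  split=> // _; exists (fun=> a); by rewrite big_ord1 scaleoE mulr1.
apply: dim0 => a; split=> [[f [[If hf] H] ->]|->]; last by case: sU.
have [//|fm] := eqVneq f@_m 0; case: nin; exists f; split=> //; first by rewrite dm.
move=> m' mm'; have [//|fm'] := eqVneq f@_m' 0.
have m'd : m' \in desc d by rewrite mem_desc (homog_supp hf fm').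
by apply: H; rewrite desc_index.
Qed.

Local Notation chains := {ffun {set 'I_n} -> poly}.
Implicit Types c : chains.

(* The component of multidegree M. *)
Definition proj M c : {ffun {set 'I_n} -> k^o} :=
  [ffun F : {set 'I_n} => if divides F M then (c F)@_(M - mset F) else 0].

Lemma proj_linear M : linear (proj M).
Proof.
move=> a u v; apply/ffunP => F; rewrite !ffunE; case: ifP => _; last by rewrite scaler0 addr0.
by rewrite mcoeffD mcoeffZ.
Qed.

Lemma proj_bd M X c : proj M (bd mulX X c) = sbd X (proj M c).
Proof.
apply/ffunP => G; rewrite !ffunE; case: (boolP (divides G M)) => GM.
  rewrite (lin_sum (mcoeff_linear _)); apply: eq_bigr => x; rewrite inE => /andP[xG _].
  have E : (mulX x (c (x |: G)))@_(M - mset G) = proj M c (x |: G).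
    rewrite ffunE mcoeff_mulX dividesU1 GM andbT mnmBE msetE (negbTE xG) subn0.
    have e : (M - mset G - U_(x) = M - U_(x) - mset G)%MM by apply/mnmP => i; rewrite !mnmBE subnAC.
    by rewrite e -sub_mset_U1.
  by rewrite mcoeffZ E.
rewrite big1 // => x _; rewrite ffunE dividesU1 (negbTE GM) andbF.
by rewrite scaler0.
Qed.

Lemma add_mset_divides m F : divides F (m + mset F)%MM.
Proof. by apply/dividesP => i iF; rewrite mnmDE msetE iF addn1. Qed.

Lemma add_msetK m F : (m + mset F - mset F)%MM = m.
Proof. by apply/mnmP => i; rewrite mnmBE mnmDE addnK. Qed.

Lemma sub_msetK M F : divides F M -> (M - mset F + mset F)%MM = M.
Proof.
move=> /dividesP FM; apply/mnmP => i; rewrite mnmDE mnmBE msetE.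
by case: (boolP (i \in F)) => [/FM Mi|_]; rewrite ?subnK ?subn0 ?addn0.
Qed.

Lemma proj_eq0 c : (forall M, proj M c = 0) -> c = 0.
Proof.
move=> H; apply/ffunP => F; apply/mpolyP => m; rewrite ffunE mcoeff0.
by have /ffunP/(_ F) := H (m + mset F)%MM; rewrite !ffunE add_mset_divides add_msetK.
Qed.

Lemma cycles_vars p j W : cycles k vars p j W =
  \sum_(M <- desc j) rcyc k [set: 'I_n] (facets p W M) set0.
Proof.
rewrite /cycles (perm_big _ (permEl (perm_sort _ _))) /=.
by have -> : [set i in vars] = [set: 'I_n] by apply/setP => i; rewrite !inE mem_vars.
Qed.

Lemma desc_uniq d : uniq (desc d).
Proof. by rewrite sort_uniq uniq_mons // vars_uniq. Qed.

Lemma kcyc_filtration I p d : subspace I -> fin (piece I d%:Z) ->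
  dim (kcyc mulX (piece I d%:Z) p) = \sum_(M <- desc (d + p)) dim (img (proj M)
    (fun c => kcyc mulX (piece I d%:Z) p c /\
      forall M', (index M' (desc (d + p)) < index M (desc (d + p)))%N -> proj M' c = 0)).
Proof.
move=> sI fI; apply: dim_filtration; [exact: proj_linear | exact: (fin_kcyc mulX_linear p fI) | exact: desc_uniq |].
move=> c [cc _] H; apply: proj_eq0 => M; have [/H //|Md] := boolP (M \in desc (d + p)).
apply/ffunP => F; rewrite !ffunE; case: ifP => // FM.
have := cc F; case: eqP => [cF [_ hF]|_ ->]; last by rewrite mcoeff0.
have [//|nz] := eqVneq (c F)@_(M - mset F) 0; case/negP: Md.
by rewrite mem_desc -[M](sub_msetK FM) mdegD mdeg_mset cF (homog_supp hF nz).
Qed.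

(** Filter the cycles by multidegree from the largest down. The leading component of a cycle is
    again a cycle. Its nonzero coefficients are leading coefficients, since a larger monomial in
    [c F] would belong to an earlier multidegree. *)
Lemma kcyc_initial_le I p d : subspace I -> fin (piece I d%:Z) ->
  (dim (kcyc mulX (piece I d%:Z) p) <= cycles k vars p (d + p) (initial I))%N.
Proof.
move=> sI fI; rewrite kcyc_filtration // cycles_vars !big_seq; apply: leq_sum => M Md.
have sP := subspace_piece d%:Z sI; have fK := fin_kcyc mulX_linear p fI.
apply: dim_le; last first.
- move=> _ [c [[cc bc] H] ->]; split; last first.
    apply/supp0; rewrite -proj_bd bc; exact: (lin0 (proj_linear M)).
  move=> F; rewrite inE ffunE; case: (boolP (divides F M)) => //= FM.
  have := cc F; case: eqP => [cF [IF hF] /= nin|_ -> _]; last by rewrite mcoeff0.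
  have [//|nz] := eqVneq (c F)@_(M - mset F) 0; case/initialP: nin.
  exists (c F); split=> //; first by rewrite (homog_supp hF nz).
  move=> m' lt; have [//|nz'] := eqVneq (c F)@_m' 0.
  have M'd : (m' + mset F)%MM \in desc (d + p).
    by rewrite mem_desc mdegD mdeg_mset cF (homog_supp hF nz').
  have lt' : (index (m' + mset F)%MM (desc (d + p)) < index M (desc (d + p)))%N.
    by rewrite desc_index // -[M](sub_msetK FM) ltmc_add2l.
  by have /ffunP/(_ F) := H _ lt'; rewrite !ffunE add_mset_divides add_msetK.
- exact: fin_scyc.
apply: (fin_img (proj_linear M)); apply: (fin_sub fK) => [|c []//].
apply: subspaceI; first exact: (subspace_kcyc mulX_linear p sP).
split=> [M' _|a u v hu hv M' lt]; first exact: (lin0 (proj_linear M')).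
by rewrite (proj_linear M') hu // hv // scaler0 addr0.
Qed.

(** When the initial monomials themselves lie in [L], a simplicial cycle in multidegree [M] lifts to
    a Koszul cycle with no other component, so every piece of the filtration is attained. *)
Lemma kcyc_monomial_ge L p d : subspace L -> fin (piece L d%:Z) ->
  (forall m, initial L m -> L 'X_[m]) ->
  (cycles k vars p (d + p) (initial L) <= dim (kcyc mulX (piece L d%:Z) p))%N.
Proof.
move=> sL fL monL; rewrite kcyc_filtration // cycles_vars !big_seq; apply: leq_sum => M.
rewrite mem_desc => /eqP dM.
have sP := subspace_piece d%:Z sL; have fK := fin_kcyc mulX_linear p fL.
apply: dim_le; first exact: fin_scyc.
  apply: (fin_img (proj_linear M)); apply: (fin_sub fK) => [|c []//].
  apply: subspaceI; first exact: (subspace_kcyc mulX_linear p sP).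
  split=> [M' _|a u v hu hv M' lt]; first exact: (lin0 (proj_linear M')).
  by rewrite (proj_linear M') hu // hv // scaler0 addr0.
move=> a [aD /supp0 ba].
pose c : chains := [ffun F : {set 'I_n} =>
  if F \in facets p (initial L) M then a F *: 'X_[M - mset F] else 0].
have projE M' : proj M' c = if M' == M then a else 0.
  apply/ffunP => F; rewrite !ffunE; case: (boolP (F \in facets p (initial L) M)) => FD; last first.
    by rewrite mcoeff0 if_same; case: eqP => _; rewrite ?ffunE // aD.
  have FM : divides F M by move: FD; rewrite inE => /and3P[].
  case: (boolP (divides F M')) => FM'.
    rewrite mcoeffZ mcoeffX; case: (eqVneq M' M) => [->|ne]; first by rewrite eqxx mulr1.
    rewrite ffunE; case: eqP => [e|_]; last by rewrite mulr0.
    by case/eqP: ne; rewrite -(sub_msetK FM) e sub_msetK.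
  by case: eqP => [e|_]; rewrite ?ffunE //; rewrite e FM in FM'.
exists c; last by rewrite projE eqxx.
split; last first.
  move=> M' lt; rewrite projE; case: eqP => // e; by rewrite e ltnn in lt.
split.
  move=> F; rewrite ffunE inE; case: eqP => //= cF; case: ifP => [/andP[FM iL]|_]; last by case: sP.
  apply: (subspaceZ _ sP); split; first exact: monL.
  move=> m; rewrite msuppX inE => /eqP ->.
  by rewrite mdeg_sub_mset // cF dM addnK.
apply: proj_eq0 => M'; rewrite proj_bd projE; case: eqP => // _.
by rewrite (lin0 (sbd_linear _)).
Qed.

End InitialMonomials.

Arguments mulX {k n} x f.
Arguments mulX_linear {k n} x.

(** * Koszul complexes of free modules *)

Section PolynomialKoszul.
Variables (k : fieldType) (n : nat).
Local Notation poly := {mpoly k[n]}.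
Local Notation chains := {ffun {set 'I_n} -> poly}.
Implicit Types (f g : poly) (X F : {set 'I_n}) (m : 'X_{1..n}) (d : int) (c : chains).

Lemma fin_of_inj (V W : lmodType k) (f : V -> W) (U : V -> Prop) (U' : W -> Prop) :
  linear f -> subspace U -> fin U' -> (forall v, U v -> U' (f v)) ->
  (forall v, U v -> f v = 0 -> v = 0) -> fin U.
Proof.
move=> fl sU fU' UU' inj.
have [b ib] : fin (img f U).
  by apply: (fin_sub fU') => [|_ [v Uv ->]]; [apply: subspace_img | apply: UU'].
exists (0 + b)%N; apply: (has_dim_extension fl sU _ ib); apply: has_dim0 => v.
split=> [[Uv fv]|->]; first exact: inj.
by rewrite (lin0 fl); case: sU.
Qed.

Lemma homog_coeff d f : homog_int d f <-> (forall m, (mdeg m)%:Z != d -> f@_m = 0).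
Proof.
split=> H m; last by rewrite mcoeff_msupp => fm; apply/eqP; apply: contraR fm => /H ->.
by move=> md; apply/eqP; apply: contraR md; rewrite -mcoeff_msupp => /H ->.
Qed.

Lemma addmUK m x : (0 < m x)%N -> (m - U_(x) + U_(x))%MM = m.
Proof.
move=> mx; apply/mnmP => i; rewrite mnmDE mnmBE mnm1E.
by case: eqP => [<-|_]; rewrite ?subnK ?subn0 ?addn0.
Qed.

(** Zero in negative degrees, so that degree shifts may run over all integers. *)
Definition hpart d f : poly := if d is Posz e then pihomog mdeg e f else 0.

Lemma mcoeff_hpart d f m : (hpart d f)@_m = if (mdeg m)%:Z == d then f@_m else 0.
Proof.
case: d => e /=; last by rewrite mcoeff0.
rewrite -[(mdeg m)%:Z == e]/(mdeg m == e).
have H (f' : poly) : pihomog mdeg e f' \is e.-homog by apply: pihomogP.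
case: eqP => [dm|/eqP dm].
  rewrite pihomogE raddf_sum /= [in RHS](mpolyE f) raddf_sum /= [in RHS](bigID (fun m' => mdeg m' == e)) /=.
  rewrite [X in _ = _ + X]big1 ?addr0 // => m' m'e.
  rewrite mcoeffZ mcoeffX; case: eqP => [mm'|_]; last by rewrite mulr0.
  by rewrite mm' dm eqxx in m'e.
by apply/eqP; apply: contraR dm; rewrite -mcoeff_msupp => fm; have /dhomogP/(_ m fm) /= -> := H f.
Qed.

Lemma hpart_homog d f : homog_int d (hpart d f).
Proof. by apply/homog_coeff => m /negbTE md; rewrite mcoeff_hpart md. Qed.

Lemma hpart_id d f : homog_int d f -> hpart d f = f.
Proof.
move=> /homog_coeff hf; apply/mpolyP => m; rewrite mcoeff_hpart.
by case: ifP => // /negbT /hf ->.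
Qed.

Lemma hpart_linear d : linear (hpart d).
Proof.
move=> a u v; apply/mpolyP => m; rewrite !(mcoeffD, mcoeffZ, mcoeff_hpart).
by case: ifP => // _; rewrite mulr0 addr0.
Qed.

Lemma hpart_mulX d x f : hpart (d + 1) (mulX x f) = mulX x (hpart d f).
Proof.
apply/mpolyP => m; rewrite mcoeff_hpart !mcoeff_mulX; case: posnP => [_|mx]; first by rewrite if_same.
rewrite mcoeff_hpart; have e : mdeg m = (mdeg (m - U_(x))).+1 by rewrite -[in LHS](addmUK mx) mdegD mdeg1 addn1.
by rewrite e -addn1 PoszD (inj_eq (addIr _)).
Qed.

Lemma homog_mulX d x f : homog_int d f -> homog_int (d + 1) (mulX x f).
Proof. by move/hpart_id => <-; rewrite -hpart_mulX; apply: hpart_homog. Qed.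

(* Both sides say that f lies in the ideal generated by the variables in X. *)
Lemma bd_set0P X f :
  (exists c, f = bd mulX X c set0) <-> (forall m, f@_m != 0 -> exists2 y, y \in X & (0 < m y)%N).
Proof.
split=> [[c ->] m|H].
  rewrite ffunE raddf_sum /= => nz.
  have [y] : exists y, (y \in X) && (0 < m y)%N.
    apply/existsP; apply: contraR nz => /existsPn H; apply/eqP; apply: big1 => y.
    rewrite setD0 => yX; have := H y; rewrite yX /= lt0n negbK => /eqP my.
    by rewrite mcoeffZ mcoeff_mulX my mulr0.
  by case/andP=> ? ?; exists y.
have el : linear (fun c : chains => c set0) by move=> a u v; rewrite !ffunE.
have sI : subspace (img (fun c => bd mulX X c set0) (fun=> True)).
  apply: subspace_img => // a u v; rewrite (bd_linear mulX_linear); exact: el.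
suff [c _ ->] : img (fun c => bd mulX X c set0) (fun=> True) f by exists c.
rewrite (mpolyE f) big_seq; apply: (subspace_sum _ sI) => m; rewrite mcoeff_msupp => /H[y yX my].
apply: (subspaceZ _ sI).
exists [ffun F : {set 'I_n} => if F == [set y] then sgn k y set0 *: 'X_[m - U_(y)] : poly else 0] => //.
rewrite ffunE setD0 (bigD1 y) //= big1 => [|z /andP[_ zy]]; last first.
  rewrite ffunE setU0; case: eqP => [/set1_inj e|_]; first by rewrite e eqxx in zy.
  by rewrite (lin0 (mulX_linear z)) scaler0.
rewrite ffunE setU0 eqxx (linZ (mulX_linear y)) scalerA sgn_mul scale1r addr0.
by rewrite /mulX -mpolyXD addmC addmUK.
Qed.

Lemma mulX_regular X x f c : x \notin X ->
  mulX x f = bd mulX X c set0 -> exists c', f = bd mulX X c' set0.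
Proof.
move=> xX E; apply/bd_set0P => m fm.
have /bd_set0P/(_ (m + U_(x))%MM) : exists c, mulX x f = bd mulX X c set0 by exists c.
rewrite mcoeff_mulX mnmDE mnm1E eqxx addn1 /=.
have -> : (m + U_(x) - U_(x))%MM = m by apply/mnmP => i; rewrite mnmBE mnmDE addnK.
case=> // y yX; rewrite mnmDE mnm1E; case: eqP => [e|_]; first by rewrite e yX in xX.
by rewrite addn0; exists y.
Qed.

Lemma poly_koszul_exact d p c : (0 < p)%N -> kcyc mulX (homog_int (d + 1)) p c ->
  exists2 b, kchain (homog_int d) p.+1 b & bd mulX setT b = c.
Proof.
move=> p0 [cc c0].
have [|b bc be] := koszul_exact mulX_linear (@mulXC k n) mulX_regular p0 _ c0.
  by move=> F; rewrite subsetT /= => /negbTE pF; have := cc F; rewrite pF.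
(* The filling obtained so far is not homogeneous; its component of degree d has the same boundary
   because [c] is homogeneous. *)
exists [ffun F => hpart d (b F)].
  move=> F; rewrite ffunE; case: eqP => [_|/eqP pF]; first exact: hpart_homog.
  by rewrite bc ?(lin0 (hpart_linear d)) // subsetT.
apply/ffunP => G; have := cc G; rewrite -be !ffunE => cG.
have -> : \sum_(x in [set: 'I_n] :\: G) sgn k x G *: mulX x (b (x |: G)) =
  hpart (d + 1) (bd mulX setT b G).
  move: cG; rewrite !ffunE.
  case: ifP => [_ /hpart_id -> //|_ ->].
  by rewrite (lin0 (hpart_linear _)).
rewrite ffunE (lin_sum (hpart_linear _)); apply: eq_bigr => x _.
by rewrite (linZ (hpart_linear _)) hpart_mulX ffunE.
Qed.

Lemma poly_max_ideal d f : homog_int (d + 1) f -> f@_0%MM = 0 ->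
  exists2 c, kchain (homog_int d) 1 c & f = bd mulX setT c set0.
Proof.
move=> hf f0; have [c fc] : exists c, f = bd mulX setT c set0.
  apply/bd_set0P => m fm; have [y my] : exists y, (0 < m y)%N.
    apply/existsP; apply: contraR fm => /existsPn m0; have -> : m = 0%MM.
      by apply/mnmP => i; have := m0 i; rewrite mnm0E lt0n negbK => /eqP.
    by rewrite f0.
  by exists y.
exists [ffun F : {set 'I_n} => if #|F| == 1%N then hpart d (c F) else 0].
  by move=> F; rewrite ffunE; case: eqP => // _; apply: hpart_homog.
rewrite -[LHS](hpart_id hf) fc !ffunE (lin_sum (hpart_linear _)); apply: eq_bigr => x _.
by rewrite (linZ (hpart_linear _)) hpart_mulX ffunE setU0 cards1 eqxx.
Qed.

End PolynomialKoszul.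

Section FreeModules.
Variables (k : fieldType) (n r : nat) (dg : 'I_r -> int).
Local Notation poly := {mpoly k[n]}.
Local Notation free := {ffun 'I_r -> poly}.
Implicit Types (u v : free) (d : int).

Definition muv (x : 'I_n) v : free := [ffun a => mulX x (v a)].

Definition homv d v : Prop := forall a, homog_int (d - dg a) (v a).

Lemma muv_linear x : linear (muv x).
Proof. by move=> c u v; apply/ffunP => a; rewrite !ffunE mulX_linear. Qed.

Lemma muvC x y v : muv x (muv y v) = muv y (muv x v).
Proof. by apply/ffunP => a; rewrite !ffunE mulXC. Qed.

Lemma subspace_homv d : subspace (homv d).
Proof.
split=> [a|c u v hu hv a]; rewrite !ffunE; first by case: (subspace_homog k n (d - dg a)).
exact: (subspace_homog k n (d - dg a)).2.
Qed.

Lemma fin_homv d : fin (homv d).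
Proof.
(* No component of a homogeneous vector of degree d reaches degree [N], so finitely many
   coefficients determine the vector. *)
pose N := (\max_(a : 'I_r) `|d - dg a|%N).+1.
pose ev v := [ffun t : 'I_r * 'X_{1..n < N} => (v t.1)@_t.2 : k^o].
have evl : linear ev.
  by move=> a u v; apply/ffunP => m; rewrite !ffunE mcoeffD mcoeffZ.
have fT : fin (fun c : {ffun 'I_r * 'X_{1..n < N} -> k^o} => forall t, t \notin setT -> c t = 0).
  by exists #|[set: 'I_r * 'X_{1..n < N}]|; apply: has_dim_supp.
apply: (fin_of_inj evl _ fT); [exact: subspace_homv | by move=> f _ t; rewrite inE |].
move=> v hv v0; apply/ffunP => a; apply/mpolyP => m; rewrite ffunE mcoeff0.
have [//|vm] := eqVneq (v a)@_m 0.
have dm : (mdeg m < N)%N.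
  rewrite -mcoeff_msupp in vm; have [e] : `|d - dg a|%N = mdeg m by rewrite -(hv a m vm).
  by rewrite ltnS -e (leq_bigmax_cond (F := fun a : 'I_r => `|d - dg a|%N)).
by have /ffunP/(_ (a, BMultinom dm)) := v0; rewrite !ffunE.
Qed.

Lemma homv_muv d x v : homv d v -> homv (d + 1) (muv x v).
Proof. by move=> hv a; rewrite ffunE addrAC; apply: homog_mulX. Qed.

Lemma bd_muvE X (c : {ffun {set 'I_n} -> free}) F a :
  bd muv X c F a = bd mulX X [ffun F => c F a] F.
Proof. by rewrite !ffunE sum_ffunE; apply: eq_bigr => x _; rewrite !ffunE. Qed.

Lemma free_koszul_exact d p c : (0 < p)%N -> kcyc muv (homv (d + 1)) p c ->
  exists2 b, kchain (homv d) p.+1 b & bd muv setT b = c.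
Proof.
move=> p0 [cc c0].
have /fin_all_exists2[b bc be] : forall a : 'I_r, exists2 b,
    kchain (homog_int (d - dg a)) p.+1 b & bd mulX setT b = [ffun F => c F a].
  move=> a; apply: poly_koszul_exact => //; split.
    move=> F; have := cc F; rewrite ffunE addrAC; case: ifP => _; first exact.
    by move=> ->; rewrite ffunE.
  by apply/ffunP => F; rewrite -bd_muvE c0 !ffunE.
exists [ffun F : {set 'I_n} => [ffun a => b a F]].
  move=> F; rewrite ffunE; case: ifP => pF; first by move=> a; rewrite ffunE; have := bc a F; rewrite pF.
  by apply/ffunP => a; rewrite !ffunE; have := bc a F; rewrite pF.
apply/ffunP => F; apply/ffunP => a; rewrite bd_muvE.
have -> : [ffun F0 => [ffun F : {set 'I_n} => [ffun a => b a F]] F0 a] = b a.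
  by apply/ffunP => G; rewrite !ffunE.
by rewrite be ffunE.
Qed.

Lemma free_max_ideal d v : homv (d + 1) v ->
  (exists2 c, kchain (homv d) 1 c & v = bd muv setT c set0) <-> (forall a, (v a)@_0%MM = 0).
Proof.
move=> hv; split=> [[c _ ->] a|v0].
  rewrite bd_muvE; apply/eqP; apply: contraT => nz.
  have /bd_set0P/(_ _ nz)[y _] : exists c', bd mulX setT [ffun F => c F a] set0 =
    bd mulX setT c' set0 by eexists.
  by rewrite mnm0E.
have /fin_all_exists2[b bc be] : forall a : 'I_r, exists2 b,
    kchain (homog_int (d - dg a)) 1 b & v a = bd mulX setT b set0.
  by move=> a; apply: poly_max_ideal => //; have := hv a; rewrite addrAC.
exists [ffun F : {set 'I_n} => [ffun a => b a F]].
  move=> F; rewrite ffunE; case: ifP => pF; first by move=> a; rewrite ffunE; have := bc a F; rewrite pF.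
  by apply/ffunP => a; rewrite !ffunE; have := bc a F; rewrite pF.
apply/ffunP => a; rewrite bd_muvE be; congr (bd _ _ _ _).
by apply/ffunP => G; rewrite !ffunE.
Qed.

End FreeModules.

Arguments muv {k n r} x v.

(** * Dimension shifting *)

Section Multiplication.
Variables (k : fieldType) (n : nat) (V : lmodType k) (mu : 'I_n -> V -> V).
Hypothesis mul : forall x, linear (mu x).
Implicit Types (U : V -> Prop) (c : {ffun {set 'I_n} -> V}).

Definition mult U : V -> Prop := fun v => exists2 c, kchain U 1 c & v = bd mu setT c set0.

Lemma kchain_bd U U' p c : subspace U' -> (forall x v, U v -> U' (mu x v)) ->
  kchain U p.+1 c -> kchain U' p (bd mu setT c).
Proof.
move=> sU' UU' cU F; rewrite ffunE; case: eqP => [pF|/eqP pF].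
  apply: (subspace_sum _ sU') => x; rewrite inE => /andP[xF _]; apply: (subspaceZ _ sU').
  by apply: UU'; have := cU (x |: F); rewrite cardsU1 xF pF add1n eqxx.
apply: big1 => x; rewrite inE => /andP[xF _].
have := cU (x |: F); rewrite cardsU1 xF add1n eqSS (negbTE pF) => ->.
by rewrite (lin0 (mul x)) scaler0.
Qed.

Lemma bd_set0_linear : linear (fun c => bd mu setT c set0).
Proof. by move=> a u v; rewrite (bd_linear mul) !ffunE. Qed.

Lemma kchain1_bd U c : kchain U 1 c -> bd mu setT c set0 = 0 -> bd mu setT c = 0.
Proof.
move=> cU c0; apply/ffunP => F; rewrite [RHS]ffunE; have [->//|F0] := eqVneq F set0.
have /(_ F) : kchain (fun=> True) 0 (bd mu setT c).
  apply: (kchain_bd _ _ (U := fun=> True)) => // G; have := cU G.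
  by case: ifP.
by rewrite cards_eq0 (negbTE F0).
Qed.

Lemma mult_img U : mult U = img (fun c => bd mu setT c set0) (kchain U 1).
Proof. by []. Qed.

Lemma dim_mult U : fin U -> (n * dim U = dim (kcyc mu U 1) + dim (mult U))%N.
Proof.
move=> fU; rewrite -{1}[n]bin1 -dim_kchain // mult_img (rank_nullity bd_set0_linear (fin_kchain n 1 fU)).
congr addn; apply: dim_ext => c; split=> [[cU c0]|[cU c0]]; split=> //; first exact: (kchain1_bd cU c0).
by rewrite c0 ffunE.
Qed.

End Multiplication.

Local Ltac lia_dim := repeat match goal with |- context [@dim ?k ?V ?U] => move: (@dim k V U) => ? end; lia.

Section GradedSurjection.
Variables (k : fieldType) (n : nat) (A W : lmodType k).
Variables (muA : 'I_n -> A -> A) (muW : 'I_n -> W -> W) (delta : A -> W).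
Hypotheses (mulA : forall x, linear (muA x)) (mulW : forall x, linear (muW x)).
Hypothesis muAC : forall x y v, muA x (muA y v) = muA y (muA x v).
Hypothesis deltal : linear delta.
Hypothesis deltaM : forall x v, delta (muA x v) = muW x (delta v).
Variable hA : int -> A -> Prop.
Hypothesis fin_hA : forall d, fin (hA d).
Hypothesis hA_mul : forall d x v, hA d v -> hA (d + 1) (muA x v).
Hypothesis exactA : forall d p c, (0 < p)%N -> kcyc muA (hA (d + 1)) p c ->
  exists2 b, kchain (hA d) p.+1 b & bd muA setT b = c.
Implicit Types (c : {ffun {set 'I_n} -> A}) (d : int).

Definition imd d := img delta (hA d).
Definition kerd d v := hA d v /\ delta v = 0.

Lemma fin_imd d : fin (imd d).
Proof. exact: fin_img. Qed.

Lemma fin_kerd d : fin (kerd d).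
Proof. exact: fin_ker. Qed.

Lemma dim_surjection d : (dim (hA d) = dim (kerd d) + dim (imd d))%N.
Proof. exact: rank_nullity. Qed.

Definition push c : {ffun {set 'I_n} -> W} := [ffun F => delta (c F)].

Lemma push_linear : linear push.
Proof. by move=> a u v; apply/ffunP => F; rewrite !ffunE deltal. Qed.

Lemma bd_push X c : bd muW X (push c) = push (bd muA X c).
Proof.
apply/ffunP => G; rewrite !ffunE (lin_sum deltal); apply: eq_bigr => x _.
by rewrite (linZ deltal) deltaM ffunE.
Qed.

(** Chains over the cover [A] that become cycles over [W]. Computing their dimension by [push] and
    again by the boundary relates the cycles of [W] to those of the kernel. *)
Definition relcyc d p c := kchain (hA d) p c /\ push (bd muA setT c) = 0.

Lemma fin_relcyc d p : fin (relcyc d p).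
Proof.
apply: (fin_ker (f := fun c => push (bd muA setT c))); last exact: fin_kchain.
by move=> a u v; rewrite (bd_linear mulA) push_linear.
Qed.

Lemma relcyc_push d p :
  dim (relcyc d p) = ('C(n, p) * dim (kerd d) + dim (kcyc muW (imd d) p))%N.
Proof.
rewrite (rank_nullity push_linear (fin_relcyc d p)) -(dim_kchain n p (fin_kerd d)).
congr addn; apply: dim_ext => c; split.
- case=> -[cA _] /ffunP c0 F; have := cA F; have := c0 F; rewrite !ffunE.
  by case: ifP.
- move=> cK; have cA : kchain (hA d) p c by move=> F; have := cK F; case: ifP => // _ [].
  have c0 : push c = 0.
    apply/ffunP => F; rewrite !ffunE; have := cK F; case: ifP => _ => [[]//|->].
    exact: lin0.
  by split=> //; split=> //; rewrite -bd_push c0 (lin0 (bd_linear mulW _)).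
- case=> b [bA b0] ->; split; last by rewrite bd_push b0.
  move=> F; rewrite ffunE; have := bA F; case: ifP => _ bF; first by exists (b F).
  by rewrite bF (lin0 deltal).
case=> cM c0.
have /fin_all_exists2[b bA bE] : forall F : {set 'I_n}, exists2 v,
    (if #|F| == p then hA d v else v = 0) & c F = delta v.
  move=> F; have := cM F; case: ifP => _; first by case=> v hv ->; exists v.
  by move=> ->; exists 0; rewrite // (lin0 deltal).
have E : push [ffun F => b F] = c by apply/ffunP => F; rewrite !ffunE bE.
exists [ffun F => b F]; last by rewrite E.
split; first by move=> F; rewrite ffunE; apply: bA.
by rewrite -bd_push E.
Qed.

Lemma relcyc_bd d p : (0 < p)%N -> dim (relcyc d p.+1) =
  (dim (kcyc muA (hA d) p.+1) + dim (kcyc muA (kerd (d + 1)) p))%N.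
Proof.
move=> p0; rewrite (rank_nullity (bd_linear mulA setT) (fin_relcyc d p.+1)).
congr addn; apply: dim_ext => c; split.
- by case=> -[].
- case=> cA c0; split=> //; split=> //.
  by rewrite c0; apply: (lin0 push_linear).
- case=> b [bA /ffunP b0] ->; split; last exact: bd_bd.
  have H := kchain_bd mulA (fin_subspace (fin_hA (d + 1))) (@hA_mul d) bA.
  by move=> F; have := H F; case: ifP => // _ hF; split=> //; have := b0 F; rewrite !ffunE.
case=> cK c0.
have [|b bA bc] := @exactA d p c p0.
  by split=> // F; have := cK F; case: ifP => // _ [].
exists b => //; split=> //; rewrite bc; apply/ffunP => F; rewrite !ffunE.
by have := cK F; case: ifP => _ => [[]//|->]; apply: lin0.
Qed.

Lemma relcyc1_bd d : dim (relcyc d 1) =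
  (dim (kcyc muA (hA d) 1) + dim (fun v => kerd (d + 1) v /\ mult muA (hA d) v))%N.
Proof.
rewrite (rank_nullity (bd_set0_linear mulA) (fin_relcyc d 1)).
congr addn; apply: dim_ext => c; split.
- by case=> -[cA _] c0; split=> //; apply: (kchain1_bd mulA cA c0).
- case=> cA c0; split; last by rewrite c0 ffunE.
  by split=> //; rewrite c0; apply: (lin0 push_linear).
- case=> b [bA /ffunP b0] ->; split; last by exists b.
  have H := kchain_bd mulA (fin_subspace (fin_hA (d + 1))) (@hA_mul d) bA.
  by have := H set0; rewrite cards0 eqxx => hb; split=> //; have := b0 set0; rewrite !ffunE.
case=> -[hc c0] [b bA cb]; exists b => //; split=> //; apply/ffunP => F.
rewrite [LHS]ffunE [RHS]ffunE; have [->|F0] := eqVneq F set0; first by rewrite -cb.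
have := kchain_bd mulA (fin_subspace (fin_hA (d + 1))) (@hA_mul d) bA F.
by rewrite cards_eq0 (negbTE F0) => ->; apply: lin0.
Qed.

Lemma free_step d p : (0 < p)%N -> ('C(n, p.+1) * dim (hA d) =
  dim (kcyc muA (hA d) p.+1) + dim (kcyc muA (hA (d + 1)) p))%N.
Proof.
move=> p0; rewrite -dim_kchain // (rank_nullity (bd_linear mulA setT) (fin_kchain n _ (fin_hA d))).
congr addn; apply: dim_ext => c; split; last by case/exactA => // b bA <-; exists b.
case=> b bA ->; split; last exact: bd_bd.
exact: (kchain_bd mulA (fin_subspace (fin_hA (d + 1))) (@hA_mul d) bA).
Qed.

(** The dimension of Koszul homology in total degree j: cycles minus boundaries, the latter being
    all chains one step higher minus the cycles among them. *)
Definition kbetti (V : lmodType k) (mu : 'I_n -> V -> V) (U : int -> V -> Prop) p (j : int) : int :=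
  let z p := dim (kcyc mu (U (j - p%:Z)%R) p) in
  (z p)%:Z + (z p.+1)%:Z - ('C(n, p.+1) * dim (U (j - p.+1%:Z)%R))%N%:Z.

(** The connecting isomorphism for the kernel, [A] and [W], with [A] acyclic in positive degrees,
    read as an identity of dimensions. *)
Lemma kbetti_step p j : (1 < p)%N -> kbetti muW imd p j = kbetti muA kerd p.-1 j.
Proof.
case: p => [|[|p]] // _; rewrite /kbetti /=.
have E1 := relcyc_push (j - p.+2%:Z) p.+2.
have E2 := relcyc_push (j - p.+3%:Z) p.+3.
have E3 := @relcyc_bd (j - p.+2%:Z) p.+1 isT.
have E4 := @relcyc_bd (j - p.+3%:Z) p.+2 isT.
have E5 := @free_step (j - p.+3%:Z) p.+2 isT.
have E6 := dim_surjection (j - p.+3%:Z).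
have e1 : j - p.+2%:Z + 1 = j - p.+1%:Z by lia.
have e2 : j - p.+3%:Z + 1 = j - p.+2%:Z by lia.
rewrite e1 in E3; rewrite e2 in E4 E5.
rewrite E6 mulnDr in E5; move: E1 E2 E3 E4 E5; clear.
lia_dim.
Qed.

(** At index 1 the homology of [A] in index 0 interferes: what remains is the part of the kernel
    lying in the variables times [A], modulo the variables times the kernel. *)
Lemma kbetti_step1 j : kbetti muW imd 1 j =
  (dim (fun v => kerd j v /\ mult muA (hA (j - 1%:Z)%R) v))%:Z - (dim (mult muA (kerd (j - 1%:Z)%R)))%:Z.
Proof.
rewrite /kbetti /=.
have E1 := relcyc_push (j - 1%:Z) 1%N.
have E2 := relcyc_push (j - 2%:Z) 2%N.
have E3 := relcyc1_bd (j - 1%:Z).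
have E4 := @relcyc_bd (j - 2%:Z) 1%N isT.
have E5 := @free_step (j - 2%:Z) 1%N isT.
have E6 := dim_surjection (j - 2%:Z).
have E7 := dim_mult mulA (fin_kerd (j - 1%:Z)).
have e1 : j - 1%:Z + 1 = j by lia.
have e2 : j - 2%:Z + 1 = j - 1%:Z by lia.
rewrite e1 in E3; rewrite e2 in E4 E5; rewrite bin1 in E1.
rewrite E6 mulnDr in E5; move: E1 E2 E3 E4 E5 E7; clear.
lia_dim.
Qed.

Lemma dim_mult_free j : (dim (mult muA (hA (j - 1%:Z)%R)) =
  dim (mult muW (imd (j - 1%:Z))) + dim (fun v => kerd j v /\ mult muA (hA (j - 1%:Z)%R) v))%N.
Proof.
have E1 := relcyc_push (j - 1%:Z) 1%N.
have E3 := relcyc1_bd (j - 1%:Z).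
have E5 := dim_mult mulA (fin_hA (j - 1%:Z)).
have E6 := dim_surjection (j - 1%:Z).
have E7 := dim_mult mulW (fin_imd (j - 1%:Z)).
have e1 : j - 1%:Z + 1 = j by lia.
rewrite e1 in E3; rewrite bin1 in E1.
rewrite E6 mulnDr in E5; move: E1 E3 E5 E7; clear.
lia_dim.
Qed.

End GradedSurjection.

(** * Betti numbers from Koszul cycles *)

Section Resolution.
Variables (k : fieldType) (n : nat) (I : {mpoly k[n]} -> Prop).
Variable FI : graded_free_resolution I.
Local Notation poly := {mpoly k[n]}.
Implicit Types (d j : int) (f g : poly).

Lemma hpartM d e f g : homog_int e g -> hpart (d + e) (f * g) = hpart d f * g.
Proof.
move=> /homog_coeff hg; apply/mpolyP => m; rewrite mcoeff_hpart !mcoeffM.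
case: eqP => [dm|dm].
  apply: eq_bigr => -[a b] /= /eqP mE; rewrite mcoeff_hpart.
  have [eb|/hg ->] := eqVneq (mdeg b)%:Z e; last by rewrite !mulr0.
  have := congr1 (fun z => (mdeg z)%:Z) mE; rewrite dm mdegD PoszD eb => /addIr ->.
  by rewrite eqxx.
rewrite big1 // => -[a b] /= /eqP mE; rewrite mcoeff_hpart.
have [eb|/hg ->] := eqVneq (mdeg b)%:Z e; last by rewrite mulr0.
case: eqP => [da|_]; last by rewrite mul0r.
by case: dm; have := congr1 (fun z => (mdeg z)%:Z) mE; rewrite mdegD PoszD eb da.
Qed.

(* Shifted by one, so that the ring itself is the module of index 0. *)
Definition rk m : nat := if m is m'.+1 then res_rank FI m' else 1.
Definition dgs m : 'I_(rk m) -> int :=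
  match m with 0 => fun=> 0 | m'.+1 => fun a => @res_deg k n I FI m' a end.
Definition Dmat m : 'I_(rk m.+1) -> 'I_(rk m) -> poly :=
  match m with 0 => fun a _ => res_aug FI a 0 | m'.+1 => fun a b => res_diff FI m' a b end.
Local Notation free m := {ffun 'I_(rk m) -> poly}.
Definition delta m (v : free m.+1) : free m := [ffun b => \sum_a v a * Dmat a b].

Lemma Dmat_homog m a b : homog_int (dgs a - dgs b) (@Dmat m a b).
Proof.
case: m a b => [|m] a b /=; last exact: res_diff_homog.
by rewrite subr0; apply: res_aug_homog.
Qed.

Lemma delta_linear m : linear (@delta m).
Proof.
move=> c u v; apply/ffunP => b; rewrite !ffunE scaler_sumr -big_split /=.
by apply: eq_bigr => a _; rewrite !ffunE mulrDl scalerAl.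
Qed.

Lemma delta_muv m x (v : free m.+1) : delta (muv x v) = muv x (delta v).
Proof.
apply/ffunP => b; rewrite !ffunE /mulX mulr_sumr; apply: eq_bigr => a _.
by rewrite ffunE mulrA.
Qed.

Lemma delta_exact m (v : free m.+1) : delta v = 0 <-> exists w : free m.+2, v = delta w.
Proof.
pose rw r (u : {ffun 'I_r -> poly}) : 'rV[poly]_r := \row_a u a.
have rwI r (u u' : {ffun 'I_r -> poly}) : rw r u = rw r u' -> u = u'.
  by move=> /rowP H; apply/ffunP => a; have := H a; rewrite !mxE.
have rwD m' (u : free m'.+2) : rw _ (delta u) = rw _ u *m res_diff FI m'.
  by apply/rowP => b; rewrite !mxE ffunE; apply: eq_bigr => a _; rewrite mxE.
have ex m' (u : free m'.+1) :
    (exists w : free m'.+2, u = delta w) <-> exists w, rw _ u = w *m res_diff FI m'.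
  split=> [[w ->]|[w uw]]; first by exists (rw _ w); rewrite rwD.
  exists [ffun a => w 0 a]; apply: rwI; rewrite rwD uw; congr mulmx.
  by apply/rowP => a; rewrite mxE ffunE.
case: m v => [|m] v.
  rewrite ex -res_exact0; split=> [/ffunP/(_ ord0) e|e].
    apply/rowP => b; rewrite !mxE; move: e; rewrite !ffunE => e; rewrite -[RHS]e.
    by apply: eq_bigr => a _; rewrite mxE /= !(ord1 b).
  apply/ffunP => b; rewrite !ffunE; have /rowP/(_ 0) := e; rewrite !mxE => e'.
  by rewrite -[RHS]e'; apply: eq_bigr => a _; rewrite mxE.
rewrite ex -res_exact -rwD; split=> [->|e]; first by apply/rowP => b; rewrite !mxE ffunE.
by apply: rwI; rewrite e; apply/rowP => b; rewrite !mxE ffunE.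
Qed.

Definition hpartv m d (v : free m) : free m := [ffun a => hpart (d - dgs a) (v a)].

Lemma hpartv_homog m d (v : free m) : homv (@dgs m) d (hpartv d v).
Proof. by move=> a; rewrite ffunE; apply: hpart_homog. Qed.

Lemma hpartv_id m d (v : free m) : homv (@dgs m) d v -> hpartv d v = v.
Proof. by move=> hv; apply/ffunP => a; rewrite ffunE hpart_id. Qed.

Lemma delta_hpartv m d (v : free m.+1) : delta (hpartv d v) = hpartv d (delta v).
Proof.
apply/ffunP => b; rewrite !ffunE (lin_sum (hpart_linear _)); apply: eq_bigr => a _.
rewrite ffunE -(hpartM _ _ (@Dmat_homog m a b)); congr (hpart _ _).
by rewrite addrA subrK.
Qed.

Lemma delta_homv m d (v : free m.+1) : homv (@dgs m.+1) d v -> homv (@dgs m) d (delta v).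
Proof. by move=> /hpartv_id <-; rewrite delta_hpartv; apply: hpartv_homog. Qed.

(** Because of the shift in [rk], index 0 is [I] itself, as a submodule of the free module of rank
    one. *)
Definition syz m : int -> free m -> Prop := imd (@delta m) (homv (@dgs m.+1)).

Lemma kerd_syz m : kerd (@delta m) (homv (@dgs m.+1)) = @syz m.+1.
Proof.
apply: functional_extensionality => d; apply: pred_ext => v; split=> [[hv /delta_exact[w vw]]|[w hw ->]].
  exists (hpartv d w); first exact: hpartv_homog.
  by rewrite delta_hpartv -vw hpartv_id.
by split; [apply: delta_homv | apply/delta_exact; exists w].
Qed.

Lemma syz0 d (v : free 0) : syz d v <-> piece I d (v ord0).
Proof.
split=> [[w hw ->]|[Iv hv]].
  split; last by have H := delta_homv hw; have := H ord0; rewrite /= subr0.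
  apply/(res_aug_onto FI); exists (\row_a w a); rewrite !mxE ffunE.
  by apply: eq_bigr => a _; rewrite mxE.
have /(res_aug_onto FI)[w vw] := Iv.
pose u : free 1 := [ffun a => w 0 a].
have E : v = delta (m := 0) u.
  apply/ffunP => b; rewrite (ord1 b) vw mxE ffunE.
  by apply: eq_bigr => a _; rewrite ffunE.
have hv' : homv (@dgs 0) d v by move=> b; rewrite (ord1 b) /= subr0.
exists (hpartv d u); first exact: hpartv_homog.
by rewrite delta_hpartv -E hpartv_id.
Qed.

Local Notation hom m := (homv (@dgs m)).

Local Notation hmult m d := (@mult k n (free m) muv (hom m d)).

Lemma fin_syz m d : fin (@syz m d).
Proof. exact: (fin_imd (@delta_linear m) (@fin_homv k n _ _)). Qed.

Lemma syz_step m p j : kbetti muv (@syz m) p.+2 j = kbetti muv (@syz m.+1) p.+1 j.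
Proof.
rewrite -kerd_syz.
exact: (kbetti_step (@muv_linear k n _) (@muv_linear k n _) (@muvC k n _) (@delta_linear m)
  (@delta_muv m) (@fin_homv k n _ _) (@homv_muv k n _ _) (@free_koszul_exact k n _ _)).
Qed.

Lemma syz_step1 m j : kbetti muv (@syz m) 1 j =
  (dim (fun v => @syz m.+1 j v /\ hmult m.+1 (j - 1%:Z)%R v))%:Z
  - (dim (mult muv (@syz m.+1 (j - 1%:Z)%R)))%:Z.
Proof.
rewrite -kerd_syz.
exact: (kbetti_step1 (@muv_linear k n _) (@muv_linear k n _) (@muvC k n _) (@delta_linear m)
  (@delta_muv m) (@fin_homv k n _ _) (@homv_muv k n _ _) (@free_koszul_exact k n _ _)).
Qed.

Lemma dim_mult_hom m j : (dim (hmult m.+1 (j - 1%:Z)%R) =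
  dim (mult muv (@syz m (j - 1%:Z)%R))
  + dim (fun v => @syz m.+1 j v /\ hmult m.+1 (j - 1%:Z)%R v))%N.
Proof.
rewrite -kerd_syz.
exact: (dim_mult_free (@muv_linear k n _) (@muv_linear k n _) (@delta_linear m)
  (@delta_muv m) (@fin_homv k n _ _) (@homv_muv k n _ _)).
Qed.

Lemma syz_kbetti i j : kbetti muv (@syz 0) i.+1 j = kbetti muv (@syz i) 1 j.
Proof.
suff E l : (l <= i)%N -> kbetti muv (@syz 0) i.+1 j = kbetti muv (@syz l) (i - l).+1 j.
  by rewrite (E i) // subnn.
elim: l => [|l IH] li; first by rewrite subn0.
by rewrite IH ?(ltnW li) // -(subnSK li) syz_step.
Qed.

End Resolution.

(** * Row spaces of matrices as subspaces *)

Section RowSpaces.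
Variable k : fieldType.

Lemma has_dim_row_space r d (A : 'M[k]_(r, d)) : has_dim (fun u : 'rV[k]_d => (u <= A)%MS) (\rank A).
Proof.
have E (v : 'rV[k]_d) : \sum_i v 0 i *: delta_mx 0 i = v by rewrite [RHS]row_sum_delta.
have -> : (fun u : 'rV[k]_d => (u <= A)%MS : Prop) =
  (fun w => exists2 v : 'rV[k]_d, (v <= A)%MS & w = \sum_i v 0 i *: (delta_mx 0 i : 'rV_d)).
  apply: pred_ext => u; split=> [uA|[v vA ->]]; last by rewrite E.
  by exists u; rewrite ?E.
by apply: has_dim_row => v _; rewrite E.
Qed.

Lemma sub_diag_mx d (P : pred 'I_d) (u : 'rV[k]_d) :
  (u <= diag_mx (\row_a (P a)%:R))%MS <-> (forall a, ~~ P a -> u 0 a = 0).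
Proof.
split=> [/submxP[w ->] a /negbTE Pa|H].
  by rewrite mul_mx_diag !mxE Pa mulr0.
apply/submxP; exists u; apply/rowP => a; rewrite mul_mx_diag !mxE.
by case: (boolP (P a)) => [_|/H ->]; rewrite ?mulr1 ?mul0r.
Qed.

End RowSpaces.

(** * Tor of a graded free resolution as Koszul homology *)

Section Tor.
Variables (k : fieldType) (n : nat) (I : {mpoly k[n]} -> Prop).
Variable FI : graded_free_resolution I.
Local Notation poly := {mpoly k[n]}.
Local Notation free m := {ffun 'I_(rk FI m) -> poly}.
Local Notation hom m := (homv (@dgs k n I FI m)).
Local Notation syz m := (@syz k n I FI m).
Local Notation hmult m d := (@mult k n (free m) muv (hom m d)).
Implicit Types (d j : int).

Definition ev m (v : free m) : 'rV[k]_(rk FI m) := \row_a (v a)@_0%MM.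

Lemma ev_linear m : linear (@ev m).
Proof. by move=> c u v; apply/rowP => a; rewrite !mxE !ffunE mcoeffD mcoeffZ. Qed.

Lemma ev_eq0 m (v : free m) : ev v = 0 <-> (forall a, (v a)@_0%MM = 0).
Proof.
split=> [/rowP H a|H]; first by have := H a; rewrite !mxE.
by apply/rowP => a; rewrite !mxE.
Qed.

Lemma hmultP m d v : hmult m (d - 1%:Z) v <-> hom m d v /\ ev v = 0.
Proof.
have e : d - 1%:Z + 1 = d by rewrite subrK.
split=> [mv|[hv]]; last by rewrite ev_eq0 => v0; apply/free_max_ideal => //; rewrite e.
have hv : hom m d v.
  case: mv => c cA ->; rewrite -[d]e.
  have := kchain_bd (@muv_linear k n _) (@subspace_homv k n _ (@dgs k n I FI m) _) (@homv_muv k n _ _ _) cA.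
  by move/(_ set0); rewrite cards0.
by split=> //; apply/ev_eq0/(free_max_ideal (d := d - 1%:Z)); rewrite ?e.
Qed.

Lemma ev_delta m (v : free m.+2) : ev (delta v) = (ev v : 'rV[k]_(res_rank FI m.+1)) *m tor_diff FI m.
Proof.
apply/rowP => b; rewrite !mxE ffunE raddf_sum; apply: eq_bigr => a _.
by rewrite !mxE /= rmorphM.
Qed.

Lemma ev_chain m d (v : free m.+1) : hom m.+1 d v -> (ev v <= tor_chain FI m d)%MS.
Proof.
move=> hv; apply/(sub_diag_mx (fun a : 'I_(res_rank FI m) => res_deg a == d)) => a ad.
rewrite mxE; apply/eqP; apply: contraR ad; rewrite -mcoeff_msupp => /hv /eqP.
by rewrite mdeg0 eq_sym subr_eq0 eq_sym.
Qed.

Lemma chain_ev m d (u : 'rV[k]_(res_rank FI m)) : (u <= tor_chain FI m d)%MS ->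
  exists2 v : free m.+1, hom m.+1 d v & ev v = u.
Proof.
move=> /(sub_diag_mx (fun a : 'I_(res_rank FI m) => res_deg a == d)) ud.
pose v : free m.+1 := [ffun a : 'I_(res_rank FI m) => (u 0 a)%:MP].
exists v; last by apply/rowP => a; rewrite mxE ffunE mcoeffC eqxx mulr1.
move=> a m'; rewrite ffunE msuppC; case: eqP => // /eqP ua; rewrite inE => /eqP ->.
by rewrite mdeg0; apply/eqP; rewrite eq_sym subr_eq0 eq_sym; apply: contraR ua => /ud ->.
Qed.

(** Vanishing modulo the variables. At index 0 there is no condition, since Tor in homological
    degree 0 is all of [I] modulo the variables times [I]. *)
Definition top_part m : free m -> Prop := if m is 0 then fun=> True else fun v => ev v = 0.

Lemma sub_tor_ker m (v : free m.+1) : (ev v <= tor_ker FI m)%MS <-> top_part (delta v).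
Proof.
case: m v => [|m] v /=; first by rewrite submx1.
by rewrite ev_delta; split=> [/sub_kermxP|/sub_kermxP].
Qed.

Lemma fin_hom m d : @fin k (free m) (hom m d). Proof. exact: fin_homv. Qed.

Lemma rank_boundaries m j : (dim (syz m.+1 j) =
  dim (fun v => syz m.+1 j v /\ hmult m.+1 (j - 1%:Z) v)
  + \rank (tor_chain FI m.+1 j *m tor_diff FI m))%N.
Proof.
rewrite (rank_nullity (@ev_linear m.+1) (fin_syz _ _ _)); congr addn.
  apply: dim_ext => v; split=> [[sv v0]|[sv /hmultP[_ v0]]]; split=> //.
  by apply/hmultP; split=> //; case: sv => w hw ->; apply: delta_homv.
rewrite -(dimE (has_dim_row_space _)); apply: dim_ext => u; split.
  case=> _ [w hw ->] ->; rewrite ev_delta; apply: submxMr; exact: ev_chain.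
case/submxP => w ->; have [|v hv vw] := @chain_ev m.+1 j (w *m tor_chain FI m.+1 j).
  exact: submxMl.
exists (delta v); first by exists v.
by rewrite ev_delta vw mulmxA.
Qed.

(** The dimension of [C] is computed twice: reduction modulo the variables has kernel [hmult] and
    the Tor cycles as image, while [delta] has the next syzygies as kernel and the right-most space
    as image. *)
Lemma rank_cycles m j :
  (\rank (tor_chain FI m j :&: tor_ker FI m)%MS + dim (hmult m.+1 (j - 1%:Z)%R) =
   dim (syz m.+1 j) + dim (fun w => syz m j w /\ top_part w))%N.
Proof.
pose C v := hom m.+1 j v /\ top_part (delta v).
have sC : @subspace k (free m.+1) C.
  apply: subspaceI; first exact: subspace_homv.
  apply: (subspace_pre (U := @top_part m)); first exact: delta_linear.
  case: (m) => [|m'] //=; exact: (subspace_ker (@ev_linear m'.+1)).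
have fC : @fin k (free m.+1) C by apply: (fin_sub (@fin_hom m.+1 j)) => // v [].
have E1 := rank_nullity (@ev_linear m.+1) fC.
have E2 := rank_nullity (@delta_linear k n I FI m) fC.
have -> : \rank (tor_chain FI m j :&: tor_ker FI m)%MS = dim (img (@ev m.+1) C).
  rewrite -(dimE (has_dim_row_space _)); apply: dim_ext => u; rewrite sub_capmx; split.
    case/andP => /chain_ev[v hv <-] /sub_tor_ker vk; by exists v.
  by case=> v [hv /sub_tor_ker vk] ->; rewrite vk ev_chain.
have -> : dim (hmult m.+1 (j - 1%:Z)%R) = dim (fun v => C v /\ ev v = 0).
  apply: dim_ext => v; rewrite hmultP; split=> [[hv v0]|[[hv _] v0]]; split=> //; split=> //.
  by apply/sub_tor_ker; rewrite v0 sub0mx.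
have -> : dim (syz m.+1 j) = dim (fun v => C v /\ delta v = 0).
  rewrite -kerd_syz; apply: dim_ext => v; split=> [[hv v0]|[[hv _] v0]]; split=> //; split=> //.
  rewrite v0; case: (m) => [|m'] //=; exact: (lin0 (@ev_linear m'.+1)).
have -> : dim (fun w => syz m j w /\ top_part w) = dim (img (@delta k n I FI m) C).
  apply: dim_ext => w; split=> [[[v hv ->] tv]|[v [hv tv] ->]]; first by exists v.
  by split=> //; exists v.
by rewrite addnC -E1 E2.
Qed.

Lemma fin_top_part m j : fin (fun w => syz m j w /\ top_part w).
Proof.
apply: (fin_sub (fin_syz FI m j)) => [|v []//]; apply: subspaceI.
  exact: fin_subspace (fin_syz FI m j).
case: (m) => [|m'] //=; exact: (subspace_ker (@ev_linear m'.+1)).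
Qed.

Lemma mult_syz_le m j :
  (dim (mult muv (syz m (j - 1%:Z)%R)) <= dim (fun w => syz m j w /\ top_part w))%N.
Proof.
apply: dim_le; last 1 first.
- move=> v mv; have [c cs ve] := mv; split.
    have mulS d x (w : free m) : syz m d w -> syz m (d + 1) (muv x w).
      by case=> w' hw ->; exists (muv x w'); [apply: homv_muv | rewrite delta_muv].
    have := kchain_bd (@muv_linear k n _) (fin_subspace (fin_syz FI m _)) (@mulS _) cs.
    by move/(_ set0); rewrite cards0 subrK -ve.
  case: m c cs {ve} v mv => [|m] //= c cs v mv.
  suff /hmultP[] : hmult m.+1 (j - 1%:Z) v by [].
  case: mv => c' c's ->; exists c' => // F; have := c's F; case: ifP => // _ [w hw ->].
  exact: delta_homv.
- apply: (fin_img (bd_set0_linear (@muv_linear k n _))).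
  exact: (fin_kchain n 1 (fin_syz FI m _)).
exact: fin_top_part.
Qed.

(** Tor is the [top_part] of the syzygies modulo the variables times the syzygies. The resolution
    need not be minimal: the rank of its reduced differential cancels between cycles and
    boundaries. *)
Lemma tor_dim_syz m j : (tor_dim FI m j)%:Z =
  (dim (fun w => syz m j w /\ top_part w))%:Z - (dim (mult muv (syz m (j - 1%:Z)%R)))%:Z.
Proof.
have E1 := rank_boundaries m j; have E2 := rank_cycles m j.
have E3 := dim_mult_hom FI m j; have E4 := mult_syz_le m j.
rewrite /tor_dim; move: E1 E2 E3 E4.
move: (\rank _) (\rank _) (dim _) (dim _) (dim _) (dim _) (dim _); clear; lia.
Qed.

Lemma dim_kcyc0 (V : lmodType k) (mu : 'I_n -> V -> V) (mul : forall x, linear (mu x)) (U : V -> Prop) :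
  fin U -> dim (kcyc mu U 0) = dim U.
Proof.
move=> fU; rewrite -[RHS]mul1n -(bin0 n) -dim_kchain //; apply: dim_ext => c.
split=> [[]//|cU]; split=> //; apply/ffunP => G; rewrite !ffunE; apply: big1 => x.
rewrite inE => /andP[xG _]; have := cU (x |: G); rewrite cardsU1 xG => ->.
by rewrite (lin0 (mul x)) scaler0.
Qed.

Lemma tor_dim_kbetti i j : (tor_dim FI i j)%:Z = kbetti muv (syz 0) i j.
Proof.
rewrite tor_dim_syz; case: i => [|i].
  have E := dim_mult (@muv_linear k n _) (fin_syz FI 0 (j - 1%:Z)).
  rewrite /kbetti /= subr0 bin1 E (dim_kcyc0 (@muv_linear k n _) (fin_syz FI 0 j)).
  have -> : dim (fun w => syz 0 j w /\ True) = dim (syz 0 j).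
    by apply: dim_ext => w; split=> [[]|].
  move: (dim _) (dim _) (dim _); clear; lia.
rewrite syz_kbetti syz_step1; congr (Posz _ - _).
apply: dim_ext => v; split=> [[sv v0]|[sv /hmultP[_ v0]]]; split=> //.
by apply/hmultP; split=> //; case: sv => w hw ->; apply: delta_homv.
Qed.

Definition lift1 (f : poly) : {ffun 'I_1 -> poly} := [ffun=> f].

Lemma lift1_linear : linear lift1.
Proof. by move=> a u v; apply/ffunP => i; rewrite !ffunE. Qed.

Lemma syz0_lift1 d : syz 0 d = img lift1 (piece I d).
Proof.
apply: pred_ext => v; rewrite syz0; split=> [pv|[f pf ->]]; last by rewrite ffunE.
by exists (v ord0) => //; apply/ffunP => a; rewrite ffunE (ord1 a).
Qed.

Lemma lift1_eq0 f : lift1 f = 0 -> f = 0.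
Proof. by move/ffunP/(_ ord0); rewrite !ffunE. Qed.

Lemma fin_piece (sI : subspace I) d : fin (piece I d).
Proof.
apply: (fin_of_inj lift1_linear _ (fin_syz FI 0 d)) => [|f pf|f _]; last exact: lift1_eq0.
  exact: subspace_piece.
by rewrite syz0_lift1; exists f.
Qed.

Lemma dim_syz0 (sI : subspace I) d : dim (syz 0 d) = dim (piece I d).
Proof.
rewrite syz0_lift1 (dim_inj lift1_linear (fin_piece sI d)) // => f _; exact: lift1_eq0.
Qed.

Lemma dim_kcyc_syz0 (sI : subspace I) p d :
  dim (kcyc muv (syz 0 d) p) = dim (kcyc mulX (piece I d) p).
Proof.
pose up (c : {ffun {set 'I_n} -> poly}) : {ffun {set 'I_n} -> {ffun 'I_1 -> poly}} := [ffun F => lift1 (c F)].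
have upl : linear up by move=> a u v; apply/ffunP => F; rewrite !ffunE lift1_linear.
have up0 c : up c = 0 -> c = 0.
  by move=> /ffunP H; apply/ffunP => F; have := H F; rewrite !ffunE => /lift1_eq0.
have bd_up c : bd muv setT (up c) = up (bd mulX setT c).
  apply/ffunP => F; apply/ffunP => a; rewrite bd_muvE.
  have -> : up (bd mulX setT c) F a = bd mulX setT c F by rewrite /up ffunE ffunE.
  congr (bd _ _ _ _).
  by apply/ffunP => G; rewrite !ffunE.
rewrite -(dim_inj upl (fin_kcyc mulX_linear p (fin_piece sI d))) => [|c _]; last exact: up0.
apply: dim_ext => c; split=> [[cs c0]|[b [bI b0] ->]].
  have cE : c = up [ffun F => c F ord0].
    by apply/ffunP => F; apply/ffunP => a; rewrite !ffunE (ord1 a).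
  exists [ffun F => c F ord0] => //; split.
    move=> F; rewrite ffunE; have := cs F; case: ifP => _; first by rewrite syz0.
    by move=> ->; rewrite ffunE.
  by apply: up0; rewrite -bd_up -cE.
split; last by rewrite bd_up b0; apply: lin0.
move=> F; rewrite ffunE; have := bI F; case: ifP => _ => [pF|->]; last exact: (lin0 lift1_linear).
by rewrite syz0_lift1; exists (b F).
Qed.

Lemma tor_dim_piece (sI : subspace I) i j : (tor_dim FI i j)%:Z = kbetti mulX (piece I) i j.
Proof. by rewrite tor_dim_kbetti /kbetti /= !dim_kcyc_syz0 // dim_syz0. Qed.

End Tor.

(** * Monomial ideals *)

Section MonomialIdeals.
Variables (k : fieldType) (n : nat).
Local Notation poly := {mpoly k[n]}.
Implicit Types (f g : poly) (I L A : poly -> Prop) (m u v : 'X_{1..n}) (D : 'X_{1..n} -> Prop).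

Lemma ideal_gen_ideal A : is_ideal (ideal_gen A).
Proof.
split=> [|p q [s [sA ->]] [t [tA ->]]|a p [s [sA ->]]].
- by exists [::]; rewrite big_nil.
- exists (s ++ t); rewrite big_cat; split=> // x; rewrite mem_cat => /orP[/sA|/tA] //.
exists [seq (a * x.1, x.2) | x <- s]; split=> [_ /mapP[x xs ->]|]; first exact: sA xs.
by rewrite big_map mulr_sumr; apply: eq_bigr => x _; rewrite mulrA.
Qed.

Lemma ideal_gen_mem A f : A f -> ideal_gen A f.
Proof.
move=> Af; exists [:: (1, f)]; rewrite big_seq1 mul1r; split=> // x.
by rewrite inE => /eqP ->.
Qed.

Lemma ideal_mulX_le I m u : is_ideal I -> I 'X_[m] -> (m <= u)%MM -> I 'X_[u].
Proof. by move=> [_ _ IM] Im /submK <-; rewrite mpolyXD; apply: IM. Qed.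

Lemma mcoeff_mulXm f m u : (f * 'X_[m])@_u != 0 -> (m <= u)%MM.
Proof.
rewrite -mcoeff_msupp => /msuppM_le/allpairsP[[a b] /= [_]].
rewrite msuppX inE => /eqP -> ->; apply/mnm_lepP => i; rewrite mnmDE; exact: leq_addl.
Qed.

Lemma ideal_gen_monomials A D f : (forall g, A g <-> exists2 m, D m & g = 'X_[m]) ->
  ideal_gen A f <-> (forall u, f@_u != 0 -> exists2 m, D m & (m <= u)%MM).
Proof.
move=> AD; have gI := ideal_gen_ideal A; split=> [[s [sA ->]] u|H].
  rewrite raddf_sum /= big_seq => nz; have [x xs] : exists2 x, x \in s & (x.1 * x.2)@_u != 0.
    apply/hasP; apply: contraR nz => /hasPn H; apply/eqP; apply: big1 => x xs.
    by apply/eqP; have := H x xs; rewrite negbK.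
  by have /AD[m Dm ->] := sA x xs => /mcoeff_mulXm; exists m.
rewrite (mpolyE f) big_seq; apply: (subspace_sum _ (ideal_subspace gI)) => u.
rewrite mcoeff_msupp => /H[m Dm mu]; apply: (subspaceZ _ (ideal_subspace gI)).
by apply: (ideal_mulX_le gI _ mu); apply: ideal_gen_mem; apply/AD; exists m.
Qed.

Lemma monomial_ideal_coeff I f u : monomial_ideal I -> I f -> f@_u != 0 -> I 'X_[u].
Proof.
case=> D ID /ID If fu; apply/ID.
have H g := @ideal_gen_monomials _ D g (fun g => iff_refl _).
have /(_ u fu)[m Dm mu] := (H f).1 If.
apply/H => u'; rewrite mcoeffX; case: (eqVneq u u') => [<- _|_]; first by exists m.
by rewrite eqxx.
Qed.

Lemma initial_monomial I u : I 'X_[u] -> initial I u.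
Proof.
move=> Iu; apply/initialP; exists 'X_[u]; split.
- by split=> // m; rewrite msuppX inE => /eqP ->.
- by rewrite mcoeffX eqxx oner_neq0.
move=> m um; rewrite mcoeffX; case: (eqVneq u m) => // e.
by rewrite e Order.POrderTheory.ltxx in um.
Qed.

Lemma graded_dim_piece I d h : graded_dim I d h <-> has_dim (piece I d%:Z) h.
Proof.
have E p : (I p /\ p \is d.-homog) <-> piece I d%:Z p.
  split=> -[Ip hp]; split=> //; first by move=> m /(dhomog_mf hp) ->.
  by apply/dhomogP => m /hp [].
by split=> -[b [bP bf]]; exists b; split=> // p; rewrite -bP E.
Qed.

Lemma dim_piece_neg I i : I 0 -> piece I (Negz i) = (fun f => f = 0).
Proof.
move=> I0; apply: pred_ext => f; split=> [[_ hf]|->]; last by split=> // m; rewrite msupp0.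
apply/mpolyP => m; rewrite mcoeff0; have [//|] := eqVneq f@_m 0.
by rewrite -mcoeff_msupp => /hf.
Qed.

End MonomialIdeals.

(** If x divides both [m i] and [m j] with [i < j], then [m j] times [m i / x] is a multiple of
    [m i]. Regularity puts [m i / x] into the ideal of the earlier monomials, so some [m l] divides
    it. This [m l] has smaller degree than [m i], hence [l < i], and it divides [m i]; regularity at
    i then puts 1 into an ideal generated by monomials of positive degree. *)
Lemma regular_monomials_coprime (k : fieldType) (n r : nat) (m : 'I_r -> 'X_{1..n}) :
  (forall i, 0 < mdeg (m i))%N -> (forall i j : 'I_r, i <= j -> mdeg (m i) <= mdeg (m j))%N ->
  regular_sequence (fun i => 'X_[k, m i]) ->
  forall (i j : 'I_r) x, i != j -> (0 < m i x)%N -> m j x = 0%N.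
Proof.
move=> m0 mono [reg _].
pose J (i : 'I_r) := ideal_gen (fun p => exists2 j : 'I_r, (j < i)%N & p = 'X_[k, m j]).
have JP i f : J i f <-> (forall u, f@_u != 0 -> exists2 l : 'I_r, (l < i)%N & (m l <= u)%MM).
  have H := @ideal_gen_monomials k n _ (fun u => exists2 l : 'I_r, (l < i)%N & u = m l) f.
  rewrite /J H => [|g].
    by split=> K u /K => [[_ [l li ->]]|[l li]] lu; [exists l | exists (m l) => //; exists l].
  by split=> [[l li ->]|[_ [l li ->] ->]]; [exists (m l) => //; exists l | exists l].
have JX i u : J i 'X_[u] <-> exists2 l : 'I_r, (l < i)%N & (m l <= u)%MM.
  rewrite JP; split=> [/(_ u)|[l li lu] v].
    by rewrite mcoeffX eqxx oner_neq0; apply.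
  by rewrite mcoeffX; case: (eqVneq u v) => [<- _|_]; [exists l | rewrite eqxx].
suff cop (i j : 'I_r) x : (i < j)%N -> (0 < m i x)%N -> (0 < m j x)%N -> False.
  move=> i j x ij mi; apply/eqP; rewrite -leqn0 leqNgt; apply/negP => mj.
  move: ij; rewrite -(inj_eq val_inj) neq_ltn => /orP[] lt; [exact: cop lt mi mj | exact: cop lt mj mi].
move=> ij mi mj.
have /reg/JX[l lj lu] : J j ('X_[m j] * 'X_[m i - U_(x)]).
  rewrite -[m j](addmUK mj) -mpolyXD -addmA [(U_(x) + _)%MM]addmC addmUK // JX.
  by exists i => //; apply/mnm_lepP => z; rewrite mnmDE leq_addl.
have li : (l < i)%N.
  rewrite ltnNge; apply/negP => /mono; apply/negP; rewrite -ltnNge.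
  have -> : mdeg (m i) = (mdeg (m i - U_(x))).+1 by rewrite -[in LHS](addmUK mi) mdegD mdeg1 addn1.
  by rewrite ltnS -(submK lu) mdegD leq_addl.
have /reg : J i ('X_[m i] * 1).
  rewrite mulr1 JX; exists l => //; apply: (lepm_trans lu); apply/mnm_lepP => z.
  by rewrite mnmBE leq_subr.
rewrite -/(J i 1) -mpolyX0 JX => -[l' _ /mnm_lepP l0].
have := m0 l'; rewrite lt0n mdeg_eq0; case/negP; apply/eqP/mnmP => z.
by have := l0 z; rewrite mnm0E leqn0 => /eqP.
Qed.

(** * Lex-plus-powers ideals degree by degree *)

Section LexPlusPowers.
Variables (k : fieldType) (n r : nat) (hr : (r <= n)%N) (e : 'I_r -> nat).
Local Notation poly := {mpoly k[n]}.
Variable L : poly -> Prop.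
Hypothesis L_lex : lex_plus (pure_powers hr e) L.
Implicit Types (f g : poly) (u v : 'X_{1..n}).

Lemma pure_powersP f : pure_powers hr e f <->
  (forall u, f@_u != 0 -> exists i : 'I_r, (e i <= u (widen_ord hr i))%N).
Proof.
rewrite /pure_powers (ideal_gen_monomials
  (D := fun u => exists i : 'I_r, u = (U_(widen_ord hr i) *+ e i)%MM)) => [|g].
  split=> H u /H => [[_ [i ->] /mnm_lepP/(_ (widen_ord hr i))]|[i iu]].
    by rewrite mulmnE mnm1E eqxx mul1n; exists i.
  exists (U_(widen_ord hr i) *+ e i)%MM; first by exists i.
  apply/mnm_lepP => z; rewrite mulmnE mnm1E; case: eqP => [<-|_]; first by rewrite mul1n.
  by rewrite mul0n.
split=> [[i ->]|[_ [i ->] ->]]; first by exists (U_(widen_ord hr i) *+ e i)%MM; rewrite ?mpolyXn; [exists i |].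
by exists i; rewrite mpolyXn.
Qed.

Lemma lex_plus_subspace : subspace L.
Proof.
case: L_lex => Lh [[D LhD] _] LE.
have sLh : subspace Lh.
  have [L0 LD] := ideal_subspace (ideal_gen_ideal (fun p : poly => exists2 m, D m & p = 'X_[m])).
  by split=> [|a u v /LhD Lu /LhD Lv]; apply/LhD => //; apply: LD.
have sP : subspace (pure_powers hr e : poly -> Prop) by apply/ideal_subspace/ideal_gen_ideal.
split=> [|a _ _ /LE[u [w [Lu Pw ->]]] /LE[u' [w' [Lu' Pw' ->]]]]; apply/LE.
  by exists 0, 0; rewrite addr0; split=> //; [case: sLh | case: sP].
exists (a *: u + u'), (a *: w + w'); split; [exact: sLh.2 | exact: sP.2 |].
by rewrite scalerDr addrACA.
Qed.

Lemma lex_plus_powers u i : (e i <= u (widen_ord hr i))%N -> L 'X_[u].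
Proof.
case: L_lex => Lh [[D LhD] _] LE iu; apply/LE; exists 0, 'X_[u]; rewrite add0r; split=> //.
  by apply/LhD; case: (ideal_gen_ideal (fun p : poly => exists2 m, D m & p = 'X_[m])).
apply/pure_powersP => v; rewrite mcoeffX; case: (eqVneq u v) => [<- _|_]; last by rewrite eqxx.
by exists i.
Qed.

(** Adding the two summands of [f] creates no new monomials, so [u] occurs in the lex summand or in
    the powers. *)
Lemma lex_plus_coeff f u : L f -> f@_u != 0 ->
  (forall v, mdeg u = mdeg v -> (u = v \/ lex_lt u v) -> L 'X_[v]) \/
  (exists i : 'I_r, (e i <= u (widen_ord hr i))%N).
Proof.
case: L_lex => Lh [mLh lexLh] LE /LE[a [b [La Pb ->]]]; rewrite mcoeffD => nz.
have [bu|bu] := eqVneq b@_u 0; last by right; move/pure_powersP: Pb; apply.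
left; have Lu : Lh 'X_[u] by apply: (monomial_ideal_coeff mLh La); rewrite bu addr0 in nz.
have LhL v : Lh 'X_[v] -> L 'X_[v].
  move=> Lv; apply/LE; exists 'X_[v], 0; rewrite addr0; split=> //.
  by case: (ideal_gen_ideal (fun p : poly => exists i : 'I_r, p = 'X_(widen_ord hr i) ^+ e i)).
by move=> v dv [<-|uv]; apply: LhL => //; apply: lexLh uv Lu.
Qed.

Lemma lex_plus_initial u : initial L u -> L 'X_[u].
Proof.
case/initialP => f [[Lf _] fu _].
case: (lex_plus_coeff Lf fu) => [H|[i]]; [by apply: H => //; left | exact: lex_plus_powers].
Qed.

(* Exponents above d impose no condition in degree d. *)
Definition expo d (x : 'I_n) : nat := if insub (val x) is Some i then minn (e i) d.+1 else d.+1.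

Lemma expo_widen d i : expo d (widen_ord hr i) = minn (e i) d.+1.
Proof. by rewrite /expo /= insubT //= => H; congr (minn (e _) _); apply: val_inj. Qed.

Lemma expo_ge d (x : 'I_n) : (r <= x)%N -> expo d x = d.+1.
Proof. by move=> rx; rewrite /expo insubN // -leqNgt. Qed.

Lemma expo_lt d (x : 'I_n) : (x < r)%N -> exists2 i : 'I_r, x = widen_ord hr i & expo d x = minn (e i) d.+1.
Proof.
move=> xr; have xE : x = widen_ord hr (Ordinal xr) by apply: val_inj.
by exists (Ordinal xr); rewrite // -expo_widen -xE.
Qed.

Lemma lex_plus_lexp d : lexp (vars n) d (expo d) (initial L).
Proof.
split=> [x u _|u v]; rewrite !mon_vars => /eqP du.
  have ud : (u x <= d)%N by rewrite -du mdegE (bigD1 x) //= leq_addr.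
  move=> xu; apply/initial_monomial; case: (ltnP x r) => [/(expo_lt d)[i xE]|/(expo_ge d)] E.
    apply: (@lex_plus_powers u i); rewrite -xE; move: xu; rewrite E geq_min => /orP[//|].
    by rewrite ltnNge ud.
  by move: xu; rewrite E ltnNge ud.
move=> /eqP dv nP /initialP[f [[Lf _] fu _]] uv; apply: initial_monomial.
have duv : mdeg u = mdeg v by rewrite du dv.
case: (lex_plus_coeff Lf fu) => [H|[i iu]].
  apply: H => //; right; case/(ltmcP duv): uv => x xj lt; exists x; split=> // j jx.
  by rewrite xj.
case/negP: nP; apply/hasP; exists (widen_ord hr i); first exact: mem_vars.
by rewrite expo_widen geq_min iu.
Qed.

End LexPlusPowers.

Theorem theorem9p2 (k : fieldType) (n r : nat) (hr : (r <= n)%N)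
  (e : 'I_r -> nat)
  (e_ge2 : forall i : 'I_r, (2 <= e i)%N)
  (e_mono : forall i j : 'I_r, (i <= j)%N -> (e i <= e j)%N)
  (I : {mpoly k[n]} -> Prop) (I_homog : homogeneous_ideal I)
  (m : 'I_r -> 'X_{1..n})
  (f_deg : forall i : 'I_r, mdeg (m i) = e i)
  (f_in_I : forall i : 'I_r, I ('X_[k, m i]))
  (f_regular : regular_sequence (fun i : 'I_r => 'X_[k, m i]))
  (L : {mpoly k[n]} -> Prop) (L_lex : lex_plus (pure_powers hr e) L)
  (H : nat -> nat) (I_hilb : hilbert_function I H) (L_hilb : hilbert_function L H)
  (FI : graded_free_resolution I) (FL : graded_free_resolution L) :
  consecutive_cancellations (betti FI) (betti FL).
Proof.
have [iI _] := I_homog; have sI := ideal_subspace iI.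
have sL := lex_plus_subspace L_lex.
have m0 i : (0 < mdeg (m i))%N by rewrite f_deg; apply: leq_trans (e_ge2 i).
have cop : forall (i j : 'I_r) x, i != j -> (0 < m i x)%N -> m j x = 0%N.
  apply: (regular_monomials_coprime m0 _ f_regular) => i j ij; rewrite !f_deg; exact: e_mono.
have pI d : has_dim (piece I d%:Z) (H d) by apply/graded_dim_piece.
have pL d : has_dim (piece L d%:Z) (H d) by apply/graded_dim_piece.
have fI d : fin (piece I d%:Z) by exists (H d).
have fL d : fin (piece L d%:Z) by exists (H d).
have pN i : piece I (Negz i) = piece L (Negz i).
  by rewrite !dim_piece_neg //; [case: sL | case: sI].
have hE d : dim (piece I d) = dim (piece L d).
  by case: d => d; [rewrite (dimE (pI d)) (dimE (pL d)) | rewrite pN].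
pose z (J : {mpoly k[n]} -> Prop) p d := dim (kcyc mulX (piece J d) p).
have expo_mono d (x y : 'I_n) : (y < x)%N -> (expo e d y <= expo e d x)%N.
  move=> yx; case: (ltnP x r) => [xr|/(expo_ge e d) ->]; last first.
    case: (ltnP y r) => [/(expo_lt hr e d)[i _ ->]|/(expo_ge e d) -> //]; exact: geq_minr.
  have [i xE ->] := expo_lt hr e d xr; have [j yE ->] := expo_lt hr e d (ltn_trans yx xr).
  rewrite leq_min geq_minr andbT; apply: leq_trans (geq_minl _ _) _; apply: e_mono.
  by move: yx; rewrite xE yE => /ltnW.
have zle p d : (z I p d <= z L p d)%N.
  case: d => d; last by rewrite /z pN.
  apply: leq_trans (kcyc_initial_le p sI (fI d)) _.
  apply: leq_trans (kcyc_monomial_ge p sL (fL d) (lex_plus_initial L_lex)).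
  apply: (@cycles_coprime n k r hr _ p d (expo e d) _ _ m).
  - exact: vars_decreasing.
  - exact: mem_vars.
  - exact: m0.
  - exact: cop.
  - exact: expo_mono.
  - by move=> i; rewrite expo_widen f_deg.
  - by move=> x; apply: expo_ge.
  - move=> i u _ /mnm_lepP mu; apply: initial_monomial; exact: ideal_mulX_le (f_in_I i) mu.
  - exact: lex_plus_lexp.
  by rewrite -!dim_piece // (dimE (pI d)) (dimE (pL d)).
(* By [zle] the truncated subtraction is exact. The value 0 in row -1 fits the formula, because z_0
   is the dimension and [I] and [L] have the same one in each degree. *)
exists (fun i j => if i is Posz i' then
  (z L i'.+1 (j - i'.+1%:Z)%R - z I i'.+1 (j - i'.+1%:Z)%R)%N else 0%N).
have step i j : (tor_dim FI i j)%:Z = (tor_dim FL i j)%:Z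
  - ((z L i (j - i%:Z)%R)%:Z - (z I i (j - i%:Z)%R)%:Z)
  - (z L i.+1 (j - i.+1%:Z)%R - z I i.+1 (j - i.+1%:Z)%R)%N%:Z.
  rewrite !tor_dim_piece // /kbetti /= -/(z _ _ _) hE.
  have := zle i.+1 (j - i.+1%:Z); rewrite -!/(z _ _ _).
  move: (z _ _ _) (z _ _ _) (z _ _ _) (z _ _ _) (dim _); clear; lia.
case=> [[|i]|i] j.
- rewrite /betti step /z (dim_kcyc0 mulX_linear (fin_piece FL sL _)).
  by rewrite (dim_kcyc0 mulX_linear (fin_piece FI sI _)) hE subrr subr0 addr0.
- rewrite /betti step.
  have -> : Posz i.+1 - 1 = Posz i by lia.
  rewrite /=; have := zle i.+1 (j - i.+1%:Z).
  move: (z L i.+1 _) (z I i.+1 _) (z L i.+2 _) (z I i.+2 _) (tor_dim _ _ _); clear; lia.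
by have -> : Negz i - 1 = Negz i.+1 by lia.
Qed.
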